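(* Let $m\ge1$ be an odd integer, and let $k\ge0$ and $n\ge k+m$ be integers. For every $\mathcal{Z}\in\mathrm{Mat}_{n,k+m}^{>0}$ and every $Y\in\mathcal{A}_{n,k,m}^{>0}$, the crossing number $c_{n,k,m}(Y,\mathcal{Z})$ is independent of $Y$ and of $\mathcal{Z}$, and it equals $$c_{n,k,m}(Y,\mathcal{Z})=\begin{cases}\dfrac{2k+m-1}{m+1}\dbinom{\frac{k+m-2}{2}}{\frac{m-1}{2}} & \text{for } k \text{ odd},\\[2mm] 2\dbinom{\frac{k+m-1}{2}}{\frac{m+1}{2}} & \text{for } k\text{ even}.\end{cases}$$
   Context: $[n]=\{1,\dots,n\}$. $\mathrm{Gr}_{k,n}$ is the real Grassmannian of $k$-planes in $\mathbb{R}^n$, a point being represented by a $k\times n$ matrix whose rows span it; $\mathrm{Gr}_{k,n}^{>0}$ is the set of points having a representative all of whose maximal minors are $>0$. $\mathrm{Mat}_{n,k+m}^{>0}$ is the set of real $n\times(k+m)$ matrices all of whose maximal minors (rows in increasing order) are positive; the rows of $\mathcal{Z}$ are $\mathcal{Z}_1,\dots,\mathcal{Z}_n\in\mathbb{R}^{k+m}$. For $k+m\le n$, $\mathcal{A}_{n,k,m}^{>0}\subset\mathrm{Gr}_{k,k+m}$ (depending on $\mathcal{Z}$) is the image of $\mathrm{Gr}_{k,n}^{>0}$ under the map sending the point represented by $C$ to the point represented by $C\mathcal{Z}$. Crossing number. Write $m=2r-1$. For $Y\in\mathrm{Gr}_{k,k+m}$ let $V_Y=\mathbb{R}^{k+m}/Y\simeq\mathbb{R}^m$,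 $\pi_Y$ the quotient map, and $Z_i=\pi_Y(\mathcal{Z}_i)$. Consider all index sets $K=\{i_1,i_1+1,\dots,i_r,i_r+1\}\subset[n]$ with $i_1<i_1+1<i_2<\dots<i_r<i_r+1$. For each such $K$ and each nonempty subset $J\subset K$ for which the points $Z_j$, $j\in J$, are affinely independent in $V_Y$, the cell $\mathfrak{C}(J)$ is the relative interior of the convex hull of $\{Z_j: j\in J\}$ (for $|J|=1$ it is the point $Z_j$). A cell is identified by its index set $J$ (a cell occurring for several $K$ is counted once). The crossing number $c_{n,k,m}(Y,\mathcal{Z})$ is the number of cells containing the origin of $V_Y$. *)

(* Defs.v *)
From HB Require Import structures.
From mathcomp Require Import all_boot all_order all_algebra.
From mathcomp Require Import all_classical all_reals topology normedtype.

Set Implicit Arguments.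
Unset Strict Implicit.
Unset Printing Implicit Defensive.

Import Order.TTheory GRing.Theory Num.Theory.
Import numFieldNormedType.Exports.

Local Open Scope classical_set_scope.
Local Open Scope ring_scope.

(* Indices 1, ..., n are shifted to 'I_n = {0, ..., n - 1}.                   *)

Section Grassmannian.
Variable R : realType.

Definition increasing (k n : nat) (f : 'I_k -> 'I_n) : Prop :=
  forall a b : 'I_k, (a < b)%N -> (f a < f b)%N.

Definition col_minors_pos (k n : nat) (C : 'M[R]_(k, n)) : Prop :=
  forall f : 'I_k -> 'I_n, increasing f -> 0 < \det (colsub f C).

Definition row_minors_pos (n p : nat) (Z : 'M[R]_(n, p)) : Prop :=
  forall f : 'I_p -> 'I_n, increasing f -> 0 < \det (rowsub f Z).

Definition rowspan (k n : nat) (C : 'M[R]_(k, n)) : {vspace 'rV[R]_n} :=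
  <<[seq row i C | i : 'I_k]>>%VS.

Definition Gr (k n : nat) : set {vspace 'rV[R]_n} := [set V | \dim V = k].

Definition Gr_pos (k n : nat) : set {vspace 'rV[R]_n} :=
  [set V | Gr k V /\
     exists C : 'M[R]_(k, n), rowspan C = V /\ col_minors_pos C].

Definition amplituhedron (k m n : nat) (Z : 'M[R]_(n, k + m)) :
    set {vspace 'rV[R]_(k + m)} :=
  [set Y | exists C : 'M[R]_(k, n),
     Gr_pos k (rowspan C) /\ rowspan (C *m Z) = Y].

(* The quotient R^N / Y is modelled by R^d with d = \dim Y^C = N - \dim Y: a  *)
(* vector is projected onto the complement Y^C along Y and then written in a  *)
(* basis of Y^C.  quot_projP shows that this is a quotient map, i.e. a        *)
(* surjective linear map with kernel Y.                                       *)
Definition quot_proj (N : nat) (Y : {vspace 'rV[R]_N}) (v : 'rV[R]_N) :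
    'rV[R]_(\dim Y^C) :=
  \row_i coord (vbasis Y^C) i (daddv_pi Y^C Y v).

Lemma quot_projP (N : nat) (Y : {vspace 'rV[R]_N}) :
  [/\ linear (quot_proj Y),
      forall v, (quot_proj Y v == 0) = (v \in Y),
      forall w, exists v, quot_proj Y v = w
    & \dim Y^C = (N - \dim Y)%N].
Proof.
have dYC : (Y^C :&: Y = 0)%VS by rewrite capvC capv_compl.
have inS v : v \in (Y^C + Y)%VS by rewrite addvC addv_complf memvf.
split.
- by move=> a u v; apply/rowP => i; rewrite !mxE linearP linearP.
- move=> v; apply/eqP/idP => [h|vY].
    have p0 : daddv_pi Y^C Y v = 0.
      rewrite (coord_vbasis (memv_pi Y^C Y v)) big1 // => i _.
      by move/rowP/(_ i): h; rewrite !mxE => ->; rewrite scale0r.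
    rewrite -(daddv_pi_add dYC (inS v)) p0 add0r; exact: memv_pi.
  have e := daddv_pi_add dYC (inS v).
  rewrite (daddv_pi_id (capv_compl Y) vY) in e.
  have p0 : daddv_pi Y^C Y v = 0 by apply: (addIr v); rewrite e add0r.
  by apply/rowP => i; rewrite !mxE p0 linear0.
- move=> w; exists (\sum_i w 0 i *: (vbasis Y^C)`_i).
  apply/rowP => j; rewrite !mxE daddv_pi_id //.
    by rewrite coord_sum_free // (basis_free (vbasisP _)).
  apply: rpred_sum => i _; apply: rpredZ; apply: vbasis_mem.
  by rewrite mem_nth // size_tuple.
- by rewrite dimv_compl dimvf /dim /= mul1n.
Qed.

End Grassmannian.

Section ConvexGeometry.
Variable R : realType.

Definition affine_hull (V : lmodType R) (A : set V) : set V :=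
  [set x | exists (p : nat) (a : 'I_p -> V) (l : 'I_p -> R),
     [/\ forall i, A (a i), \sum_i l i = 1 & x = \sum_i l i *: a i]].

Definition convex_hull (V : lmodType R) (A : set V) : set V :=
  [set x | exists (p : nat) (a : 'I_p -> V) (l : 'I_p -> R),
     [/\ forall i, A (a i), forall i, 0 <= l i, \sum_i l i = 1
       & x = \sum_i l i *: a i]].

(* Interior relative to the affine hull, for the usual topology of R^d. *)
Definition relative_interior (d : nat) (A : set 'rV[R]_d) : set 'rV[R]_d :=
  [set x | A x /\ \forall y \near x, affine_hull A y -> A y].

(* Independence is that of the family: a repeated point makes it dependent. *)
Definition affinely_independent (V : lmodType R) (I : finType) (z : I -> V)
    (J : {set I}) : Prop :=
  forall l : I -> R,
    \sum_(j in J) l j = 0 -> \sum_(j in J) l j *: z j = 0 ->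
    forall j, j \in J -> l j = 0.

Definition cell (d : nat) (I : finType) (z : I -> 'rV[R]_d) (J : {set I}) :
    set 'rV[R]_d :=
  relative_interior (convex_hull (z @` [set` J])).

End ConvexGeometry.

Section CrossingNumber.

(* K is the union of r pairs {i s, i s + 1} of consecutive indices, where     *)
(* i s + 1 < i t whenever s < t.                                              *)
Definition union_of_consecutive_pairs (n r : nat) (K : {set 'I_n}) : Prop :=
  exists i : 'I_r -> nat,
    [/\ forall s, ((i s).+1 < n)%N,
        forall s t : 'I_r, (s < t)%N -> ((i s).+1 < i t)%N
      & forall j : 'I_n,
          (j \in K) <-> exists s, j = i s :> nat \/ j = (i s).+1 :> nat].

Definition cell_index (R : realType) (n r d : nat) (z : 'I_n -> 'rV[R]_d)
    (J : {set 'I_n}) : Prop :=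
  [/\ exists2 K : {set 'I_n}, union_of_consecutive_pairs r K & J \subset K,
      J != finset.set0
    & affinely_independent z J].

(* Intended for odd m, where m.+1./2 is the r with m = 2 r - 1. *)
Definition crossing_number (R : realType) (k m n : nat)
    (Y : {vspace 'rV[R]_(k + m)}) (Z : 'M[R]_(n, k + m)) : nat :=
  let z (i : 'I_n) := quot_proj Y (row i Z) in
  #|[pred J : {set 'I_n} | `[< cell_index m.+1./2 z J /\ cell z J 0 >]]|.

End CrossingNumber.

(* Main.v *)
(* Let U be the space of vectors Z x with x orthogonal to Y, and W its orthogonal
   complement.  Cells containing the origin correspond to the supports of
   nonnegative vectors of W lying over a union K of r = (m + 1) / 2 consecutive
   pairs.  Total positivity bounds the number of sign changes of every nonzero
   vector of U, whatever signs its zeros are given, between k and k + m - 1.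
   Since a pair of adjacent zeros can absorb two sign changes, no nonzero vector
   of U vanishes on such a K; refinements of this argument show that the cones
   around a cell form, as in a P-matrix linear complementarity problem, a
   complete simplicial fan, so that the number of cells is locally constant in Y
   even where Y is degenerate.  Scaling the last column of C down to 0 therefore
   does not change that number and removes the last point, until n = k + m.
   Then W is the row space of C, the cells are the sets K whose pairs all start
   at indices of the same parity, and they are counted by two binomials. *)

Require Import Defs.
From mathcomp Require Import all_boot all_order all_algebra.
From mathcomp Require Import all_classical all_reals topology normedtype.
From mathcomp Require Import zify ring lra.

Set Implicit Arguments.
Unset Strict Implicit.
Unset Printing Implicit Defensive.

Import Order.TTheory GRing.Theory Num.Theory.
Import numFieldNormedType.Exports.

Local Open Scope ring_scope.

(** * Sign changes *)

(** Around a cell, positivity enters only through [sign_bounded], which is stable under reversal of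
    the indices and still holds at the end of the path, where minors of the scaled [C] may vanish.
    It forces dim U = 2r - 1, one less than the size of K, so every K has exactly one dependency up
    to scale and carries at most one cell. The obstacle is a degenerate Y, at which one cell J lies
    in several K. A small perturbation of Y moves the dependency of each such K, and the signs of
    its entries off J decide whether it still gives a cell. These entries are the coordinates,
    modulo W and R^J, of a vector describing the perturbation. Hence exactly one cell survives near
    J as soon as the cones spanned by the sets K around J cover the space and overlap only in common
    faces. Covering is [cone_cover], the overlap condition is [cone_unique]. Scaling one column is a
    perturbation of rank one, so that the vector in question is a multiple of a fixed one and no
    terms of higher order appear. *)

Definition changes (M : nat) (e : nat -> bool) : nat :=
  (\sum_(j < M) (e j != e j.+1))%N.

(* e j codes the sign (-1)^(e j); it is free where u vanishes. *)
Definition compat (R : realDomainType) (e : nat -> bool) (u : nat -> R) : Prop :=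
  forall j, 0 <= (-1) ^+ e j * u j.

Definition gapped (N : nat) (l : nat -> nat) : Prop :=
  forall s, (s.+1 < N)%N -> ((l s).+2 <= l s.+1)%N.

Lemma gapped_lt (N : nat) (l : nat -> nat) (s t : nat) :
  gapped N l -> (s < t < N)%N -> ((l s).+2 <= l t)%N.
Proof.
move=> gl; elim: t => [|t IH] //= /andP[st tN].
have := gl t tN; rewrite ltnS leq_eqVlt in st.
case/orP: st => [/eqP-> //|st].
by have := IH; rewrite st (ltnW tN) => /(_ isT); lia.
Qed.

(* Filling the zeros of v from the right gives equal signs at l, l + 1 and l + 2
   (or at l - 1, l and l + 1 when l lies beyond the last nonzero entry of v). *)
Definition flat (R : realDomainType) (v : nat -> R) (l : nat) : Prop :=
  (v l.+1 = 0 /\ (v l != 0 -> exists d, [/\ (l < d)%N, 0 < v l * v d &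
     forall j, (l < j < d)%N -> v j = 0])) \/
  (0 < v l * v l.+1 /\ 0 < v l.+1 * v l.+2).

(* The sign vector e' fills the zeros of v from the right; each l s is then the
   start of a constant stretch, one entry of which can be flipped in e. *)
Lemma gain (R : realDomainType) (N M a0 : nat) (l : nat -> nat) (u v : nat -> R) :
  (a0 <= M)%N -> v a0 != 0 -> (forall j, (a0 < j)%N -> v j = 0) ->
  (forall j, u j != 0 -> 0 < u j * v j) ->
  gapped N l -> (forall s, (s < N)%N -> (l s < M)%N) ->
  (forall s, (s < N)%N -> u (l s).+1 = 0 /\ flat v (l s)) ->
  exists e e', [/\ compat e u, compat e' u & changes M e = (changes M e' + N.*2)%N].
Proof.
move=> a0M va0 v0 uv gl lM Hl.
(* The recursion is on the distance to [a0]: a zero of [v] takes the sign of the next nonzero entry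
   to its right. Beyond [a0] the truncated difference is 0, which gives the sign at [a0]. *)
pose F := fix F x := if x is x'.+1 then
   if v (a0 - x'.+1)%N != 0 then v (a0 - x'.+1)%N < 0 else F x' else v a0 < 0.
pose e' j := F (a0 - j)%N.
have e'1 j : v j != 0 -> e' j = (v j < 0).
  move=> vj; have ja : (j <= a0)%N by rewrite leqNgt; apply/negP=> /v0 h; rewrite h eqxx in vj.
  rewrite /e'; case E: (a0 - j)%N => [|x] /=.
    by have -> : j = a0 by lia.
  have -> : (a0 - x.+1)%N = j by lia.
  by rewrite vj.
have e'2 j : v j = 0 -> (j < a0)%N -> e' j = e' j.+1.
  move=> vj ja; rewrite /e'; have -> : (a0 - j)%N = (a0 - j.+1).+1 by lia.
  rewrite /=; have -> : (a0 - (a0 - j.+1).+1)%N = j by lia.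
  by rewrite vj eqxx.
have e'3 j : (a0 <= j)%N -> e' j = e' a0.
  by move=> h; rewrite /e' (eqP h) subnn.
have e'C : compat e' u.
  move=> j; have [->|uj] := eqVneq (u j) 0; first by rewrite mulr0.
  have := uv j uj; have [->|vj] := eqVneq (v j) 0; first by rewrite mulr0 ltxx.
  rewrite e'1 //; case: (ltP (v j) 0) => h; rewrite ?expr1 ?expr0 ?mul1r ?mulN1r; first by nra.
  by have : 0 < v j; [rewrite lt_neqAle eq_sym vj|nra].
(* The entry to flip is the middle of a constant stretch. Beyond [a0] it is [l s] rather than
   [l s + 1], since [l s + 1] may be the end point [M], whose flip would gain only one change. *)
pose f s := if (l s < a0)%N then (l s).+1 else l s.
have la s : (s < N)%N -> l s != a0.
  move=> sN; apply/eqP=> E; case: (Hl s sN) => _ [[_]|[_]].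
    rewrite E => /(_ va0)[d [d1]]; rewrite (v0 d) ?mulr0 ?ltxx //.
  by rewrite E (v0 a0.+2) ?mulr0 ?ltxx.
have tri s : (s < N)%N -> [/\ (0 < f s)%N, (f s < M)%N, u (f s) = 0,
    e' (f s) = e' (f s).+1 & e' (f s).-1 = e' (f s)].
  move=> sN; have [u1 fl] := Hl s sN; have lM' := lM s sN; have lna := la s sN.
  rewrite /f; case: (ltnP (l s) a0) => h.
    have zc d : (l s < d <= a0)%N -> (forall j, (l s < j < d)%N -> v j = 0) ->
         e' (l s).+1 = e' d.
      elim: d => [|d IH] //= /andP[ld da] hz.
      move: ld; rewrite ltnS leq_eqVlt => /orP[/eqP-> //|ld].
      rewrite IH ?ld ?(ltnW da) //; last by move=> j /andP[j1 j2]; apply: hz; rewrite j1 ltnW.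
      by rewrite e'2 // hz // ld /=.
    case: fl => [[v1 vd]|[p1 p2]].
      have la1 : ((l s).+1 < a0)%N.
        by rewrite ltn_neqAle h andbT; apply/eqP=> E; rewrite E in v1; rewrite v1 eqxx in va0.
      split=> //; [by rewrite (leq_trans la1)|by rewrite e'2|].
      rewrite /=; have [vl|vl] := eqVneq (v (l s)) 0; first by rewrite e'2.
      have [d [ld pd hz]] := vd vl.
      have vd0 : v d != 0 by apply/eqP=> E; rewrite E mulr0 ltxx in pd.
      have da : (d <= a0)%N by rewrite leqNgt; apply/negP=> /v0 E; rewrite E eqxx in vd0.
      rewrite (zc d) ?ld // e'1 // e'1 //.
      by apply/idP/idP=> ?; nra.
    have n1 : v (l s).+1 != 0 by apply/eqP=> E; rewrite E mulr0 ltxx in p1.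
    have n0 : v (l s) != 0 by apply/eqP=> E; rewrite E mul0r ltxx in p1.
    have n2 : v (l s).+2 != 0 by apply/eqP=> E; rewrite E mulr0 ltxx in p2.
    have la2 : ((l s).+2 <= a0)%N by rewrite leqNgt; apply/negP=> /v0 E; rewrite E eqxx in n2.
    split=> //=; first by rewrite (leq_trans la2).
      by rewrite !e'1 //; apply/idP/idP=> ?; nra.
    by rewrite !e'1 //; apply/idP/idP=> ?; nra.
  have {}h : (a0 < l s)%N by rewrite ltn_neqAle eq_sym lna.
  split=> //; [by rewrite (leq_ltn_trans _ h)| |by rewrite !e'3 //; lia|by rewrite !e'3 //; lia].
  by apply/eqP; apply: contraT => /uv; rewrite (v0 _ h) mulr0 ltxx.
have fgap s t : (s < t < N)%N -> ((f s).+2 <= f t)%N.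
  move=> st; have := gapped_lt gl st; rewrite /f.
  have sN : (s < N)%N by case/andP: st => /ltn_trans; apply.
  have tN : (t < N)%N by case/andP: st.
  case: (ltnP (l s) a0) => h1; case: (ltnP (l t) a0) => h2 h3; try lia.
  have : (l s).+1 != a0; last by have := la t tN; lia.
  apply/eqP=> E; case: (Hl s sN) => _ [[h _]|[_]]; first by rewrite E in h; rewrite h eqxx in va0.
  by rewrite E (v0 a0.+1) // mulr0 ltxx.
have finj (s t : 'I_N) : f s = f t -> s = t.
  move=> E; apply/val_inj; case: (ltngtP s t) => // h.
    by have := @fgap s t; rewrite h ltn_ord => /(_ isT); lia.
  by have := @fgap t s; rewrite h ltn_ord => /(_ isT); lia.
pose fl j := [exists s : 'I_N, j == f s].
pose e j := e' j (+) fl j.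
have sfl j : (\sum_(s < N) (j == f s) = fl j)%N.
  rewrite /fl; case: existsP => [[s /eqP Ej]|nx] /=.
    rewrite (bigD1 s) //= Ej eqxx big1 // => t ts.
    by case: eqP => // /finj E; rewrite E eqxx in ts.
  by rewrite big1 // => s _; case: eqP => // E; case: nx; exists s; apply/eqP.
exists e, e'; split=> //.
  move=> j; rewrite /e; have [/existsP[s /eqP->]|] := boolP (fl j).
    by have [_ _ -> _ _] := tri s (ltn_ord s); rewrite mulr0.
  by rewrite addbF => _; apply: e'C.
(* Flipped positions are never adjacent, and in [e'] they agree with both neighbours, so every flip
   creates two changes and destroys none. *)
have pt j : ((e j != e j.+1) = (e' j != e' j.+1) + (fl j + fl j.+1) :> nat)%N.
  rewrite /e; have [/existsP[s /eqP Ej]|] := boolP (fl j);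
    have [/existsP[t /eqP Ej1]|] := boolP (fl j.+1); rewrite ?addbF ?addbT //.
  - exfalso; case: (ltngtP s t) => h.
    + by have := @fgap s t; rewrite h ltn_ord => /(_ isT); lia.
    + by have := @fgap t s; rewrite h ltn_ord => /(_ isT); lia.
    + by move/val_inj: h => h; subst; lia.
  - by have [_ _ _ + _] := tri s (ltn_ord s); rewrite -Ej => ->; case: (e' _).
  - by have [_ _ _ _ +] := tri t (ltn_ord t); rewrite -Ej1 /= => ->; case: (e' _).
  - by move=> *; rewrite !addn0.
rewrite /changes (eq_bigr _ (fun (j : 'I_M) _ => pt j)) !big_split /=; congr addn.
have s1 : (\sum_(i < M) fl i = N)%N.
  rewrite -(eq_bigr _ (fun (j : 'I_M) _ => sfl j)) exchange_big /=.
  rewrite (eq_bigr (fun=> 1%N)) ?sum1_card ?card_ord // => s _.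
  have [_ h _ _ _] := tri s (ltn_ord s).
  rewrite (bigD1 (Ordinal h)) //= eqxx big1 // => i; rewrite -val_eqE /=.
  by move/negbTE->.
have s2 : (\sum_(i < M) fl i.+1 = N)%N.
  rewrite -(eq_bigr _ (fun (j : 'I_M) _ => sfl j.+1)) exchange_big /=.
  rewrite (eq_bigr (fun=> 1%N)) ?sum1_card ?card_ord // => s _.
  have [h0 h _ _ _] := tri s (ltn_ord s).
  have h' : ((f s).-1 < M)%N by lia.
  rewrite (bigD1 (Ordinal h')) //= prednK // eqxx big1 // => i; rewrite -val_eqE /=.
  by case: eqP => //; lia.
by rewrite s1 s2 addnn.
Qed.

(** * Sign changes in the image of a matrix with positive minors *)

Section SignVariation.
Variable R : realType.

Lemma card_ord_lt (q s : nat) : (s <= q)%N -> #|[set t : 'I_q | (t < s)%N]| = s.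
Proof.
move=> sq; have inj : injective (widen_ord sq) by move=> a b /(congr1 val) /= /val_inj.
rewrite -[RHS]card_ord -cardsT -(card_imset _ inj).
apply: eq_card => t; rewrite inE; apply/idP/imsetP => [ts|[a _ ->]]; last exact: (ltn_ord a).
by exists (Ordinal ts) => //; apply/val_inj.
Qed.

Definition rank_below (n : nat) (A : {set 'I_n}) (i : nat) : nat := #|[set a in A | (a < i)%N]|.

Lemma increasing_enum (n q : nat) (A : {set 'I_n}) : #|A| = q ->
  exists f : 'I_q -> 'I_n, [/\ increasing f, forall s, f s \in A,
    forall i, i \in A -> exists s, i = f s & forall s, rank_below A (f s) = s].
Proof.
move=> <-; pose f (s : 'I_#|A|) : 'I_n := enum_val s.
have srt : sorted ltn (map val (enum A)).
  apply: (@subseq_sorted _ ltn ltn_trans _ (map val (enum 'I_n))).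
    by apply: map_subseq; rewrite [enum (ordinal _)]enumT; exact: filter_subseq.
  by rewrite val_enum_ord iota_ltn_sorted.
have inc : increasing f.
  move=> a b ab; rewrite /f.
  have x0 : 'I_n by case: (f a) => m hm; exists m.
  have H := sorted_ltn_nth ltn_trans (val x0) srt.
  have sz : size (map val (enum A)) = #|A| by rewrite size_map -cardE.
  have := H a b; rewrite !inE sz !ltn_ord => /(_ isT isT ab).
  by rewrite !(nth_map x0) -?cardE ?ltn_ord // -!enum_val_nth.
exists f; split=> //; first by move=> s; exact: enum_valP.
  by move=> i iA; exists (enum_rank_in iA i); rewrite /f enum_rankK_in.
have finj : injective f by exact: enum_val_inj.
move=> s; rewrite -[RHS](@card_ord_lt #|A| s) ?(ltnW (ltn_ord s)) //.
rewrite -(card_imset _ finj); apply: eq_card => i; rewrite !inE.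
apply/andP/imsetP => [[iA lis]|[t]].
  exists (enum_rank_in iA i); last by rewrite /f enum_rankK_in.
  rewrite inE ltnNge; apply/negP; rewrite leq_eqVlt => /orP[/eqP/val_inj E|h].
    by rewrite E /f enum_rankK_in ?ltnn in lis.
  by have := inc _ _ h; rewrite {2}/f enum_rankK_in // => /ltn_trans /(_ lis); rewrite ltnn.
by rewrite inE => ts ->; split; [exact: enum_valP|exact: inc].
Qed.

(** Prepend the column [M x] to the p + 1 selected rows. The resulting square matrix is singular,
    and in the expansion of its determinant along that column all terms have the same weak sign, so
    each of them vanishes. Then [M x] is zero on p rows whose minor is positive. *)
Lemma weak_alternation (N p : nat) (M : 'M[R]_(N, p)) (x : 'cV[R]_p) (A : {set 'I_N}) (b : bool) :
  row_minors_pos M -> #|A| = p.+1 ->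
  (forall i, i \in A -> 0 <= (-1) ^+ (b + rank_below A i) * (M *m x) i 0) -> x = 0.
Proof.
move=> Mp cA alt; have [f [finc fA _ frk]] := increasing_enum cA.
have flt (i : 'I_p.+1) : increasing (f \o lift i).
  by move=> s t st; apply: finc; rewrite /= /bump; move: (nat_of_ord i) (nat_of_ord s) (nat_of_ord t) st => a1 a2 a3; case: (leqP a1 a2); case: (leqP a1 a3); lia.
pose D := rowsub f (row_mx (M *m x) M) : 'M[R]_(p.+1).
have D0 : \det D = 0.
  apply/eqP; apply: contraT => nz.
  have Du : D \in unitmx by rewrite unitmxE unitfE.
  pose y : 'cV[R]_p.+1 := col_mx 1%:M (- x).
  have y0 : D *m y = 0.
    have E : row_mx (M *m x) M *m col_mx 1%:M (- x) = 0.
      by rewrite mul_row_col mulmx1 mulmxN subrr.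
    apply: (etrans (mul_rowsub_mx f (row_mx (M *m x) M) (col_mx 1%:M (- x)))).
    by rewrite E; apply/matrixP => i j; rewrite !mxE.
  have : y = 0 by rewrite -(mulKmx Du y) y0 mulmx0.
  move/matrixP/(_ ord0 0); have := col_mxEu (1%:M : 'M[R]_1) (- x) 0 0.
  rewrite (_ : lshift p 0 = ord0); last exact/val_inj.
  by rewrite /y => ->; rewrite !mxE /= => /eqP; rewrite oner_eq0.
have cof i : cofactor D i ord0 = (-1) ^+ i * \det (rowsub (f \o lift i) M).
  rewrite /cofactor /= addn0; congr (_ * \det _).
  apply/matrixP => s t; rewrite !mxE.
  have := row_mxEr (M *m x) M (f (lift i s)) t; rewrite (_ : rshift 1 t = lift ord0 t); last exact/val_inj.
  by rewrite [X in X = _ -> _]mxE.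
have := D0; rewrite (expand_det_col D ord0) => S0.
have Dv i : D i ord0 = (M *m x) (f i) 0.
  rewrite [LHS]mxE; have := row_mxEl (M *m x) M (f i) 0.
  by rewrite (_ : lshift p 0 = ord0) //; exact/val_inj.
have S1 : \sum_(i < p.+1) (-1) ^+ (b + i) * (M *m x) (f i) 0 * \det (rowsub (f \o lift i) M) = 0.
  transitivity ((-1) ^+ b * (\sum_i D i ord0 * cofactor D i ord0)); last by rewrite S0 mulr0.
  rewrite big_distrr /=; apply: eq_bigr => i _.
  by rewrite Dv cof exprD; ring.
have nn (i : 'I_p.+1) : true -> 0 <= (-1) ^+ (b + i) * (M *m x) (f i) 0 * \det (rowsub (f \o lift i) M).
  by move=> _; apply: mulr_ge0; [have := alt _ (fA i); rewrite frk|apply: ltW; exact: Mp].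
have v0 i : (M *m x) (f i) 0 = 0.
  have /eqP := S1; rewrite psumr_eq0 // => /allP /(_ i); rewrite mem_index_enum => /(_ isT) /=.
  by rewrite mulf_eq0 mulf_eq0 signr_eq0 /= (gt_eqF (Mp _ (flt i))) orbF => /eqP.
have Mu : rowsub (f \o lift ord0) M \in unitmx by rewrite unitmxE unitfE gt_eqF // Mp.
have E0 : rowsub (f \o lift ord0) M *m x = 0.
  by rewrite mul_rowsub_mx; apply/matrixP => i j; rewrite ord1 [LHS]mxE v0 mxE.
by rewrite -(mulKmx Mu x) E0 mulmx0.
Qed.

Lemma minors_full_rank (N p : nat) (M : 'M[R]_(N, p)) (x : 'cV[R]_p) (A : {set 'I_N}) :
  row_minors_pos M -> #|A| = p -> (forall i, i \in A -> (M *m x) i 0 = 0) -> x = 0.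
Proof.
move=> Mp cA h0; have [f [finc fA _ _]] := increasing_enum cA.
have Mu : rowsub f M \in unitmx by rewrite unitmxE unitfE gt_eqF // Mp.
have E0 : rowsub f M *m x = 0.
  by rewrite mul_rowsub_mx; apply/matrixP => i j; rewrite ord1 [LHS]mxE h0 ?mxE.
by rewrite -(mulKmx Mu x) E0 mulmx0.
Qed.

(* Junk value: positions past the last index read as 0. *)
Definition at_ (n : nat) (u : 'rV[R]_n) (j : nat) : R :=
  if insub j is Some i then u 0 i else 0.

Lemma at_ord (n : nat) (u : 'rV[R]_n) (i : 'I_n) : at_ u i = u 0 i.
Proof. by rewrite /at_ valK. Qed.

Lemma at_ge (n : nat) (u : 'rV[R]_n) (j : nat) : (n <= j)%N -> at_ u j = 0.
Proof. by move=> h; rewrite /at_ insubF // ltnNge h. Qed.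

Definition change_set (n : nat) (e : nat -> bool) : {set 'I_n} :=
  [set i : 'I_n | (0 < i)%N && (e i.-1 != e i)].

Lemma card_change_set (n : nat) (e : nat -> bool) : #|change_set n e| = changes n.-1 e.
Proof.
case: n => [|n]; first by rewrite /changes big_ord0; apply/eqP; rewrite -leqn0 -[X in (_ <= X)%N](card_ord 0) max_card.
rewrite /changes /= -sum1_card big_mkcond /= big_ord_recl /= inE /= add0n.
by apply: eq_bigr => i _; rewrite inE /=; case: eqP.
Qed.

Lemma sign_change_set (n : nat) (e : nat -> bool) (i : nat) : (i < n)%N ->
  e i = e 0 (+) odd #|[set h in change_set n e | (h <= i)%N]|.
Proof.
elim: i => [|i IH] h.
  rewrite (_ : [set _ in _ | _] = finset.set0) ?cards0 ?addbF //.
  apply/setP => x; rewrite !inE leqn0; case: (posnP x) => x0; rewrite ?x0 ?andbF // eqn0Ngt x0 andbF.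
have hi : (i < n)%N by apply: ltnW.
have -> : #|[set x in change_set n e | (x <= i.+1)%N]| =
   ((e i != e i.+1) + #|[set x in change_set n e | (x <= i)%N]|)%N.
  pose o := Ordinal h.
  rewrite (cardsD1 o) !inE /= leqnn andbT; congr (_ + _)%N.
  apply: eq_card => x; rewrite !inE -val_eqE /=.
  rewrite (leq_eqVlt x i.+1) ltnS; case: (x =P i.+1 :> nat) => [->|] //=.
  by rewrite [(i.+1 <= i)%N]ltnn andbF.
by rewrite oddD oddb addbCA -IH //; case: (e i) (e i.+1) => [] [].
Qed.

Lemma discrete_ivt (f : nat -> nat) (N c : nat) : (f 0 <= c <= f N)%N ->
  (forall j, (j < N)%N -> (f j.+1 <= (f j).+1)%N) -> exists2 j, (j <= N)%N & f j = c.
Proof.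
elim: N => [|N IH] /andP[h1 h2] st; first by exists 0%N => //; lia.
case: (leqP c (f N)) => h.
  have [||j jN E] := IH; [by rewrite h1|by move=> j jN; apply: st; lia|].
  by exists j => //; lia.
by exists N.+1 => //; have := st N (leqnn _); lia.
Qed.

(** With p changes or more, the index 0 and the positions where [e] changes contain p + 1 indices on
    which [M x] weakly alternates; [discrete_ivt] truncates them to that exact number. *)
Lemma changes_image (N p : nat) (M : 'M[R]_(N, p)) (x : 'cV[R]_p) (e : nat -> bool) :
  row_minors_pos M -> x != 0 -> compat e (at_ (M *m x)^T) -> (0 < p)%N -> (changes N.-1 e < p)%N.
Proof.
move=> Mp x0 ce p0; rewrite ltnNge; apply/negP=> hp.
case: N M Mp ce hp => [|N] M Mp ce hp; first by rewrite /changes big_ord0 in hp; lia.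
pose A0 : {set 'I_N.+1} := ord0 |: change_set N.+1 e.
have cA0 : #|A0| = (changes N e).+1 by rewrite cardsU1 inE /= card_change_set.
pose A j := [set a in A0 | (a < j)%N].
have [||j jN cA] := @discrete_ivt (fun j => #|A j|) N.+1 p.+1.
- rewrite (_ : A 0%N = finset.set0) ?cards0 /=; last by apply/setP => a; rewrite !inE andbF.
  by rewrite (_ : A N.+1 = A0) ?cA0 //; apply/setP => a; rewrite inE ltn_ord andbT.
- move=> j jN; rewrite (cardsD1 (Ordinal jN)); apply: (@leq_trans (1 + #|A j|)) => //.
  apply: leq_add; first by case: (_ \in _).
  apply: subset_leq_card; apply/fintype.subsetP => a; rewrite !inE -val_eqE /=; lia.
move/eqP: x0; apply; apply: (weak_alternation (b := e 0) Mp cA) => i.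
rewrite inE => /andP[iA0 ij].
have := ce i; rewrite at_ord mxE; congr (0 <= _ * _).
rewrite -[RHS]signr_odd oddD oddb (sign_change_set e (ltn_ord i)).
congr (_ ^+ nat_of_bool (_ (+) odd _)).
have [->|in0] := eqVneq i ord0.
  rewrite (_ : rank_below (A j) _ = 0%N); last by apply: eq_card0 => a; rewrite !inE andbF.
  by apply: eq_card0 => a; rewrite !inE leqn0; case: (posnP a) => a0; rewrite ?a0 ?andbF.
have iC : i \in change_set N.+1 e by move: iA0; rewrite /A0 in_setU1 (negbTE in0).
have i0 : (0 < i)%N by rewrite lt0n; apply: contra in0 => /eqP E; apply/eqP/val_inj.
rewrite /rank_below (cardsD1 i) inE iC leqnn /= [RHS](cardsD1 ord0).
have -> : ord0 \in [set a in A j | (a < i)%N] by rewrite !inE /= i0 (ltn_trans i0 ij).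
congr (_ + _)%N; apply: eq_card => a; rewrite !inE -!val_eqE /=.
by case: (posnP a) => [->|a0] //=; rewrite ?andbF //; case: (e _ != e _); lia.
Qed.

End SignVariation.

(** * Sign changes in the kernel of a matrix with positive minors *)

Section Kernels.
Variable R : realType.

Lemma nonzero_solution (k : nat) (I : finType) (Q : {set I}) (F : I -> 'cV[R]_k) :
  (#|Q| < k)%N -> exists2 c : 'rV[R]_k, c != 0 & forall i, i \in Q -> c *m F i = 0.
Proof.
move=> Qk; pose A : 'M[R]_(k, #|Q|) := \matrix_(a, b) F (enum_val b) a 0.
have : kermx A != 0.
  by rewrite -mxrank_eq0 mxrank_ker -lt0n subn_gt0 (leq_ltn_trans (rank_leq_col A)).
case/rowV0Pn => c /sub_kermxP cA c0; exists c => // i iQ.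
apply/matrixP => a b; rewrite !ord1 [RHS]mxE.
have := congr1 (fun X : 'rV_#|Q| => X 0 (enum_rank_in iQ i)) cA.
rewrite !mxE => E; rewrite -[RHS]E; apply: eq_bigr => s _.
by rewrite mxE enum_rankK_in.
Qed.

Lemma trmx_minors_pos (k n : nat) (C : 'M[R]_(k, n)) :
  col_minors_pos C -> row_minors_pos C^T.
Proof.
move=> Cp f /Cp; rewrite -det_tr.
by congr (0 < \det _); apply/matrixP => i j; rewrite !mxE.
Qed.

Lemma row_nonzero_off (k n : nat) (C : 'M[R]_(k, n)) (c : 'rV[R]_k) (H : {set 'I_n}) (i : 'I_n) :
  col_minors_pos C -> c != 0 -> #|H|.+1 = k -> (forall j, j \in H -> (c *m C) 0 j = 0) ->
  i \notin H -> (c *m C) 0 i != 0.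
Proof.
move=> Cp c0 cH z iH; apply: contra c0 => /eqP vi.
rewrite -trmx_eq0; apply/eqP.
apply: (minors_full_rank (A := i |: H) (trmx_minors_pos Cp)); first by rewrite cardsU1 iH.
move=> j; rewrite in_setU1 -trmx_mul mxE => /orP[/eqP-> //|]; exact: z.
Qed.

(** So [c C] changes sign exactly at the elements of [H]. Otherwise there are i and j outside [H]
    such that [c C] weakly alternates on the k + 1 indices of [H] together with i and j, and then
    [c = 0]. *)
Lemma row_sign_off (k n : nat) (C : 'M[R]_(k, n)) (c : 'rV[R]_k) (H : {set 'I_n}) :
  col_minors_pos C -> c != 0 -> #|H|.+1 = k -> (forall j, j \in H -> (c *m C) 0 j = 0) ->
  exists b : bool, forall i, i \notin H -> 0 < (-1) ^+ (b + rank_below H i) * (c *m C) 0 i.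
Proof.
move=> Cp c0 cH z; pose v := c *m C; pose w (i : 'I_n) := (-1) ^+ rank_below H i * v 0 i.
have w0 i : i \notin H -> w i != 0.
  by move=> iH; rewrite mulf_neq0 ?signr_eq0 ?(row_nonzero_off Cp c0 cH).
have W (i j : 'I_n) : (i < j)%N -> i \notin H -> j \notin H -> 0 < w i * w j.
  move=> ij iH jH; rewrite lt_neqAle eq_sym mulf_neq0 ?w0 //= leNgt; apply/negP=> neg.
  move/eqP: c0; apply; apply/trmx_inj; rewrite trmx0.
  have inej : i != j by rewrite -val_eqE /=; lia.
  have cA : #|i |: (j |: H)| = k.+1 by rewrite !cardsU1 in_setU1 negb_or inej iH jH -cH.
  apply: (weak_alternation (b := w i < 0) (trmx_minors_pos Cp) cA) => h.
  rewrite -trmx_mul mxE -/v.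
  have wi : 0 <= (-1) ^+ (w i < 0)%R * w i.
    by case: ltP => E; rewrite ?expr1 ?mulN1r ?oppr_ge0 ?expr0 ?mul1r // ltW.
  rewrite !in_setU1 => /orP[/eqP->|/orP[/eqP->|hH]].
  - rewrite (_ : rank_below _ i = rank_below H i) ?exprD -?mulrA //.
    apply: eq_card => a; rewrite !inE -!val_eqE /=; case: (ltnP a i) => E; rewrite ?andbF ?andbT //.
    by have -> : (a == i :> nat) = false by [lia]; have -> : (a == j :> nat) = false by lia.
  - rewrite (_ : rank_below _ j = (rank_below H j).+1); last first.
      rewrite /rank_below (cardsD1 i) !inE eqxx ij /=; congr (_.+1).
      apply: eq_card => a; rewrite !inE -!val_eqE /=; case: (a =P i :> nat) => [E|E] /=.
        by rewrite (_ : a = i) ?(negbTE iH) //; apply/val_inj.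
      case: (ltnP a j) => E2; rewrite ?andbF ?andbT //.
      by have -> : (a == j :> nat) = false by lia.
    rewrite addnS exprS exprD -!mulrA -/(w j) mulN1r oppr_ge0.
    move: wi neg; move: (w i) (w j) => x y.
    by case: (ltP x 0) => E _; rewrite ?expr1 ?expr0 ?mulN1r ?mul1r => neg; nra.
  - by rewrite /v z ?mulr0.
case: (pickP [pred i | i \notin H]) => [i /= iH|all]; last first.
  by exists false => i iH; have := all i; rewrite /= iH.
exists (w i < 0) => j jH; rewrite exprD -mulrA -/(w j).
have := w0 i iH; have := w0 j jH.
case: (ltngtP i j) => [ij|ji|/val_inj->].
- have := W _ _ ij iH jH; move: (w i) (w j) => x y.
  by case: (ltP x 0) => E; rewrite ?expr1 ?expr0 ?mulN1r ?mul1r => h1 h2 h3; nra.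
- have := W _ _ ji jH iH; move: (w i) (w j) => x y.
  by case: (ltP x 0) => E; rewrite ?expr1 ?expr0 ?mulN1r ?mul1r => h1 h2 h3; nra.
- by case: (ltgtP (w j) 0) => //= E; rewrite ?expr1 ?expr0 ?mulN1r ?mul1r ?oppr_gt0.
Qed.

(** If [e] had fewer than k changes, some vector of the row space of [C] would change sign together
    with [e]; its products with the entries of [u] would all have one sign and yet add up to 0. *)
Lemma changes_kernel (k n : nat) (C : 'M[R]_(k, n)) (u : 'rV[R]_n) (e : nat -> bool) :
  col_minors_pos C -> (k <= n)%N -> u *m C^T = 0 -> u != 0 -> compat e (at_ u) ->
  (k <= changes n.-1 e)%N.
Proof.
move=> Cp kn Cu u0 ce; rewrite leqNgt; apply/negP=> hk.
pose Hc := change_set n e; have cHc : #|Hc| = changes n.-1 e by exact: card_change_set.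
(* The set of changes is padded to k - 1 elements by a final segment. The indices that remain
   outside lie to the left of it, so their signs are not affected. *)
pose T j := Hc :|: [set a : 'I_n | (n - j <= a)%N].
have [||p pn cH] := @discrete_ivt (fun j => #|T j|) n k.-1.
- rewrite (_ : T 0%N = Hc); last first.
    by apply/setP => a; rewrite !inE subn0 [(n <= a)%N]leqNgt ltn_ord orbF.
  rewrite (_ : T n = finset.setT); last by apply/setP => a; rewrite !inE subnn orbT.
  by rewrite cHc cardsT card_ord; lia.
- move=> j jn; have jn' : (n - j.+1 < n)%N by lia.
  rewrite (cardsD1 (Ordinal jn')); apply: (@leq_trans (1 + #|T j|)) => //.
  apply: leq_add; first by case: (_ \in _).
  apply: subset_leq_card; apply/fintype.subsetP => a; rewrite !inE -val_eqE /=.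
  by move=> /andP[ne /orP[->//|h]]; apply/orP; right; lia.
set H := T p in cH.
have cH1 : #|H|.+1 = k by rewrite cH; lia.
have dot0 (c : 'rV[R]_k) : \sum_i (c *m C) 0 i * u 0 i = 0.
  have : (c *m C) *m u^T = 0.
    by rewrite -mulmxA (_ : C *m u^T = 0) ?mulmx0 // -[C]trmxK -trmx_mul Cu trmx0.
  move=> /matrixP/(_ 0 0); rewrite [LHS]mxE [RHS]mxE => E; rewrite -[RHS]E.
  by apply: eq_bigr => i _; rewrite [u^T _ _]mxE.
have uH i : i \notin H -> u 0 i = 0.
  have [|c c0 cz] := @nonzero_solution k _ H (fun i => col i C); first by lia.
  have z j : j \in H -> (c *m C) 0 j = 0.
    by move=> /cz /matrixP/(_ 0 0); rewrite !mxE => E; rewrite -[RHS]E; apply: eq_bigr => s _; rewrite mxE.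
  have [b sg] := row_sign_off Cp c0 cH1 z.
  have rk j : j \notin H -> (-1) ^+ (b + rank_below H j) = (-1) ^+ (b (+) e 0 (+) e j) :> R.
    move=> jH; rewrite -signr_odd oddD oddb (sign_change_set e (ltn_ord j)).
    rewrite addbA addbK; congr (_ ^+ nat_of_bool (_ (+) odd _)).
    apply: eq_card => a; move: jH; rewrite !inE => /norP[jn jp].
    case: (ltngtP a j) => [aj|aj|/val_inj ->]; rewrite ?andbF ?andbT //; last first.
      by rewrite (negbTE jn).
    by rewrite [(n - p <= a)%N](_ : _ = false) ?orbF //; lia.
  move=> iH; have S0 : \sum_j (-1) ^+ (b (+) e 0) * ((c *m C) 0 j * u 0 j) = 0.
    by rewrite -big_distrr /= dot0 mulr0.
  have nn j : true -> 0 <= (-1) ^+ (b (+) e 0) * ((c *m C) 0 j * u 0 j).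
    move=> _; have [jH|jH] := boolP (j \in H); first by rewrite z // mul0r mulr0.
    have := sg j jH; rewrite rk // => p1; have := ce j; rewrite at_ord => p2.
    have := mulr_ge0 (ltW p1) p2; congr (0 <= _); rewrite !signr_addb.
    by rewrite -[RHS]mul1r -[X in _ = X * _](sqrr_sign R (e j)) expr2; ring.
  have /eqP := S0; rewrite psumr_eq0 // => /allP /(_ i); rewrite mem_index_enum => /(_ isT) /=.
  rewrite !mulf_eq0 signr_eq0 /= => /orP[/eqP E|/eqP //].
  by have := row_nonzero_off Cp c0 cH1 z iH; rewrite E eqxx.
move/eqP: u0; apply; apply/rowP => j; rewrite [RHS]mxE.
have [jH|/uH//] := boolP (j \in H).
(* An index j of [H] is exchanged with some [a] outside [H]. Since [u] already vanishes off [H],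
   orthogonality to the new row vector reduces to the single term at j. *)
have [a aH] : exists a, a \notin H.
  apply/existsP; apply: contraT; rewrite negb_exists => /forallP all.
  have : (n <= #|H|)%N; last by lia.
  by rewrite -[X in (X <= _)%N]card_ord; apply: subset_leq_card; apply/fintype.subsetP => x _; have := all x; rewrite negbK.
pose H' := a |: (H :\ j).
have cH' : #|H'|.+1 = k by rewrite cardsU1 in_setD1 (negbTE aH) andbF -cH1 [in RHS](cardsD1 j) jH.
have [|c c0 cz] := @nonzero_solution k _ H' (fun i => col i C); first by lia.
have z i : i \in H' -> (c *m C) 0 i = 0.
  by move=> /cz /matrixP/(_ 0 0); rewrite !mxE => E; rewrite -[RHS]E; apply: eq_bigr => s _; rewrite mxE.
have jH' : j \notin H' by rewrite !inE eqxx orbF; apply: contra aH => /eqP<-.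
have := dot0 c; rewrite (bigD1 j) //= big1 ?addr0; last first.
  move=> i ij; have [iH'|iH'] := boolP (i \in H'); first by rewrite z ?mul0r.
  by rewrite uH ?mulr0 //; apply: contra iH' => iH; rewrite in_setU1 in_setD1 ij iH orbT.
by move/eqP; rewrite mulf_eq0 (negbTE (row_nonzero_off Cp c0 cH' z jH')) => /eqP.
Qed.

End Kernels.

(** * Dependencies supported on consecutive pairs *)

Lemma changesS (M : nat) (e : nat -> bool) :
  changes M.+1 e = (changes M e + (e M != e M.+1))%N.
Proof. by rewrite /changes big_ord_recr. Qed.

Section Core.
Variables (R : realType) (n : nat).

Definition ev (j : nat) : 'rV[R]_n := \row_i (i == j :> nat)%:R.

Definition dot (a u : 'rV[R]_n) : R := \sum_i a 0 i * u 0 i.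

Lemma dot_ev (j : nat) (u : 'rV[R]_n) : dot (ev j) u = at_ u j.
Proof.
rewrite /dot; case: (ltnP j n) => jn.
  rewrite (bigD1 (Ordinal jn)) //= mxE eqxx mul1r big1 ?addr0; last first.
    by move=> i ij; rewrite mxE (_ : (i == j :> nat) = false) ?mul0r //; apply/negbTE; move: ij; rewrite -val_eqE.
  by rewrite -at_ord.
by rewrite at_ge // big1 // => i _; rewrite mxE (_ : (i == j :> nat) = false) ?mul0r //; have := ltn_ord i; lia.
Qed.

Lemma dotDl (a b u : 'rV[R]_n) : dot (a + b) u = dot a u + dot b u.
Proof. by rewrite /dot -big_split; apply: eq_bigr => i _; rewrite mxE mulrDl. Qed.

Lemma dotZl x (a u : 'rV[R]_n) : dot (x *: a) u = x * dot a u.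
Proof. by rewrite /dot mulr_sumr; apply: eq_bigr => i _; rewrite mxE mulrA. Qed.

Lemma dot_mx (a u : 'rV[R]_n) : dot a u = (a *m u^T) 0 0.
Proof. by rewrite mxE; apply: eq_bigr => i _; rewrite [u^T _ _]mxE. Qed.

Definition in_pairs (N : nat) (g : nat -> nat) (j : nat) : Prop :=
  exists2 s, (s < N)%N & j = g s \/ j = (g s).+1.

Definition admissible (r : nat) (g : nat -> nat) : Prop :=
  gapped r g /\ forall s, (s < r)%N -> ((g s).+1 < n)%N.

Definition orth (d : nat) (B : 'M[R]_(d, n)) (a : 'rV[R]_n) : Prop := a *m B^T = 0.

Definition supported (P : nat -> Prop) (a : 'rV[R]_n) : Prop :=
  forall i : 'I_n, a 0 i != 0 -> P i.

(** Here [r.*2.-1] is m, and [r.*2 <= n.+1] says that r disjoint pairs fit into the positions 0,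
    ..., n, the position n being virtual. Equality in the bound on the rank is derived in
    [sign_bounded_rank]. *)
Definition sign_bounded (k r d : nat) (B : 'M[R]_(d, n)) : Prop :=
  [/\ (0 < r)%N, (r.*2 <= n.+1)%N, (r.*2.-1 <= \rank B)%N &
    forall u, (u <= B)%MS -> u != 0 -> forall e, compat e (at_ u) ->
      (k <= changes n.-1 e < k + r.*2.-1)%N].

Variables (k r d : nat) (B : 'M[R]_(d, n)).

Lemma orth_dot a u : orth B a -> (u <= B)%MS -> dot a u = 0.
Proof.
move=> aW /submxP[D ->]; rewrite dot_mx trmx_mul mulmxA aW mul0mx mxE //.
Qed.

Lemma orthD a b : orth B a -> orth B b -> orth B (a + b).
Proof. by rewrite /orth mulmxDl => -> ->; rewrite addr0. Qed.

Lemma orthZ x a : orth B a -> orth B (x *: a).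
Proof. by rewrite /orth -scalemxAl => ->; rewrite scaler0. Qed.

(** Double annihilator: W + R^A is the orthogonal complement of the vectors of U that vanish on [A].
    The columns of the cokernel [Y] provide such vectors. *)
Lemma span_mod (A : {set 'I_n}) (h : 'rV[R]_n) :
  (forall u, (u <= B)%MS -> (forall i, i \in A -> u 0 i = 0) -> dot h u = 0) ->
  exists2 mu : 'rV[R]_n, (forall i, i \notin A -> mu 0 i = 0) & orth B (mu + h).
Proof.
move=> H; pose E := diag_mx (\row_i (i \in A)%:R : 'rV[R]_n).
pose Y := cokermx (E *m B^T).
have EY : E *m B^T *m Y = 0 by exact: mulmx_coker.
have : (h *m B^T <= E *m B^T)%MS.
  rewrite submxE -/Y; apply/eqP/rowP => j.
  pose u := (col j Y)^T *m B.
  have uE : u^T = B^T *m col j Y by rewrite trmx_mul trmxK.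
  have u0 i : i \in A -> u 0 i = 0.
    move=> iA; have := congr1 (fun X : 'M_(n, _) => X i j) EY.
    rewrite -mulmxA mul_diag_mx [LHS]mxE mxE iA mul1r [RHS]mxE => <-.
    by rewrite -[u]trmxK uE !mxE; apply: eq_bigr => s _; rewrite !mxE.
  have := H u (submxMl _ _) u0; rewrite dot_mx uE mulmxA [LHS]mxE => E0.
  by rewrite [LHS]mxE [RHS]mxE -[RHS]E0; apply: eq_bigr => s _; rewrite !mxE.
case/submxP => D HD; exists (- (D *m E)).
  move=> i iA; rewrite mxE mul_mx_diag !mxE (negbTE iA) mulr0 oppr0 //.
by rewrite /orth mulmxDl mulNmx -mulmxA HD addNr.
Qed.

Hypothesis gB : sign_bounded k r B.

Lemma solve_in_U (I : finType) (Q : {set I}) (F : I -> 'rV[R]_n) :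
  (#|Q| < r.*2.-1)%N ->
  exists u, [/\ (u <= B)%MS, u != 0 & forall i, i \in Q -> dot (F i) u = 0].
Proof.
move=> cQ; have [_ _ rk _] := gB.
have [c c0 cz] := @nonzero_solution R _ _ Q (fun i => row_base B *m (F i)^T) (leq_trans cQ rk).
exists (c *m row_base B); split.
- by rewrite (submx_trans (submxMl _ _)) // eq_row_base.
- apply: contra c0 => /eqP E; apply/eqP.
  have /row_freeP[X HX] := row_base_free B.
  by rewrite -[c]mulmx1 -HX mulmxA E mul0mx.
- move=> i /cz; rewrite dot_mx => E; rewrite -[F i]trmxK -trmx_mul -mulmxA E.
  by rewrite trmx0 mxE.
Qed.

(** Of 2r conditions only 2r - 2 can be imposed on a nonzero vector of U. In each application the
    other two are recovered from orthogonality to vectors of W, or hold by themselves. *)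
Lemma solve_but_two (F : 'I_r * bool -> 'rV[R]_n) (c1 c2 : 'I_r * bool) : c1 != c2 ->
  exists u, [/\ (u <= B)%MS, u != 0 & forall c, c != c1 -> c != c2 -> dot (F c) u = 0].
Proof.
move=> c12; have [|u [uU u0 uz]] := @solve_in_U _ (~: [set c1; c2]) F.
  have := cardsC [set c1; c2]; rewrite cards2 c12 card_prod card_ord card_bool.
  by have [r0 _ _ _] := gB; lia.
exists u; split=> // c h1 h2; apply: uz.
by rewrite inE in_set2 negb_or h1 h2.
Qed.

Definition pos (g : nat -> nat) (c : 'I_r * bool) : nat := (g c.1 + c.2)%N.

Lemma in_pairsP (g : nat -> nat) (j : nat) : in_pairs r g j <-> exists c, j = pos g c.
Proof.
split=> [[s sr [->|->]]|[[s b] ->]].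
- by exists (Ordinal sr, false); rewrite /pos /= addn0.
- by exists (Ordinal sr, true); rewrite /pos /= addn1.
- by exists (nat_of_ord s) => //=; case: b; rewrite /pos /= ?addn0 ?addn1; [right|left].
Qed.

Lemma flat_zero (v : nat -> R) l : v l = 0 -> v l.+1 = 0 -> flat v l.
Proof. by move=> v0 v1; left; rewrite v0 v1 eqxx. Qed.

(* The virtual position n, at which every vector reads 0, costs at most one
   extra sign change; this is affordable because an odd number of changes
   is to be exceeded by an even one. *)
Lemma flat_eq0 (u : 'rV[R]_n) (v : nat -> R) (l : nat -> nat) :
  (u <= B)%MS -> (forall j, at_ u j != 0 -> 0 < at_ u j * v j) ->
  (forall j, (n <= j)%N -> v j = 0) -> gapped r l -> (forall s, (s < r)%N -> (l s < n)%N) ->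
  (forall s, (s < r)%N -> at_ u (l s).+1 = 0 /\ flat v (l s)) -> u = 0.
Proof.
move=> uU uv vn gl ln fl; apply/eqP; apply: contraT => u0.
have [r0 nr _ sg] := gB.
have [i ui] : exists i, u 0 i != 0.
  by apply/rV0Pn.
have vi : v i != 0.
  by have := uv i; rewrite at_ord ui => /(_ isT) h; apply/eqP=> E; rewrite E mulr0 ltxx in h.
have bd j : v j != 0 -> (j <= n)%N.
  by move=> vj; rewrite leqNgt; apply/negP=> h; rewrite vn ?eqxx // ltnW in vj.
have ex : exists j, v j != 0 by exists i.
case: (ex_maxnP ex bd) => a0 va0 amax.
have an := bd _ va0.
have a0m j : (a0 < j)%N -> v j = 0.
  by move=> h; apply/eqP; apply: contraT => /amax; lia.
have [e [e' [ce ce' E]]] := gain an va0 a0m uv gl ln fl.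
have /andP[_ h1] := sg u uU u0 e ce; have /andP[h2 _] := sg u uU u0 e' ce'.
have st f : (changes n.-1 f <= changes n f <= (changes n.-1 f).+1)%N.
  have nE : n.-1.+1 = n by have := ltn_ord i; lia.
  by have := changesS n.-1 f; rewrite nE => ->; case: (_ != _); lia.
by have := st e; have := st e'; lia.
Qed.

Lemma zero_pairs_eq0 (u : 'rV[R]_n) (l : nat -> nat) :
  (u <= B)%MS -> gapped r l -> (forall s, (s < r)%N -> (l s < n)%N) ->
  (forall c, at_ u (pos l c) = 0) -> u = 0.
Proof.
move=> uU gl ln z; apply: (flat_eq0 uU (v := at_ u)) gl ln _.
- by move=> j uj; rewrite -expr2 exprn_even_gt0.
- by move=> j; exact: at_ge.
- move=> s sr; have := z (Ordinal sr, false); have := z (Ordinal sr, true).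
  by rewrite /pos /= addn0 addn1 => h1 h0; split=> //; exact: flat_zero.
Qed.

Lemma pos_inj (g : nat -> nat) (c c' : 'I_r * bool) : gapped r g -> pos g c = pos g c' -> c = c'.
Proof.
case: c c' => [s b] [t b'] gg; rewrite /pos /=; case: (ltngtP s t) => h.
- by have := @gapped_lt r g s t gg; rewrite h ltn_ord => /(_ isT); case: b; case: b'; rewrite /=; lia.
- by have := @gapped_lt r g t s gg; rewrite h ltn_ord => /(_ isT); case: b; case: b'; rewrite /=; lia.
- by move/val_inj: h => ->; case: b; case: b' => //=; lia.
Qed.

(** Otherwise some combination [w] vanishes at a nonzero entry [j0] of [a] and not at some [j1].
    Choose [u] vanishing on K except at [j0] and [j1]: orthogonality to [w] kills [u] at [j1], then
    orthogonality to [a] kills it at [j0], so [u] vanishes on all of K. *)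
Lemma dependency_line (g : nat -> nat) (a b : 'rV[R]_n) : admissible r g ->
  orth B a -> orth B b -> a != 0 -> supported (in_pairs r g) a -> supported (in_pairs r g) b ->
  exists x, b = x *: a.
Proof.
move=> [gg gn] aW bW a0 sa sb.
have nz (w : 'rV[R]_n) : w != 0 -> exists i, w 0 i != 0 by move/rV0Pn.
have [j0 aj0] := nz a a0.
exists (b 0 j0 / a 0 j0); apply/eqP; rewrite -subr_eq0; apply: contraT => w0.
set w := b - _ in w0; have [j1 wj1] := nz w w0.
have wj0 : w 0 j0 = 0 by rewrite !mxE divfK ?subrr.
have wW : orth B w by apply: orthD => //; rewrite -scaleNr; apply: orthZ.
have sw : supported (in_pairs r g) w.
  move=> i wi; have [ai|ai] := eqVneq (a 0 i) 0; last exact: sa.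
  by apply: sb; move: wi; rewrite !mxE ai mulr0 subr0.
have /in_pairsP[c0 E0] := sa _ aj0; have /in_pairsP[c1 E1] := sw _ wj1.
have c01 : c0 != c1.
  by apply/eqP=> E; move: wj1; rewrite (_ : j1 = j0) ?wj0 ?eqxx //; apply/val_inj; rewrite /= E0 E1 E.
have [u [uU u0 uz]] := solve_but_two (fun c => ev (pos g c)) c01.
have {}uz c : c != c0 -> c != c1 -> at_ u (pos g c) = 0 by move=> h1 h2; rewrite -dot_ev uz.
have u1 : u 0 j1 = 0.
  have := orth_dot wW uU; rewrite /dot (bigD1 j1) //= big1 ?addr0.
    by move/eqP; rewrite mulf_eq0 (negbTE wj1) => /eqP.
  move=> i ij; have [->|wi] := eqVneq (w 0 i) 0; first by rewrite mul0r.
  have /in_pairsP[c E] := sw _ wi.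
  have [Ec|cc0] := eqVneq c c0.
    by move: wi; rewrite (_ : i = j0) ?wj0 ?eqxx //; apply/val_inj; rewrite /= E Ec E0.
  have [Ec|cc1] := eqVneq c c1.
    by move: ij; rewrite (_ : i = j1) ?eqxx //; apply/val_inj; rewrite /= E Ec E1.
  by rewrite -(at_ord u) E uz // mulr0.
have u2 : u 0 j0 = 0.
  have := orth_dot aW uU; rewrite /dot (bigD1 j0) //= big1 ?addr0.
    by move/eqP; rewrite mulf_eq0 (negbTE aj0) => /eqP.
  move=> i ij; have [->|wi] := eqVneq (a 0 i) 0; first by rewrite mul0r.
  have /in_pairsP[c E] := sa _ wi.
  have [Ec|cc0] := eqVneq c c0.
    by move: ij; rewrite (_ : i = j0) ?eqxx //; apply/val_inj; rewrite /= E Ec E0.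
  have [Ec|cc1] := eqVneq c c1.
    by rewrite (_ : i = j1) ?u1 ?mulr0 //; apply/val_inj; rewrite /= E Ec E1.
  by rewrite -(at_ord u) E uz // mulr0.
move/eqP: u0; case; apply: (zero_pairs_eq0 uU gg); first by move=> s /gn; lia.
move=> c; have [->|cc0] := eqVneq c c0; first by rewrite -E0 at_ord.
by have [->|cc1] := eqVneq c c1; [rewrite -E1 at_ord|apply: uz].
Qed.

(** The position n imposes no condition, so [u] can be made to vanish everywhere on the pairs except
    at one nonzero entry of [a], where orthogonality to [a] finishes. *)
Lemma virtual_independent (l : nat -> nat) (a : 'rV[R]_n) :
  gapped r l -> (forall s, (s < r)%N -> (l s < n)%N) -> (l r.-1).+1 = n ->
  orth B a -> supported (in_pairs r l) a -> a = 0.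
Proof.
move=> gl ln ll aW sa; apply/eqP; apply: contraT => a0.
have [r0 _ _ _] := gB.
have [j0 aj0] : exists i, a 0 i != 0.
  by apply/rV0Pn.
have /in_pairsP[c0 E0] := sa _ aj0.
have r1 : (r.-1 < r)%N by lia.
pose c1 := (Ordinal r1, true).
have p1 : pos l c1 = n by rewrite /pos /= addn1.
have c01 : c0 != c1 by apply/eqP=> E; have := ltn_ord j0; rewrite E0 E p1 ltnn.
have [u [uU u0 uz]] := solve_but_two (fun c => ev (pos l c)) c01.
have {}uz c : c != c0 -> at_ u (pos l c) = 0.
  move=> h1; have [->|h2] := eqVneq c c1; first by rewrite p1 at_ge.
  by rewrite -dot_ev uz.
have u2 : u 0 j0 = 0.
  have := orth_dot aW uU; rewrite /dot (bigD1 j0) //= big1 ?addr0.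
    by move/eqP; rewrite mulf_eq0 (negbTE aj0) => /eqP.
  move=> i ij; have [->|wi] := eqVneq (a 0 i) 0; first by rewrite mul0r.
  have /in_pairsP[c E] := sa _ wi.
  have [Ec|cc0] := eqVneq c c0.
    by move: ij; rewrite (_ : i = j0) ?eqxx //; apply/val_inj; rewrite /= E Ec E0.
  by rewrite -(at_ord u) E uz // mulr0.
move/eqP: u0; case; apply: (zero_pairs_eq0 uU gl ln) => c.
by have [->|cc0] := eqVneq c c0; [rewrite -E0 at_ord|apply: uz].
Qed.

(* Pushing the pairs that collide with the right end one step to the left makes
   room for a virtual last pair. *)
Lemma few_pairs_independent (N : nat) (g : nat -> nat) (a : 'rV[R]_n) :
  (N < r)%N -> gapped N g -> orth B a ->
  supported (fun j => in_pairs N g j \/ j = n.-1) a -> a = 0.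
Proof.
move=> Nr gg aW sa; have [r0 nr _ _] := gB.
pose c s := (n.-1 - (r.-1 - s).*2)%N.
pose l s := if (s < N)%N then minn (g s) (c s) else c s.
apply: (@virtual_independent l) => //.
- move=> s sr; rewrite /l /c; case: (ltnP s.+1 N) => h.
    by have := gg s h; rewrite (ltnW h); lia.
  by case: (ltnP s N) => h'; rewrite ?geq_min; lia.
- by move=> s sr; rewrite /l /c; case: (ltnP s N) => h; lia.
- by rewrite /l /c (_ : (r.-1 < N)%N = false); lia.
move=> i /sa [[s sN E]|E]; last first.
  by exists r.-1; first by [lia]; left; rewrite /l /c (_ : (r.-1 < N)%N = false); lia.
have iN := ltn_ord i.
case: (leqP (g s) (c s)) => h.
  exists s; first by lia.
  by rewrite /l sN (minn_idPl h).
have cl t : (s <= t)%N -> (t < r)%N -> l t = c t.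
  move=> st tr; rewrite /l; case: ltnP => // tN; apply/minn_idPr.
  suff : (g s + (t - s).*2 <= g t)%N by rewrite /c in h *; lia.
  elim: t st tr tN => [|t IH] st tr tN.
    by move: st; rewrite leqn0 => /eqP->; rewrite addn0.
  move: st; rewrite leq_eqVlt => /orP[/eqP->|st]; first by lia.
  by have := IH st (ltnW tr) (ltnW tN); have := gg t tN; lia.
pose t := (s + (i - c s)./2)%N.
have tr : (t < r)%N by rewrite /t /c in h *; lia.
exists t => //; rewrite cl //; last by rewrite /t; lia.
by rewrite /t /c in h *; lia.
Qed.

(** Greedy choice from the left: each new pair starts at the first element of [J] not yet covered.
    One exists because fewer than r pairs cannot carry [a]; the last pair fits below n because r - 1
    pairs together with the single position n - 1 cannot carry it either. *)
Lemma meets_all_pairs_right (g : nat -> nat) (a : 'rV[R]_n) (J : {set 'I_n}) :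
  admissible r g -> orth B a -> a != 0 -> (forall i, a 0 i != 0 -> i \in J) ->
  (forall i : 'I_n, i \in J -> in_pairs r g i) ->
  exists g', [/\ admissible r g', forall i : 'I_n, i \in J -> in_pairs r g' i &
    (forall s, (s < r)%N -> exists2 i : 'I_n, i \in J & i = g' s :> nat) /\
    (forall s, (s < r)%N -> (g s <= g' s)%N)].
Proof.
move=> [gg gn] aW a0 sa sJ; have [r0 nr _ _] := gB.
have step N : (N <= r)%N -> exists g', [/\ gapped N g',
    forall s, (s < N)%N -> exists2 i : 'I_n, i \in J & i = g' s :> nat,
    forall s, (s < N)%N -> (g s <= g' s)%N &
    forall j : 'I_n, j \in J -> (0 < N)%N && (j <= (g' N.-1).+1)%N -> in_pairs N g' j].
  elim: N => [|N IH] Nr; first by exists g; split.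
  have [g' [gg' J' le' cov]] := IH (ltnW Nr).
  have ex : exists j, [exists i : 'I_n, [&& i \in J, i == j :> nat & ~~ `[< in_pairs N g' j >]]].
    apply: contrapT => nex; move/eqP: a0; apply; apply: (few_pairs_independent Nr gg' aW).
    move=> i /sa iJ; left; apply: contrapT => ni; apply: nex; exists (nat_of_ord i).
    by apply/existsP; exists i; rewrite iJ eqxx /=; apply/asboolPn.
  case: (ex_minnP ex) => x /existsP[ix /and3P[ixJ /eqP ixx /asboolPn xn]] xmin.
  pose g'' s := if s == N then x else g' s.
  have e1 s : (s < N)%N -> g'' s = g' s by rewrite /g'' => h; case: eqP => //; lia.
  have e2 : g'' N = x by rewrite /g'' eqxx.
  have xg : (0 < N)%N -> ((g' N.-1).+1 < x)%N.
    by move=> N0; rewrite ltnNge; apply/negP => h; apply: xn; rewrite -ixx; apply: cov => //; rewrite N0 ixx.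
  exists g''; split.
  - move=> s; rewrite ltnS leq_eqVlt => /orP[/eqP E|h].
      by rewrite e1 -?E // E e2; have := xg; rewrite -E /=; apply; lia.
    by rewrite !e1 //; [exact: gg'|lia].
  - move=> s; rewrite ltnS leq_eqVlt => /orP[/eqP->|h]; last by rewrite e1 //; exact: J'.
    by exists ix; rewrite // e2.
  - move=> s; rewrite ltnS leq_eqVlt => /orP[/eqP->|h]; last by rewrite e1 //; exact: le'.
    rewrite e2; have [t tr xt] := sJ _ ixJ.
    case: (leqP N t) => Nt.
      have : (g N <= g t)%N; last by case: xt; lia.
      by case: (ltngtP N t) Nt => // [h _|->//]; have := @gapped_lt r g N t gg; rewrite h tr => /(_ isT); lia.
    have N0 : (0 < N)%N by lia.
    have h1 : (g t <= g N.-1)%N.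
      case: (ltngtP t N.-1) => // [h|h|->//]; last by lia.
      by have := @gapped_lt r g t N.-1 gg; rewrite h => /(_ ltac:(lia)); lia.
    by have := le' N.-1; have := xg N0; case: xt; lia.
  - move=> j jJ /= ; rewrite e2 => jx.
    have [E|E] := eqVneq (j : nat) x; first by exists N; [|left; rewrite e2].
    have [E2|E2] := eqVneq (j : nat) x.+1; first by exists N; [|right; rewrite e2].
    have jlt : (j < x)%N by lia.
    have : in_pairs N g' j.
      apply: contrapT => nj; have := xmin j; rewrite leqNgt jlt => H; apply: notF; apply: H.
      by apply/existsP; exists j; rewrite jJ eqxx; apply/asboolPn.
    by case=> s sN h; exists s; [lia|rewrite e1].
have [g' [gg' J' le' cov]] := step r (leqnn r).
have last : ((g' r.-1).+1 < n)%N.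
  rewrite ltnNge; apply/negP=> h.
  have lt1 : (g' r.-1 < n)%N by have [|i _ <-] := J' r.-1; [lia|exact: ltn_ord].
  move/eqP: a0; apply; apply: (@few_pairs_independent r.-1 g') => //; first by lia.
    by move=> s sr; apply: gg'; lia.
  move=> i /sa iJ; case: (cov i iJ) => [|s sr E]; first by have := ltn_ord i; lia.
  case: (ltngtP s r.-1) => h'; last by right; have := ltn_ord i; rewrite h' in E; case: E; lia.
    by left; exists s.
  by lia.
exists g'; split=> //.
  split=> // s sr; case: (ltngtP s r.-1) => h; last by rewrite h.
    by have := @gapped_lt r g' s r.-1 gg'; rewrite h => /(_ ltac:(lia)); lia.
  by lia.
move=> i iJ; apply: cov => //; rewrite r0 /=.
have [t tr xt] := sJ _ iJ.
have := le' r.-1 ltac:(lia).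
have : (g t <= g r.-1)%N.
  case: (ltngtP t r.-1) => // [h|h|->//]; last by lia.
  by have := @gapped_lt r g t r.-1 gg; rewrite h => /(_ ltac:(lia)); lia.
by case: xt; lia.
Qed.

(** If [g' s] exceeded [g s + 1], the first s pairs of [g'] and the last r - 1 - s pairs of [g]
    would already contain the support of [a]. *)
Lemma pairs_close_le (g g' : nat -> nat) (a : 'rV[R]_n) : admissible r g -> admissible r g' ->
  orth B a -> a != 0 -> supported (in_pairs r g) a -> supported (in_pairs r g') a ->
  forall s, (s < r)%N -> (forall t, (t < s)%N -> (g' t <= (g t).+1)%N) -> (g' s <= (g s).+1)%N.
Proof.
move=> [gg gn] [gg' gn'] aW a0 sa sa' s sr IH; rewrite leqNgt; apply/negP=> h.
pose l t := if (t < s)%N then g' t else g t.+1.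
move/eqP: a0; apply; apply: (@few_pairs_independent r.-1 l) => //; first by lia.
  move=> t tr; rewrite /l; case: (ltnP t.+1 s) => h1.
    by rewrite (ltnW h1); apply: gg'; lia.
  case: (ltnP t s) => h2; last by apply: gg; lia.
  by have := IH t h2; have := gg t ltac:(lia); have := gg t.+1 ltac:(lia); lia.
move=> i ai; left; have [t tr Et] := sa _ ai; have [t' tr' Et'] := sa' _ ai.
case: (ltnP t' s) => h1; first by exists t'; [lia|rewrite /l h1].
case: (ltnP s t) => h2.
  by exists t.-1; [lia|rewrite /l (_ : (t.-1 < s)%N = false) ?prednK //; lia].
exfalso.
have : (g t <= g s)%N by case: (ltngtP t s) h2 => // [h3|->//]; have := @gapped_lt r g t s gg; rewrite h3 sr => /(_ isT); lia.
have : (g' s <= g' t')%N by case: (ltngtP s t') h1 => // [h3|->//]; have := @gapped_lt r g' s t' gg'; rewrite h3 tr' => /(_ isT); lia.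
by case: Et; case: Et'; lia.
Qed.

Lemma pairs_close (g g' : nat -> nat) (a : 'rV[R]_n) : admissible r g -> admissible r g' ->
  orth B a -> a != 0 -> supported (in_pairs r g) a -> supported (in_pairs r g') a ->
  forall s, (s < r)%N -> (g' s <= (g s).+1)%N /\ (g s <= (g' s).+1)%N.
Proof.
move=> ag ag' aW a0 sa sa'.
have H s : forall t, (t < s)%N -> (t < r)%N -> (g' t <= (g t).+1)%N /\ (g t <= (g' t).+1)%N.
  elim: s => [|s IH] t //; rewrite ltnS leq_eqVlt => /orP[/eqP->|h] tr; last exact: IH.
  split; [apply: (pairs_close_le ag ag' aW)|apply: (pairs_close_le ag' ag aW)] => // x xs;
    by have [] := IH x xs ltac:(lia).
by move=> s; exact: (H s.+1).
Qed.

End Core.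

(** * Reversing the order of the indices *)

Section Reversal.
Variables (R : realType) (n k r d : nat) (B : 'M[R]_(d, n)).

Local Notation revc u := (colsub (@rev_ord n) u).

Lemma revcK p (A : 'M[R]_(p, n)) : revc (revc A) = A.
Proof. by apply/matrixP => i j; rewrite !mxE rev_ordK. Qed.

Lemma revc_mul p q (A : 'M[R]_(p, q)) (C : 'M[R]_(q, n)) : revc (A *m C) = A *m revc C.
Proof. by apply/matrixP => i j; rewrite !mxE; apply: eq_bigr => s _; rewrite !mxE. Qed.

Lemma revc_rank p (A : 'M[R]_(p, n)) : (\rank A <= \rank (revc A))%N.
Proof.
have {1}-> : A = revc A *m revc 1%:M by rewrite -revc_mul mulmx1 revcK.
exact: mxrankM_maxl.
Qed.

Lemma revc_sub p q (A : 'M[R]_(p, n)) (C : 'M[R]_(q, n)) : (A <= revc C)%MS -> (revc A <= C)%MS.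
Proof. by case/submxP => D ->; rewrite -revc_mul revcK submxMl. Qed.

Lemma changes_rev (e : nat -> bool) : changes n.-1 (fun j => e (n.-1 - j)%N) = changes n.-1 e.
Proof.
rewrite /changes (reindex_inj rev_ord_inj) /=; apply: eq_bigr => j _.
have jn := ltn_ord j.
have -> : (n.-1 - (n.-1 - j.+1) = j.+1)%N by lia.
have -> : (n.-1 - (n.-1 - j.+1).+1 = j)%N by lia.
by rewrite eq_sym.
Qed.

Lemma sign_bounded_rev : sign_bounded k r B -> sign_bounded k r (revc B).
Proof.
case=> r0 nr rk sg; split=> //; first exact: leq_trans (revc_rank _).
move=> u /revc_sub uB u0 e ce; rewrite -changes_rev; apply: (sg (revc u)) => //.
  by apply: contra u0 => /eqP E; rewrite -[u]revcK E; apply/eqP/matrixP => i j; rewrite !mxE.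
move=> j; case: (ltnP j n) => jn; last by rewrite at_ge ?mulr0.
have := ce (n.-1 - j)%N; rewrite -[j]/(nat_of_ord (Ordinal jn)) at_ord mxE.
rewrite (_ : (n.-1 - Ordinal jn)%N = rev_ord (Ordinal jn)) ?at_ord //=; lia.
Qed.

Lemma orth_rev (a : 'rV[R]_n) : orth B a -> orth (revc B) (revc a).
Proof.
rewrite /orth => E; rewrite -[RHS]E; apply/matrixP => i j; rewrite !mxE.
rewrite (reindex_inj rev_ord_inj); apply: eq_bigr => s _.
by rewrite !mxE rev_ordK.
Qed.

(** The mirror image of [meets_all_pairs_right]. Reversal turns the end of a pair into its start,
    whence the shift by 2 in [rv]. *)
Lemma meets_all_pairs_left (g : nat -> nat) (a : 'rV[R]_n) (J : {set 'I_n}) :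
  sign_bounded k r B -> admissible n r g -> orth B a -> a != 0 -> (forall i, a 0 i != 0 -> i \in J) ->
  (forall i : 'I_n, i \in J -> in_pairs r g i) ->
  exists g', [/\ admissible n r g', forall i : 'I_n, i \in J -> in_pairs r g' i &
    forall s, (s < r)%N -> exists2 i : 'I_n, i \in J & i = (g' s).+1 :> nat].
Proof.
move=> gB ag aW a0 sa sJ.
pose rv (g : nat -> nat) s := (n - (g (r.-1 - s)).+2)%N.
have adm_rv f : admissible n r f -> admissible n r (rv f).
  move=> [gf fn]; split=> s sr; rewrite /rv; last by have := fn (r.-1 - s)%N; lia.
  have := gf (r.-1 - s.+1)%N; have := fn (r.-1 - s.+1)%N; have := fn (r.-1 - s)%N.
  by rewrite (_ : (r.-1 - s.+1).+1 = (r.-1 - s)%N); lia.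
have inP_rv f (i : 'I_n) : admissible n r f -> in_pairs r f (rev_ord i) -> in_pairs r (rv f) i.
  move=> [_ fn] [s sr E]; exists (r.-1 - s)%N; first lia.
  rewrite /rv (_ : (r.-1 - (r.-1 - s))%N = s); last by lia.
  by have := fn s sr; have := ltn_ord i; case: E => /= E; [right|left]; lia.
pose J' := [set i | rev_ord i \in J].
have [g' [ag' J'g' [hit _]]] := @meets_all_pairs_right R n k r d (revc B) (sign_bounded_rev gB) (rv g) (revc a) J' (adm_rv _ ag) (orth_rev aW)
  ltac:(by apply: contra a0 => /eqP E; rewrite -[a]revcK E; apply/eqP/matrixP => i j; rewrite !mxE)
  ltac:(by move=> i; rewrite mxE inE => /sa) ltac:(by move=> i; rewrite inE => /sJ /(inP_rv _ _ ag)).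
exists (rv g'); split; first exact: adm_rv.
  by move=> i iJ; apply: inP_rv => //; apply: J'g'; rewrite inE rev_ordK.
move=> s sr; have [i] := hit (r.-1 - s)%N ltac:(lia).
rewrite inE => iJ E; exists (rev_ord i) => //=; rewrite /rv -E.
by have := ag'.2 (r.-1 - s)%N; lia.
Qed.

End Reversal.

(** * Vectors of U that are nonnegative around a cell *)

Section Completeness.
Variables (R : realType) (n k r d : nat) (B : 'M[R]_(d, n)).
Hypothesis gB : sign_bounded k r B.

(** Compare a system around [J] with all right ends in [J] and one with all left ends in [J]; their
    pairs differ by a shift of at most 1. Where they agree, [u] vanishes on the pair. Where they
    differ, [u] is nonnegative, zero, nonnegative on three consecutive positions. Both situations
    can be made flat. *)
Lemma nonneg_near_eq0 (g : nat -> nat) (a u : 'rV[R]_n) (J : {set 'I_n}) :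
  admissible n r g -> orth B a -> a != 0 -> (forall i, a 0 i != 0 -> i \in J) ->
  (forall i : 'I_n, i \in J -> in_pairs r g i) ->
  (u <= B)%MS -> (forall i, i \in J -> u 0 i = 0) ->
  (forall g', admissible n r g' -> (forall i : 'I_n, i \in J -> in_pairs r g' i) ->
     forall i : 'I_n, in_pairs r g' i -> 0 <= u 0 i) -> u = 0.
Proof.
move=> ag aW a0 sa sJ uU uJ nn.
have [gL [agL JL hitL]] := meets_all_pairs_left gB ag aW a0 sa sJ.
have [gR [agR JR [hitR LR]]] := meets_all_pairs_right gB agL aW a0 sa JL.
have cl := pairs_close gB agL agR aW a0 (fun i ai => JL i (sa i ai)) (fun i ai => JR i (sa i ai)).
have [gaL nL] := agL; have [gaR nR] := agR.
(* On such a triple the zeros of [u] are raised to 1, which makes [v] positive at all three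
   positions, as in the second alternative of [flat]. *)
pose reg j := `[< exists2 s, (s < r)%N & gR s = (gL s).+1 /\ (gL s <= j <= (gL s).+2)%N >].
pose v j := if at_ u j != 0 then at_ u j else if reg j then 1 else 0.
have uL s : (s < r)%N -> 0 <= at_ u (gL s).
  move=> sr; have lt : (gL s < n)%N by have := nL s sr; lia.
  by rewrite -[gL s]/(nat_of_ord (Ordinal lt)) at_ord; have H := nn gL agL JL (Ordinal lt); apply: H; exists s => //=; left.
have uR s : (s < r)%N -> 0 <= at_ u (gR s).+1.
  move=> sr; have lt := nR s sr.
  by rewrite -[(gR s).+1]/(nat_of_ord (Ordinal lt)) at_ord; have H := nn gR agR JR (Ordinal lt); apply: H; exists s => //=; right.
have u1 s : (s < r)%N -> at_ u (gL s).+1 = 0.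
  by move=> /hitL[i iJ <-]; rewrite at_ord uJ.
apply: (@flat_eq0 R n k r d B gB u v gL uU) => //.
- by move=> j uj; rewrite /v uj -expr2 exprn_even_gt0.
- move=> j nj; rewrite /v at_ge // eqxx /=; case E0: (reg j) => //; exfalso.
  move/asboolP: E0 => [s sr [E /andP[_ h]]].
  by have := nR s sr; lia.
- by move=> s /nL; lia.
move=> s sr; split; first exact: u1.
have [c1 c2] := cl s sr; have LRs := LR s sr.
have [E|E] := eqVneq (gR s) (gL s).
  have ul : at_ u (gL s) = 0 by have [i iJ Ei] := hitR s sr; rewrite -E -Ei at_ord uJ.
  have nreg j : (gL s <= j <= (gL s).+1)%N -> reg j = false.
    move=> hj; apply/asboolP => -[t tr [Et ht]]; case: (ltngtP s t) => h.
    - by have := @gapped_lt r gL s t gaL; rewrite h tr => /(_ isT); lia.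
    - by have := @gapped_lt r gR t s gaR; rewrite h sr => /(_ isT); lia.
    - by rewrite h in E; lia.
  by apply: flat_zero; rewrite /v ?ul ?u1 // eqxx /= nreg //; lia.
have {}E : gR s = (gL s).+1 by lia.
have regj j : (gL s <= j <= (gL s).+2)%N -> reg j.
  by move=> h; apply/asboolP; exists s.
have vpos j : (gL s <= j <= (gL s).+2)%N -> 0 <= at_ u j -> 0 < v j.
  by move=> h u0; rewrite /v; case: eqVneq => [_|nz] /=; rewrite ?regj // lt_neqAle eq_sym nz.
have v0 := vpos _ _ (uL s sr); have v1 := vpos (gL s).+1.
have := uR s sr; rewrite E => /(vpos (gL s).+2) v2.
rewrite u1 // lexx in v1.
by right; split; apply: mulr_gt0; [apply: v0|apply: v1|apply: v1|apply: v2]; lia.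
Qed.

End Completeness.

(** * Induction along a real segment *)

Section RealInduction.
Variable R : realType.

(** The supremum of the points satisfying [P] satisfies [P], since by the last hypothesis failure at
    a point spreads to its left; by the second hypothesis it cannot be below 1. *)
Lemma real_induction (P : R -> Prop) : P 0 ->
  (forall t, 0 <= t < 1 -> P t -> exists2 t', t < t' <= 1 & P t') ->
  (forall t, 0 < t <= 1 -> ~ P t -> exists2 e, 0 < e & forall x, 0 < x < e -> ~ P (t - x)) ->
  P 1.
Proof.
move=> P0 step cl.
pose S := [set t : R | 0 <= t <= 1 /\ P t]%classic.
have S0 : S 0 by split=> //; rewrite lexx ler01.
have hs : has_sup S by split; [exists 0|exists 1 => t [/andP[]]].
set t := sup S.
have t0 : 0 <= t by apply: ub_le_sup => //; case: hs.
have t1 : t <= 1 by apply: ge_sup; [exists 0|move=> x [/andP[]]].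
have Pt : P t.
  apply: contrapT => nP.
  have t0' : 0 < t by rewrite lt_neqAle t0 andbT; apply/eqP=> E; apply: nP; rewrite -E.
  have [|e e0 H] := cl t _ nP; first by rewrite t0' t1.
  have [x [/andP[x0 x1] Px] tx] := sup_adherent e0 hs.
  have xt : x <= t by apply: ub_le_sup; [case: hs|split; rewrite ?x0].
  have xnt : x != t by apply/eqP=> E; apply: nP; rewrite -E.
  apply: (H (t - x)); last by rewrite opprB addrC subrK.
  by rewrite subr_gt0 lt_neqAle xnt xt /=; rewrite -/t in tx; lra.
move: t1; rewrite le_eqVlt => /orP[/eqP<- //|t1].
have [|t' /andP[tt' t'1] Pt'] := step t _ Pt; first by rewrite t0.
have : t' <= t by apply: ub_le_sup; [case: hs|split=> //; rewrite t'1 andbT; lra].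
by rewrite leNgt tt'.
Qed.

Lemma finite_radius (I : finType) (P : I -> R -> Prop) :
  (forall i, exists2 e, 0 < e & forall x, 0 < x < e -> P i x) ->
  exists2 e, 0 < e & forall x, 0 < x < e -> forall i, P i x.
Proof.
move=> H; suff [e e0 He] : exists2 e, 0 < e & forall x, 0 < x < e -> forall i, i \in enum I -> P i x.
  by exists e => // x xe i; apply: He; rewrite ?mem_enum.
elim: (enum I) => [|i s [e e0 He]]; first by exists 1.
have [e' e'0 He'] := H i.
exists (Num.min e e'); first by rewrite lt_min e0.
move=> x /andP[x0]; rewrite lt_min => /andP[x1 x2] j; rewrite in_cons => /orP[/eqP->|].
  by apply: He'; rewrite x0.
by apply: He; rewrite x0.
Qed.

Lemma affine_ball (x y : R) : 0 < x -> exists2 e, 0 < e & forall t, `|t| < e -> 0 < x + t * y.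
Proof.
move=> x0; exists (x / (1 + `|y|)); first by rewrite divr_gt0 // ltr_pwDl.
move=> t; rewrite ltr_pdivlMr; last by rewrite ltr_pwDl.
rewrite mulrDr mulr1 -normrM => h.
by have := ler_norm (- (t * y)); rewrite normrN; have := normr_ge0 t; lra.
Qed.

End RealInduction.

(** * The fan around a cell *)

Section LocalFan.
Variables (R : realType) (n k r d : nat) (B : 'M[R]_(d, n)).
Hypothesis gB : sign_bounded k r B.

Lemma span_pairs (g : nat -> nat) (h : 'rV[R]_n) : admissible n r g ->
  exists2 mu, supported (in_pairs r g) mu & orth B (mu + h).
Proof.
move=> [gg gn]; pose A := [set i : 'I_n | `[< in_pairs r g i >]].
have [|mu mA muW] := @span_mod R n d B A h.
  move=> u uU uA; suff -> : u = 0 by rewrite /dot big1 // => i _; rewrite mxE mulr0.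
  apply: (zero_pairs_eq0 gB uU gg) => [s /gn|c]; first lia.
  have lt : (pos g c < n)%N.
    by have := gn c.1 (ltn_ord _); rewrite /pos; case: (c.2); rewrite /= ?addn0 ?addn1; lia.
  rewrite -[pos g c]/(nat_of_ord (Ordinal lt)) at_ord uA // inE.
  by apply/asboolP/in_pairsP; exists c.
exists mu => // i mi; have : i \in A by apply: contraR mi => /mA->.
by rewrite inE => /asboolP.
Qed.

Lemma dotBl (a b u : 'rV[R]_n) : dot (a - b) u = dot a u - dot b u.
Proof. by rewrite dotDl -scaleN1r dotZl mulN1r. Qed.

(* The cones spanned modulo the face J cover the space.  Going from a point
   known to be covered along a segment on which a functional vanishing on J
   stays positive, the last covered point would lie in the relative interior of
   a larger face, whose fan covers the remaining direction by induction. *)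
Lemma cone_cover (a : 'rV[R]_n) (J : {set 'I_n}) (g : nat -> nat) (h : 'rV[R]_n) :
  orth B a -> a != 0 -> admissible n r g -> (forall i, a 0 i != 0 -> i \in J) ->
  (forall i : 'I_n, i \in J -> in_pairs r g i) ->
  exists g' mu, [/\ admissible n r g', forall i : 'I_n, i \in J -> in_pairs r g' i,
    supported (in_pairs r g') mu, forall i, i \notin J -> 0 <= mu 0 i & orth B (mu + h)].
Proof.
move=> aW a0 ag; move cJ : (n - #|J|)%N => N.
elim: N {-2}N (leqnn N) J g h ag cJ => [|N IH] N' leN J g h ag cJ sa sJ.
  have JT : J = finset.setT.
    apply/eqP; rewrite eqEcard finset.subsetT cardsT card_ord; lia.
  have [mu smu muW] := span_pairs h ag.
  by exists g, mu; split=> // i; rewrite JT inE.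
(* In the first case [h] lies in W + R^J and no entry off [J] is needed. *)
have [all0|] := pselect (forall u, (u <= B)%MS -> (forall i, i \in J -> u 0 i = 0) -> dot h u = 0).
  have [mu mJ muW] := span_mod all0; exists g, mu; split=> //.
    by move=> i mi; apply: sJ; apply: contraR mi => /mJ->.
  by move=> i /mJ->.
move=> /existsNP[u1 /not_implyP[u1U /not_implyP[u1J /eqP hu1]]].
have [u0 [u0U u0J hu0]] : exists u0, [/\ (u0 <= B)%MS, forall i, i \in J -> u0 0 i = 0 & 0 < dot h u0].
  case: (ltgtP (dot h u1) 0) hu1 => // hh _; last by exists u1.
  exists (- u1); split; first by rewrite eqmx_opp.
    by move=> i /u1J; rewrite mxE => ->; rewrite oppr0.
  rewrite (_ : dot h (- u1) = - dot h u1) ?oppr_gt0 //.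
  by rewrite /dot -sumrN; apply: eq_bigr => i _; rewrite mxE mulrN.
have [g1 [ag1 Jg1 [i1 i1g u0i1]]] : exists g1, [/\ admissible n r g1, forall i : 'I_n, i \in J -> in_pairs r g1 i &
     exists2 i1 : 'I_n, in_pairs r g1 i1 & u0 0 i1 < 0].
  apply: contrapT => nex; have u00 : u0 = 0.
    apply: (nonneg_near_eq0 gB ag aW a0 sa sJ u0U u0J) => g' ag' Jg' i ig'.
    by rewrite leNgt; apply/negP => lt; apply: nex; exists g'; split=> //; exists i.
  by move: hu0; rewrite u00 /dot big1 ?ltxx // => i _; rewrite mxE mulr0.
(* The segment starts at a point covered by [ev i1] itself. The functional [u0] is positive there
   and at [h], hence all along. *)
pose h1 := - ev R n i1.
have h1u : 0 < dot h1 u0 by rewrite /h1 -scaleN1r dotZl dot_ev at_ord mulN1r oppr_gt0.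
pose hs s := h1 + s *: (h - h1).
have hsu s : 0 <= s <= 1 -> 0 < dot (hs s) u0.
  move=> /andP[s0 s1]; rewrite /hs dotDl dotZl dotBl.
  by move: (dot h u0) (dot h1 u0) hu0 h1u => x y; nra.
pose P s := exists g' mu, [/\ admissible n r g', forall i : 'I_n, i \in J -> in_pairs r g' i,
    supported (in_pairs r g') mu, forall i, i \notin J -> 0 <= mu 0 i & orth B (mu + hs s)].
suff : P 1 by rewrite /P /hs scale1r addrC subrK.
apply: (@real_induction R P).
- exists g1, (ev R n i1); split=> //.
  + by move=> i; rewrite mxE; case: (i =P i1 :> nat) => [->|] //; rewrite eqxx.
  + by move=> i _; rewrite mxE ler0n.
  + by rewrite /hs scale0r addr0 /h1 subrr /orth mul0mx.
- move=> s /andP[s0 s1] [g2 [mu [ag2 Jg2 smu mupos muW]]].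
  pose J' := J :|: [set i | mu 0 i != 0].
  (* Since [mu + hs s] is in W and [u0] is positive on [hs s], the product of [mu] and [u0] is
     nonzero. As [u0] vanishes on [J], [mu] has a nonzero entry off [J]. *)
  have cJ' : (#|J| < #|J'|)%N.
    apply: proper_card; rewrite properE finset.subsetUl /=; apply/negP => /fintype.subsetP sub.
    have : dot (mu + hs s) u0 = 0 by exact: (orth_dot muW).
    rewrite dotDl (_ : dot mu u0 = 0) ?add0r.
      by move=> E; have := hsu s; rewrite E ltxx s0 (ltW s1) => /(_ isT).
    rewrite /dot big1 // => i _; have [->|mi] := eqVneq (mu 0 i) 0; first by rewrite mul0r.
    by rewrite u0J ?mulr0 //; apply: sub; rewrite finset.in_setU inE mi orbT.
  have J'g2 i : i \in J' -> in_pairs r g2 i.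
    by rewrite finset.in_setU inE => /orP[|mi]; [exact: Jg2|exact: smu].
  have maxJ' : (#|J'| <= n)%N by rewrite -[X in (_ <= X)%N]card_ord max_card.
  have [||g3 [nu [ag3 Jg3 snu nupos nuW]]] := IH _ _ J' g2 (h - h1) ag2 erefl _ J'g2; first by lia.
    by move=> i /sa iJ; rewrite finset.in_setU iJ.
  have rad i : exists2 e, 0 < e & forall t, 0 < t < e -> i \notin J -> 0 <= mu 0 i + t * nu 0 i.
    have [iJ|iJ] := boolP (i \in J); first by exists 1.
    have [mi|mi] := eqVneq (mu 0 i) 0.
      exists 1 => // x /andP[x0 _] _; rewrite mi add0r mulr_ge0 ?(ltW x0) // nupos //.
      by rewrite finset.in_setU negb_or iJ inE mi eqxx.
    have [|e e0 He] := @affine_ball R (mu 0 i) (nu 0 i).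
      by rewrite lt_neqAle eq_sym mi mupos.
    by exists e => // x /andP[x0 xe] _; apply/ltW/He; rewrite gtr0_norm.
  have [e e0 He] := finite_radius rad.
  pose t := Num.min (e / 2) (1 - s).
  have t0 : 0 < t by rewrite lt_min divr_gt0 // subr_gt0.
  have te : t < e by rewrite gt_min; apply/orP; left; lra.
  have t1 : t <= 1 - s by rewrite ge_min lexx orbT.
  exists (s + t); first by apply/andP; split; lra.
  exists g3, (mu + t *: nu); split=> //.
  + by move=> i iJ; apply: Jg3; rewrite finset.in_setU iJ.
  + move=> i; rewrite !mxE; have [mi|mi] := eqVneq (mu 0 i) 0; last first.
      by move=> _; apply: Jg3; rewrite finset.in_setU inE mi orbT.
    by rewrite mi add0r mulf_eq0 negb_or => /andP[_]; apply: snu.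
  + by move=> i iJ; rewrite !mxE; apply: He => //; rewrite t0.
  + rewrite (_ : _ + _ = (mu + hs s) + t *: (nu + (h - h1))); first by apply: orthD => //; apply: orthZ.
    by apply/rowP => i; rewrite !mxE; ring.
- move=> s /andP[s0 s1] nPs.
  (* Closedness is checked for each of the finitely many sets K separately. On a fixed K the
     covering vector is determined off [J] and affine in the parameter, so an entry that is negative
     at s stays negative nearby. *)
  pose Q (A : {set 'I_n}) x := ~ exists g' mu, [/\ admissible n r g', forall i : 'I_n, in_pairs r g' i <-> i \in A,
     forall i : 'I_n, i \in J -> in_pairs r g' i,
     supported (in_pairs r g') mu & (forall i, i \notin J -> 0 <= mu 0 i) /\ orth B (mu + hs (s - x))].
  suff rad A : exists2 e, 0 < e & forall x, 0 < x < e -> Q A x.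
    have [e e0 He] := finite_radius rad.
    exists e => // x xe [g' [mu [h2 h3 h4 h5 h6]]]; refine (He x xe [set i : 'I_n | `[< in_pairs r g' i >]] _).
    exists g', mu; split=> // i; rewrite inE; split=> [?|/asboolP//]; exact/asboolP.
  have [[g2 [ag2 Ag2 Jg2]]|nA] := pselect (exists g2, [/\ admissible n r g2, forall i : 'I_n, in_pairs r g2 i <-> i \in A &
       forall i : 'I_n, i \in J -> in_pairs r g2 i]); last first.
    by exists 1 => // x _ [g' [mu [h2 h3 h4 _ _]]]; apply: nA; exists g'.
  have [m1 sm1 m1W] := span_pairs h1 ag2; have [m2 sm2 m2W] := span_pairs (h - h1) ag2.
  have mW x : orth B (m1 + x *: m2 + hs x).
    rewrite (_ : _ + _ = (m1 + h1) + x *: (m2 + (h - h1))); first by apply: orthD => //; apply: orthZ.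
    by apply/rowP => i; rewrite !mxE; ring.
  have sm x : supported (in_pairs r g2) (m1 + x *: m2).
    move=> i; rewrite !mxE; have [mi|mi _] := eqVneq (m1 0 i) 0; last exact: sm1.
    by rewrite mi add0r mulf_eq0 negb_or => /andP[_]; exact: sm2.
  have [i iJ mi] : exists2 i, i \notin J & (m1 + s *: m2) 0 i < 0.
    apply: contrapT => nex; apply: nPs; exists g2, (m1 + s *: m2); split=> // i iJ.
    by rewrite leNgt; apply/negP => lt; apply: nex; exists i.
  have [|e e0 He] := @affine_ball R (- (m1 + s *: m2) 0 i) (m2 0 i); first by rewrite oppr_gt0.
  exists e => // x xe [g' [mu [ag' Ag' Jg' smu [mupos muW]]]].
  have sw : supported (in_pairs r g2) (mu - (m1 + (s - x) *: m2)).
    move=> j wj; have [E|mj] := eqVneq (mu 0 j) 0.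
      apply: (sm (s - x)); move: wj; rewrite [X in X != 0 -> _]mxE [X in _ + X]mxE E add0r oppr_eq0 //.
    by apply/Ag2/Ag'; exact: smu.
  have wW : orth B (mu - (m1 + (s - x) *: m2)).
    rewrite (_ : _ - _ = (mu + hs (s - x)) + (-1) *: (m1 + (s - x) *: m2 + hs (s - x))).
      by apply: orthD => //; apply: orthZ.
    by apply/rowP => j; rewrite !mxE; ring.
  have sag : supported (in_pairs r g2) a by move=> j /sa; exact: Jg2.
  have [y Ey] := dependency_line gB ag2 aW wW a0 sag sw.
  have ai : a 0 i = 0 by apply/eqP; apply: contraR iJ => /sa.
  have := congr1 (fun X : 'rV_n => X 0 i) Ey; rewrite !mxE ai mulr0.
  have /andP[x0 xe'] := xe; have := mupos i iJ; have := He x; rewrite gtr0_norm // => /(_ xe'); rewrite !mxE; move: (mu 0 i) (m1 0 i) (m2 0 i) => p q q'; lra.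
Qed.

End LocalFan.

(** * Counting the elements of a union of pairs *)

Section Counting.
Variable r : nat.

Definition pair_count (g : nat -> nat) (j : nat) : nat :=
  (\sum_(s < r) ((g s < j) + ((g s).+1 < j)))%N.

Lemma odd_pair_count (g : nat -> nat) (j : nat) : gapped r g ->
  odd (pair_count g j) <-> exists2 s, (s < r)%N & j = (g s).+1.
Proof.
move=> gg; split=> [oj|[s sr E]].
  apply: contrapT => nex; move: oj; rewrite /pair_count (big_morph odd oddD (erefl _)) big1 //.
  by move=> s _; case: (ltngtP (g s).+1 j) => h //; case: nex; exists s.
rewrite /pair_count (big_morph odd oddD (erefl _)) (bigD1 (Ordinal sr)) //= E ltnS leqnn ltnn.
rewrite big1 // => t ts; have {ts} : t != s :> nat by [].
rewrite neq_ltn => /orP[h|h].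
  have := @gapped_lt r g t s gg; rewrite h sr => /(_ isT) h2.
  have -> : (g t < (g s).+1)%N = true by lia.
  by have -> : ((g t).+1 < (g s).+1)%N = true by lia.
have := @gapped_lt r g s t gg; rewrite h ltn_ord => /(_ isT) h2.
have -> : (g t < (g s).+1)%N = false by lia.
by have -> : ((g t).+1 < (g s).+1)%N = false by lia.
Qed.

Lemma pair_countS (g : nat -> nat) (j : nat) : gapped r g ->
  pair_count g j.+1 = (pair_count g j + `[< in_pairs r g j >])%N.
Proof.
move=> gg; rewrite /pair_count.
have -> : (`[< in_pairs r g j >] : nat) = (\sum_(s < r) ((j == g s) + (j == (g s).+1)))%N.
  rewrite (eq_bigr (fun s : 'I_r => \sum_(b : bool) (j == pos g (s, b)))%N); last first.
    by move=> s _; rewrite big_bool /pos /= addn0 addn1 addnC.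
  rewrite pair_big /=; case: asboolP => [/in_pairsP[c ->]|nj].
    rewrite (bigD1 c) //= -surjective_pairing eqxx big1 // => c' cc'.
    by case: eqP => // /(pos_inj gg) E; case/eqP: cc'; rewrite E; case: (c').
  by rewrite big1 // => c _; case: eqP => // E; case: nj; apply/in_pairsP; exists (c.1, c.2).
rewrite -big_split; apply: eq_bigr => s _ /=.
by case: (ltngtP (g s) j); case: (ltngtP (g s).+1 j); case: (ltngtP j (g s)); lia.
Qed.

(** Counting up to j + 1 instead of j makes up for pairs shifted to the right by at most 1, and
    costs at most one element. *)
Lemma pair_count_le (g g' : nat -> nat) (j : nat) : gapped r g -> gapped r g' ->
  (forall s, (s < r)%N -> (g' s <= (g s).+1)%N) -> (pair_count g j <= (pair_count g' j).+1)%N.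
Proof.
move=> gg gg' h; apply: (@leq_trans (pair_count g' j.+1)).
  by apply: leq_sum => s _; have := h s (ltn_ord s); lia.
by rewrite pair_countS //; case: (asbool _); lia.
Qed.

Lemma pair_count_full (g : nat -> nat) (n : nat) : admissible n r g -> pair_count g n = r.*2.
Proof.
move=> [_ gn]; rewrite /pair_count (eq_bigr (fun=> 2%N)); last by move=> s _; have := gn s (ltn_ord s); lia.
by rewrite sum_nat_const card_ord; lia.
Qed.

End Counting.

(** * Overlaps of the cones around a cell *)

Section Uniqueness.
Variables (R : realType) (n k r d : nat) (B : 'M[R]_(d, n)).
Hypothesis gB : sign_bounded k r B.

(** Here [j] starts a component of the symmetric difference of K and K', and its next element [b]
    ends it: in between the counts differ by one, so [b] can only be in K'. By parity, each position
    strictly between ends a pair of one system, hence is common to both, and [u] vanishes there.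
    Subtracting the vanishing prefix sums leaves [mu j * u j = mu' b * u b], which gives [u] equal
    signs at [j] and [b]. *)
Lemma start_flat (g g' : nat -> nat) (mu mu' u : 'rV[R]_n) (j : nat) :
  admissible n r g -> admissible n r g' ->
  (forall s, (s < r)%N -> (g' s <= (g s).+1)%N /\ (g s <= (g' s).+1)%N) ->
  supported (in_pairs r g) mu -> supported (in_pairs r g') mu' ->
  (forall i : 'I_n, ~ in_pairs r g i -> 0 <= mu' 0 i) ->
  (forall i, in_pairs r g i -> in_pairs r g' i -> at_ u i = 0) ->
  (forall i, (i <= n)%N -> pair_count r g i = pair_count r g' i ->
     \sum_(x < i) (at_ mu x - at_ mu' x) * at_ u x = 0) ->
  (j < n)%N -> in_pairs r g j -> ~ in_pairs r g' j -> pair_count r g j = pair_count r g' j -> 0 < at_ mu j ->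
  at_ u j.+1 = 0 -> flat (at_ u) j.
Proof.
move=> ag ag' cl smu smu' mu'0 uz P0 jn Kj K'j cj muj uj1; left; split=> // uj.
have [gg gn] := ag; have [gg' gn'] := ag'.
have cS := pair_countS _ gg; have cS' := pair_countS _ gg'.
have le1 i : (pair_count r g i <= (pair_count r g' i).+1)%N by apply: pair_count_le => // s /cl[].
have at_out (m : 'rV[R]_n) f i : supported (in_pairs r f) m -> ~ in_pairs r f i -> at_ m i = 0.
  move=> sm ni; case: (ltnP i n) => h; last exact: at_ge.
  rewrite -[i]/(nat_of_ord (Ordinal h)) at_ord; apply/eqP; apply: contraT => /sm //.
pose D i := `[< in_pairs r g i >] != `[< in_pairs r g' i >].
(* Otherwise the counts would still differ at n, where both are 2r. *)
have ex : exists b, (j < b)%N && D b.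
  apply: contrapT => nex.
  have H i : (j < i)%N -> pair_count r g i = (pair_count r g' i).+1.
    elim: i => // i IH; rewrite ltnS leq_eqVlt => /orP[/eqP<-|ji].
      by rewrite cS cS' cj asboolT // asboolF // addn0 addn1.
    have : ~~ D i by apply/negP => Di; apply: nex; exists i; rewrite ji.
    by rewrite negbK cS cS' IH // => /eqP->; rewrite addSn.
  by have := H n jn; rewrite !(@pair_count_full r _ n) //; lia.
case: (ex_minnP ex) => b /andP[jb Db] bmin.
have H i : (j < i <= b)%N -> pair_count r g i = (pair_count r g' i).+1.
  elim: i => // i IH; rewrite ltnS leq_eqVlt => /andP[/orP[/eqP<-|ji] ib].
    by rewrite cS cS' cj asboolT // asboolF // addn0 addn1.
  have : ~~ D i by apply/negP => Di; have := bmin i; rewrite ji Di => /(_ isT); lia.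
  by rewrite negbK cS cS' IH ?ji ?(ltnW ib) // => /eqP->; rewrite addSn.
have bK : ~ in_pairs r g b /\ in_pairs r g' b.
  move: Db; rewrite /D; case: asboolP => Kb; case: asboolP => K'b //= _.
  by have := le1 b.+1; rewrite cS cS' H ?jb ?leqnn // asboolT // asboolF //; lia.
have [Kb K'b] := bK.
have bn : (b < n)%N by have [s sr E] := K'b; have := gn' s sr; case: E; lia.
have between i : (j < i < b)%N -> at_ u i = 0.
  move=> /andP[ji ib].
  have nD : ~~ D i by apply/negP => Di; have := bmin i; rewrite ji Di => /(_ isT); lia.
  have par : odd (pair_count r g i) != odd (pair_count r g' i) by rewrite H ?ji ?(ltnW ib) //=; case: (odd _).
  have KK : `[< in_pairs r g i >] || `[< in_pairs r g' i >].
    case o: (odd (pair_count r g i)) par => o2.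
      by have /(odd_pair_count _ gg)[s sr ->] := o; rewrite asboolT //; exists s => //; right.
    have : odd (pair_count r g' i) by move: o2; case: (odd _).
    by move=> /(odd_pair_count _ gg')[s sr ->]; rewrite [X in _ || X]asboolT ?orbT //; exists s => //; right.
  by move: nD KK; rewrite /D; case: asboolP => K1; case: asboolP => K2 //= _ _; apply: uz.
have P0' i : (i <= n)%N -> pair_count r g i = pair_count r g' i ->
    \sum_(0 <= x < i) (at_ mu x - at_ mu' x) * at_ u x = 0 by rewrite big_mkord; exact: P0.
have Pj := P0' j (ltnW jn) cj.
have := P0' b.+1 bn; rewrite cS cS' H ?jb ?leqnn // asboolF // asboolT // addn0 addn1 => /(_ erefl).
rewrite (@big_cat_nat _ _ _ j) ?(leq_trans (ltnW jb)) //=.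
rewrite Pj add0r big_ltn; last by rewrite ltnW.
rewrite big_nat_recr //= big_nat big1 ?add0r; last first.
  by move=> i hi; rewrite between ?mulr0.
rewrite (at_out mu' g' j) // (at_out mu g b) // subr0 sub0r => E.
exists b; split=> //.
have mb : 0 <= at_ mu' b.
  by rewrite -[b]/(nat_of_ord (Ordinal bn)) at_ord; apply: mu'0.
move: E muj mb uj; move: (at_ mu j) (at_ mu' b) (at_ u j) (at_ u b) => x y z w E x0 y0 z0.
have xz : x * z = y * w by lra.
have p : 0 < x * (z * z) by rewrite mulr_gt0 // -expr2 exprn_even_gt0.
have p2 : 0 < y * (z * w) by rewrite (_ : y * (z * w) = x * (z * z)) //; rewrite [RHS]mulrA xz; ring.
by rewrite -(pmulr_rgt0 (z * w) (x := y)) // lt_neqAle y0 andbT eq_sym; apply/eqP => y00; rewrite y00 mul0r ltxx in p2.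
Qed.

(* Some u <> 0 in U vanishes on the positions common to g and g' and is
   orthogonal to mu - mu' restricted to each component of their symmetric
   difference.  As mu - mu' has opposite signs at the two ends of a component, u
   has equal signs there, and flat_eq0 gives u = 0.  The choice of g and g' by
   their first elements makes mu - mu' nonzero at the left ends. *)
Lemma cone_unique_canonical (a : 'rV[R]_n) (J : {set 'I_n}) (g g' : nat -> nat) (mu mu' : 'rV[R]_n) :
  orth B a -> a != 0 -> (forall i, a 0 i != 0 -> i \in J) ->
  admissible n r g -> admissible n r g' ->
  (forall i : 'I_n, i \in J -> in_pairs r g i) -> (forall i : 'I_n, i \in J -> in_pairs r g' i) ->
  supported (in_pairs r g) mu -> supported (in_pairs r g') mu' ->
  (forall i, i \notin J -> 0 <= mu 0 i) -> (forall i, i \notin J -> 0 <= mu' 0 i) ->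
  (forall s, (s < r)%N -> exists2 i : 'I_n, i \in J \/ mu 0 i != 0 & i = g s :> nat) ->
  (forall s, (s < r)%N -> exists2 i : 'I_n, i \in J \/ mu' 0 i != 0 & i = g' s :> nat) ->
  orth B (mu - mu') -> forall i, in_pairs r g i -> in_pairs r g' i.
Proof.
move=> aW a0 sa ag ag' Jg Jg' smu smu' mu0 mu'0 can can' dW i Ki; apply: contrapT => K'i.
have [gg gn] := ag; have [gg' gn'] := ag'.
have sag : supported (in_pairs r g) a by move=> j /sa /Jg.
have sag' : supported (in_pairs r g') a by move=> j /sa /Jg'.
have cl := pairs_close gB ag ag' aW a0 sag sag'.
have cl' s : (s < r)%N -> (g s <= (g' s).+1)%N /\ (g' s <= (g s).+1)%N by case/cl.
have cS := pair_countS _ gg; have cS' := pair_countS _ gg'.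
have le1 j : (pair_count r g j <= (pair_count r g' j).+1)%N by apply: pair_count_le => // s /cl[].
have le2 j : (pair_count r g' j <= (pair_count r g j).+1)%N by apply: pair_count_le => // s /cl[].
pose Kb j := `[< in_pairs r g j >]; pose Kb' j := `[< in_pairs r g' j >].
pose D j := Kb j != Kb' j.
have ex : exists j, D j by exists i; rewrite /D /Kb /Kb' asboolT // asboolF.
case: (ex_minnP ex) => a1 Da1 a1min.
(* The starts of corresponding pairs differ by at most 1, so [lo s + 1] is always common to K and
   K', and so are all the zeros needed for flatness at [lo s]. *)
pose lo s := minn (g s) (g' s).
have lo_case s : (s < r)%N -> [\/ g s = g' s, g' s = (g s).+1 | g s = (g' s).+1].
  by move=> /cl[h1 h2]; case: (ltngtP (g s) (g' s)) => h; [apply: Or32|apply: Or33|apply: Or31]; lia.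
have lo1 s : (s < r)%N -> in_pairs r g (lo s).+1 /\ in_pairs r g' (lo s).+1.
  move=> sr; case: (lo_case s sr) => E; split; exists s => //; rewrite /lo E; lia.
have loK s : (s < r)%N -> in_pairs r g (lo s) \/ in_pairs r g' (lo s).
  by move=> sr; case: (leqP (g s) (g' s)) => h; [left|right]; exists s => //; rewrite /lo; lia.
have both j : in_pairs r g j -> in_pairs r g' j -> exists c : 'I_r * bool, j = pos lo c.
  move=> Kj K'j; have [s sr E] := Kj.
  have mk t b : (t < r)%N -> j = (lo t + nat_of_bool b)%N -> exists c : 'I_r * bool, j = pos lo c.
    by move=> tr ->; exists (Ordinal tr, b).
  case: (lo_case s sr) => Es.
  - by case: E => E; [apply: (mk s false)|apply: (mk s true)] => //; rewrite /lo /=; lia.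
  - by case: E => E; [apply: (mk s false)|apply: (mk s true)] => //; rewrite /lo /=; lia.
  - case: E => E; first by apply: (mk s true) => //; rewrite /lo /=; lia.
    have [t tr Et] := K'j.
    have st : (s < t)%N.
      case: (ltngtP s t) => // h; last by rewrite -h in Et; case: Et; lia.
      by have := @gapped_lt r g' t s gg'; rewrite h sr => /(_ isT); case: Et; lia.
    have := @gapped_lt r g s t gg; rewrite st tr => /(_ isT) h1.
    have := @gapped_lt r g' s t gg'; rewrite st tr => /(_ isT) h2.
    by apply: (mk t false) => //; rewrite /lo /=; case: Et; case: (lo_case t tr); lia.
have start j : D j -> pair_count r g j = pair_count r g' j -> exists2 s, (s < r)%N & j = lo s.
  rewrite /D /Kb /Kb'; case: asboolP => Kj; case: asboolP => K'j //= _ cj.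
    have [s sr E] := Kj; case: E => E.
      exists s => //; case: (lo_case s sr) => Es; rewrite /lo; [|lia|].
        by case: K'j; exists s => //; left; rewrite -Es.
      by case: K'j; exists s => //; right; rewrite -Es.
    have : odd (pair_count r g' j) by rewrite -cj; apply/odd_pair_count => //; exists s.
    by move=> /(odd_pair_count _ gg')[t tr Et]; case: K'j; exists t => //; right.
  have [s sr E] := K'j; case: E => E.
    exists s => //; case: (lo_case s sr) => Es; rewrite /lo; [| |lia].
      by case: Kj; exists s => //; left; rewrite Es.
    by case: Kj; exists s => //; right; rewrite -Es.
  have : odd (pair_count r g j) by rewrite cj; apply/odd_pair_count => //; exists s.
  by move=> /(odd_pair_count _ gg)[t tr Et]; case: Kj; exists t => //; right.
have nD j : ~~ D j -> in_pairs r g j \/ in_pairs r g' j -> in_pairs r g j /\ in_pairs r g' j.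
  by rewrite negbK /D /Kb /Kb'; case: asboolP => K1; case: asboolP => K2 //= _ [].
have d_out (j : 'I_n) : ~ in_pairs r g j -> ~ in_pairs r g' j -> (mu - mu') 0 j = 0.
  move=> K1 K2; rewrite !mxE.
  have -> : mu 0 j = 0 by apply/eqP; apply: contraT => /smu.
  by have -> : mu' 0 j = 0; [apply/eqP; apply: contraT => /smu'|rewrite subrr].
have eq_below j : (j <= a1)%N -> pair_count r g j = pair_count r g' j.
  elim: j => [|j IH] ja; first by rewrite /pair_count !big1.
  have : ~~ D j by apply/negP => /a1min; lia.
  by rewrite negbK cS cS' IH ?(ltnW ja) // => /eqP; rewrite /Kb /Kb' => ->.
have [s0 s0r E0] := start a1 Da1 (eq_below _ (leqnn _)).
pose c2 : 'I_r * bool := (Ordinal s0r, false).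
have [j0 aj0] : exists i, a 0 i != 0.
  by apply/rV0Pn.
have [c1 Ec1] := both _ (sag _ aj0) (sag' _ aj0).
have c12 : c1 != c2.
  apply/eqP => E; have : D j0 by rewrite Ec1 E /pos /= addn0 -E0.
  by rewrite /D /Kb /Kb' !asboolT //; [exact: sag'|exact: sag].
pose pf j : 'rV[R]_n := \row_x (if (x < j)%N then (mu - mu') 0 x else 0).
(* One condition for each position of the pairs starting at the [lo s]: [u] vanishes there if the
   position is common to K and K', otherwise the prefix sum below it vanishes. Condition [c1] is
   recovered from orthogonality to [a]; [c2] concerns the prefix before the first component, all of
   whose terms are zero. *)
pose F (c : 'I_r * bool) := if c.2 || (Kb (lo c.1) && Kb' (lo c.1)) then ev R n (pos lo c) else pf (lo c.1).
have [u [uU u0 uz]] := solve_but_two gB F c12.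
have pfE j : (j <= n)%N -> dot (pf j) u = \sum_(x < j) (at_ mu x - at_ mu' x) * at_ u x.
  move=> jn; rewrite (big_ord_widen n (fun x => (at_ mu x - at_ mu' x) * at_ u x) jn).
  rewrite /dot [RHS]big_mkcond /=; apply: eq_bigr => x _.
  by rewrite !mxE !at_ord; case: ifP; rewrite ?mul0r.
have uKK' j : in_pairs r g j -> in_pairs r g' j -> j <> j0 -> at_ u j = 0.
  move=> K1 K2 jj0; have [c Ec] := both _ K1 K2.
  rewrite Ec -dot_ev; have := uz c; rewrite /F.
  have -> : c.2 || (Kb (lo c.1) && Kb' (lo c.1)).
    case E: (c.2) => //=; move: Ec; rewrite /pos E addn0 => <-.
    by rewrite /Kb /Kb' !asboolT.
  apply; first by apply/eqP => E; apply: jj0; rewrite Ec E -Ec1.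
  apply/eqP => E; have : D j by rewrite Ec E /pos /= addn0 -E0.
  by rewrite /D /Kb /Kb' !asboolT.
have uj0 : u 0 j0 = 0.
  have := orth_dot aW uU; rewrite /dot (bigD1 j0) //= big1 ?addr0.
    by move/eqP; rewrite mulf_eq0 (negbTE aj0) => /eqP.
  move=> x xj; have [->|ax] := eqVneq (a 0 x) 0; first by rewrite mul0r.
  rewrite -(at_ord u) uKK' ?mulr0 //; [exact: sag|exact: sag'|].
  by move/val_inj => E; rewrite E eqxx in xj.
have uKK j : in_pairs r g j -> in_pairs r g' j -> at_ u j = 0.
  move=> K1 K2; have [->|jj0] := eqVneq j (nat_of_ord j0); first by rewrite at_ord.
  by apply: uKK' => //; exact/eqP.
have term0 j : ~~ D j -> (at_ mu j - at_ mu' j) * at_ u j = 0.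
  move=> nDj; case: (ltnP j n) => jn; last by rewrite [at_ u j]at_ge ?mulr0.
  have [K12|nK] := pselect (in_pairs r g j \/ in_pairs r g' j).
    by have [K1 K2] := nD _ nDj K12; rewrite uKK ?mulr0.
  rewrite -[j]/(nat_of_ord (Ordinal jn)) !at_ord.
  have := d_out (Ordinal jn); rewrite !mxE => ->; rewrite ?mul0r // => K; apply: nK; [by left|by right].
have lon s : (s < r)%N -> ((lo s).+1 < n)%N by move=> sr; have := gn s sr; rewrite /lo; lia.
have P0lo s : (s < r)%N -> ~ (in_pairs r g (lo s) /\ in_pairs r g' (lo s)) ->
    \sum_(x < lo s) (at_ mu x - at_ mu' x) * at_ u x = 0.
  move=> sr nb; rewrite -pfE; last by have := lon s sr; lia.
  have [Es|ns] := eqVneq (lo s) a1.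
    rewrite pfE; last by have := lon s sr; lia.
    by rewrite Es big1 // => x _; apply: term0; apply/negP => /a1min; rewrite leqNgt ltn_ord.
  have := uz (Ordinal sr, false); rewrite /F /=.
  rewrite (_ : Kb (lo s) && Kb' (lo s) = false); last first.
    by apply/negP => /andP[/asboolP h1 /asboolP h2]; apply: nb.
  apply.
    apply/eqP => E; apply: nb; rewrite -[lo s]addn0 -[(lo s + 0)%N]/(pos lo (Ordinal sr, false)) E -Ec1.
    by split; [exact: sag|exact: sag'].
  by apply/eqP => -[E]; rewrite E -E0 eqxx in ns.
(* Downward induction from n, where the sum is the product of [u] with a vector of W. Positions
   outside the symmetric difference contribute nothing, and at the start of a component the choice
   of [u] applies. *)
have P0 j : (j <= n)%N -> pair_count r g j = pair_count r g' j ->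
    \sum_(x < j) (at_ mu x - at_ mu' x) * at_ u x = 0.
  move=> jn; rewrite -(subKn jn); move: (n - j)%N => x.
  elim: x => [|x IH] cx.
    rewrite subn0 -[RHS](orth_dot dW uU) /dot; apply: eq_bigr => y _.
    by rewrite !mxE !at_ord.
  case: (ltnP x n) => xn; last first.
    by move: IH cx; rewrite (eqP xn) (_ : (n - x.+1 = 0)%N) ?big_ord0 //; lia.
  have [Dx|nDx] := boolP (D (n - x.+1)%N).
    have [s sr E] := start _ Dx cx; rewrite E; apply: P0lo => // -[K1 K2].
    by move: Dx; rewrite E /D /Kb /Kb' !asboolT.
  have := IH; rewrite (_ : (n - x = (n - x.+1).+1)%N) ?big_ord_recr /=; last by lia.
  rewrite term0 // addr0; apply; rewrite cS cS' cx.
  by move: nDx; rewrite negbK /D /Kb /Kb' => /eqP->.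
move/eqP: u0; apply; apply: (flat_eq0 gB uU (v := at_ u) (l := lo)).
- by move=> j uj; rewrite -expr2 exprn_even_gt0.
- by move=> j; exact: at_ge.
- by move=> s sr; have := gg s sr; have := gg' s sr; rewrite /lo; lia.
- by move=> s /lon; lia.
move=> s sr; have [k1 k2] := lo1 s sr; have u1 := uKK _ k1 k2; split=> //.
have losn : (lo s < n)%N by have := lon s sr; lia.
have [[K1 K2]|nb] := pselect (in_pairs r g (lo s) /\ in_pairs r g' (lo s)).
  by apply: flat_zero => //; exact: uKK.
have even_lo f : gapped r f -> lo s = f s -> ~~ odd (pair_count r f (lo s)).
  move=> gf E; apply/negP => /(odd_pair_count _ gf)[t tr Et].
  have := @pos_inj r f (Ordinal sr, false) (Ordinal tr, true) gf.
  by rewrite /pos /= addn0 addn1 -Et -E => /(_ erefl).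
have nodd f : gapped r f -> ~ in_pairs r f (lo s) -> ~~ odd (pair_count r f (lo s)).
  by move=> gf nf; apply/negP => /(odd_pair_count _ gf)[t tr Et]; apply: nf; exists t => //; right.
have ceq : ~~ odd (pair_count r g (lo s)) -> ~~ odd (pair_count r g' (lo s)) -> pair_count r g (lo s) = pair_count r g' (lo s).
  by have := le1 (lo s); have := le2 (lo s); lia.
have nJ f (x : 'I_n) : (forall i : 'I_n, i \in J -> in_pairs r f i) -> ~ in_pairs r f x -> x \notin J.
  by move=> Jf nf; apply/negP => /Jf.
case: (leqP (g s) (g' s)) => h.
  have Elo : lo s = g s by rewrite /lo; lia.
  have K1 : in_pairs r g (lo s) by exists s => //; left.
  have K2 : ~ in_pairs r g' (lo s) by move=> K2; apply: nb.
  have cs := ceq (even_lo _ gg Elo) (nodd _ gg' K2).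
  apply: (start_flat ag ag' cl smu smu') => //.
    by move=> x nx; apply: mu'0; apply: nJ nx.
  have [x xJ Ex] := can s sr; rewrite Elo -Ex at_ord.
  have xn : x \notin J by apply: (nJ g') => //; rewrite Ex -Elo.
  by case: xJ => [xJ|mx]; [rewrite xJ in xn|rewrite lt_neqAle eq_sym mx mu0].
have Elo : lo s = g' s by rewrite /lo; lia.
have K1 : in_pairs r g' (lo s) by exists s => //; left.
have K2 : ~ in_pairs r g (lo s) by move=> K2; apply: nb.
have cs := ceq (nodd _ gg K2) (even_lo _ gg' Elo).
apply: (start_flat ag' ag cl' smu' smu) => //.
- by move=> x nx; apply: mu0; apply: nJ nx.
- by move=> x h1 h2; apply: uKK.
- move=> x xn cx; transitivity (- \sum_(y < x) (at_ mu y - at_ mu' y) * at_ u y); last by rewrite P0 ?oppr0.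
  by rewrite -sumrN; apply: eq_bigr => y _; rewrite -mulNr opprB.
have [x xJ Ex] := can' s sr; rewrite Elo -Ex at_ord.
have xn : x \notin J by apply: (nJ g) => //; rewrite Ex -Elo.
by case: xJ => [xJ|mx]; [rewrite xJ in xn|rewrite lt_neqAle eq_sym mx mu'0].
Qed.

(** The greedy systems around [J] and the support of each vector are canonical. They put [mu] and
    [mu'] on one common K, where the difference is a multiple of [a] and so vanishes off [J]. *)
Lemma cone_unique (a h : 'rV[R]_n) (J : {set 'I_n}) (g g' : nat -> nat) (mu mu' : 'rV[R]_n) :
  orth B a -> a != 0 -> (forall i, a 0 i != 0 -> i \in J) ->
  admissible n r g -> admissible n r g' ->
  (forall i : 'I_n, i \in J -> in_pairs r g i) -> (forall i : 'I_n, i \in J -> in_pairs r g' i) ->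
  supported (in_pairs r g) mu -> supported (in_pairs r g') mu' ->
  (forall i, i \notin J -> 0 <= mu 0 i) -> (forall i, i \notin J -> 0 <= mu' 0 i) ->
  orth B (mu + h) -> orth B (mu' + h) -> forall i, i \notin J -> mu 0 i = mu' 0 i.
Proof.
move=> aW a0 sa ag ag' Jg Jg' smu smu' mu0 mu'0 muW mu'W.
have canon f (m : 'rV[R]_n) : admissible n r f -> (forall i : 'I_n, i \in J -> in_pairs r f i) -> supported (in_pairs r f) m ->
    exists f', [/\ admissible n r f', forall i : 'I_n, i \in J -> in_pairs r f' i, supported (in_pairs r f') m &
       forall s, (s < r)%N -> exists2 i : 'I_n, i \in J \/ m 0 i != 0 & i = f' s :> nat].
  move=> af Jf sm; pose J' := J :|: [set i | m 0 i != 0].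
  have J'P i : i \in J' <-> i \in J \/ m 0 i != 0.
    by rewrite finset.in_setU inE; split=> [/orP//|[]->]; rewrite ?orbT.
  have [||f' [af' Jf' [hit _]]] := meets_all_pairs_right gB af aW a0 (J := J').
  - by move=> i /sa iJ; apply/J'P; left.
  - by move=> i /J'P[/Jf|/sm].
  exists f'; split=> //.
  - by move=> i iJ; apply: Jf'; apply/J'P; left.
  - by move=> i mi; apply: Jf'; apply/J'P; right.
  - by move=> s /hit[i /J'P iJ E]; exists i.
have [f [af Jf smf hit]] := canon _ _ ag Jg smu.
have [f' [af' Jf' smf' hit']] := canon _ _ ag' Jg' smu'.
have dW : orth B (mu - mu').
  rewrite (_ : mu - mu' = (mu + h) + (-1) *: (mu' + h)); first by apply: orthD => //; apply: orthZ.
  by apply/rowP => j; rewrite !mxE; ring.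
have dW' : orth B (mu' - mu) by rewrite -opprB -scaleN1r; apply: orthZ.
have H2 := cone_unique_canonical aW a0 sa af' af Jf' Jf smf' smf mu'0 mu0 hit' hit dW'.
have sd : supported (in_pairs r f) (mu - mu').
  move=> i; rewrite !mxE; have [->|mi _] := eqVneq (mu' 0 i) 0; last by apply: H2; exact: smf'.
  by rewrite subr0; exact: smf.
move=> i iJ; have [x Ex] := dependency_line gB af aW dW a0 (fun j aj => Jf j (sa j aj)) sd.
have ai : a 0 i = 0 by apply/eqP; apply: contraR iJ => /sa.
have := congr1 (fun X : 'rV_n => X 0 i) Ex; rewrite !mxE ai mulr0 => /eqP.
by rewrite subr_eq0 => /eqP.
Qed.

End Uniqueness.

(** * Local constancy of the number of cells *)

Section Cells.
Variables (R : realType) (n r : nat).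

Definition cell_in (d : nat) (B : 'M[R]_(d, n)) (g : nat -> nat) (J : {set 'I_n}) : Prop :=
  [/\ admissible n r g, J != finset.set0, forall i : 'I_n, i \in J -> in_pairs r g i &
    exists2 a, orth B a & forall i, (i \in J -> 0 < a 0 i) /\ (i \notin J -> a 0 i = 0)].

Definition cell_of (d : nat) (B : 'M[R]_(d, n)) (J : {set 'I_n}) : Prop :=
  exists g, cell_in B g J.

Definition ncells (d : nat) (B : 'M[R]_(d, n)) : nat :=
  #|[pred J : {set 'I_n} | `[< cell_of B J >]]|.

Lemma card_le_rel (T T' : finType) (P : pred T) (Q : pred T') (S : T -> T' -> Prop) :
  (forall x, P x -> exists2 y, Q y & S x y) ->
  (forall x x' y, P x -> P x' -> S x y -> S x' y -> x = x') -> (#|P| <= #|Q|)%N.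
Proof.
move=> ex inj; case: (pickP P) => [x0 Px0|P0]; last by rewrite (eq_card0 P0).
have [y0 _ _] := ex x0 Px0.
have tot x : exists y, P x -> Q y /\ S x y.
  by have [/ex[y Qy Sy]|nP] := boolP (P x); [exists y|exists y0].
have [f Hf] := choice tot.
rewrite -(@card_in_image _ _ f P).
  by apply: subset_leq_card; apply/fintype.subsetP => y yi; have /mapP[x xP ->] := yi; rewrite mem_enum in xP; case: (Hf x xP).
move=> x x' Px Px' E; have [_ S1] := Hf x Px; have [_ S2] := Hf x' Px'.
by rewrite -E in S2; exact: inj S1 S2.
Qed.

Variables (k d : nat) (B : 'M[R]_(d, n)).
Hypothesis gB : sign_bounded k r B.

(** If dim U were at least 2r, some nonzero vector of U would vanish on r pairs of which the last is
    {n - 1, n}, as the virtual position costs no condition. *)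
Lemma sign_bounded_rank : \rank B = r.*2.-1.
Proof.
have [r0 nr rk _] := gB; apply/eqP; rewrite eqn_leq rk andbT leqNgt; apply/negP => lt.
pose l s := (n.-1 - (r.-1 - s).*2)%N.
have r1 : (r.-1 < r)%N by lia.
pose c1 : 'I_r * bool := (Ordinal r1, true).
have cQ : (#|[set~ c1]| < \rank B)%N.
  by have := cardsC1 c1; rewrite card_prod card_ord card_bool => ->; lia.
have [c c0 cz] := nonzero_solution (fun c => row_base B *m (ev R n (pos l c))^T) cQ.
have uz : c *m row_base B = 0.
  apply: (zero_pairs_eq0 gB (l := l)).
  - by rewrite (submx_trans (submxMl _ _)) // eq_row_base.
  - by move=> s sr; rewrite /l; lia.
  - by move=> s sr; rewrite /l; lia.
  move=> x; have [->|xc] := eqVneq x c1.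
    by apply: at_ge; rewrite /pos /l /=; lia.
  have := cz x; rewrite in_setC1 xc mulmxA => /(_ isT) E.
  rewrite -dot_ev dot_mx (_ : _ *m _ = (c *m row_base B *m (ev R n (pos l x))^T)^T).
    by rewrite E trmx0 mxE.
  by rewrite [RHS]trmx_mul trmxK.
have /row_freeP[X HX] := row_base_free B.
by move/eqP: c0; apply; rewrite -[c]mulmx1 -HX mulmxA uz mul0mx.
Qed.

Lemma dependency_exists (g : nat -> nat) : admissible n r g ->
  exists a, [/\ orth B a, a != 0 & supported (in_pairs r g) a].
Proof.
move=> [gg gn]; have [r0 nr _ _] := gB.
pose P : 'M[R]_(#|{: 'I_r * bool}|, n) := \matrix_i ev R n (pos g (enum_val i)).
have : kermx (P *m B^T) != 0.
  rewrite -mxrank_eq0 mxrank_ker -lt0n subn_gt0 (leq_ltn_trans (mxrankM_maxr _ _)) //.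
  by rewrite mxrank_tr sign_bounded_rank card_prod card_ord card_bool; lia.
case/rowV0Pn => y /sub_kermxP yP y0; exists (y *m P).
have lt (c : 'I_r * bool) : (pos g c < n)%N.
  by have := gn c.1 (ltn_ord _); rewrite /pos; case: (c.2); rewrite /= ?addn0 ?addn1; lia.
split; first by rewrite /orth -mulmxA.
  apply: contra y0 => /eqP yP0; apply/eqP/rowP => i; rewrite [RHS]mxE.
  have := congr1 (fun X : 'rV_n => X 0 (Ordinal (lt (enum_val i)))) yP0.
  rewrite [LHS]mxE [RHS]mxE (bigD1 i) //= !mxE eqxx mulr1 big1 ?addr0 //.
  move=> j ij; rewrite !mxE; case: eqP => [/(pos_inj gg)/enum_val_inj E|]; last by rewrite mulr0.
  by rewrite E eqxx in ij.
move=> i; rewrite mxE => nz; apply: contrapT => ni; move/eqP: nz; apply.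
rewrite big1 // => j _; rewrite !mxE; case: eqP => [E|]; last by rewrite mulr0.
by case: ni; apply/in_pairsP; exists (enum_val j).
Qed.

Lemma cell_in_unique (g : nat -> nat) (J J' : {set 'I_n}) : cell_in B g J -> cell_in B g J' -> J = J'.
Proof.
move=> [ag J0 Jg [a aW ha]] [_ J'0 J'g [a' aW' ha']].
have nz (a1 : 'rV[R]_n) (J1 : {set 'I_n}) : J1 != finset.set0 -> (forall i, (i \in J1 -> 0 < a1 0 i) /\ (i \notin J1 -> a1 0 i = 0)) -> a1 != 0.
  move=> /set0Pn[i iJ] h; apply/eqP => E; have [/(_ iJ)] := h i; by rewrite E mxE ltxx.
have sup (a1 : 'rV[R]_n) (J1 : {set 'I_n}) : (forall i, (i \in J1 -> 0 < a1 0 i) /\ (i \notin J1 -> a1 0 i = 0)) -> forall i, (a1 0 i != 0) = (i \in J1).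
  by move=> h i; have [h1 h2] := h i; have [/h1 h3|/h2->] := boolP (i \in J1); rewrite ?eqxx // gt_eqF.
have [x Ex] := dependency_line gB ag aW aW' (nz _ _ J0 ha)
  ltac:(by move=> i; rewrite (sup _ _ ha) => /Jg) ltac:(by move=> i; rewrite (sup _ _ ha') => /J'g).
have x0 : x != 0 by apply/eqP => E; have := nz _ _ J'0 ha'; rewrite Ex E scale0r eqxx.
by apply/setP => i; rewrite -(sup _ _ ha) -(sup _ _ ha') Ex mxE mulf_eq0 (negbTE x0).
Qed.

End Cells.

(** * Cells under a perturbation of rank one *)

Section LocalConstancy.
Variables (R : realType) (n r k q p d : nat) (C : 'M[R]_(q, n)) (Z : 'M[R]_(n, p)).
Variables (b : 'cV[R]_q) (e : 'rV[R]_n) (B : R -> 'M[R]_(d, n)).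
Hypothesis WE : forall t a, orth (B t) a <-> exists c, (a - c *m (C + t *: (b *m e))) *m Z = 0.
Hypothesis g0 : sign_bounded k r (B 0).

Lemma W0E a : orth (B 0) a <-> exists c, (a - c *m C) *m Z = 0.
Proof. by have := WE 0 a; rewrite scale0r addr0. Qed.

(** With [c = (1 - t y) c0 + t f c1], the coefficient of [e] in [c (C + t b e)] is
    [t ((1 - t y) f + t f y) = t f]. The factor [1 - t y] is chosen to make this exact. *)
Lemma perturbed_dependency (a0 nu : 'rV[R]_n) (c0 : 'rV[R]_q) :
  (a0 - c0 *m C) *m Z = 0 -> orth (B 0) (nu - e) ->
  exists y, forall t, orth (B t) ((1 - t * y) *: a0 + (t * (c0 *m b) 0 0) *: nu).
Proof.
move=> a0W /W0E[c1 nuW]; set f := (c0 *m b) 0 0.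
exists ((c1 *m b) 0 0) => t; set y := (c1 *m b) 0 0.
apply/WE; exists ((1 - t * y) *: c0 + (t * f) *: c1).
have scal (c : 'rV[R]_q) : c *m (b *m e) = (c *m b) 0 0 *: e.
  by rewrite mulmxA {1}[c *m b]mx11_scalar mul_scalar_mx.
rewrite (_ : _ - _ = (1 - t * y) *: (a0 - c0 *m C) + (t * f) *: (nu - e - c1 *m C)).
  by rewrite mulmxDl -!scalemxAl a0W nuW !scaler0 addr0.
rewrite mulmxDr -scalemxAr scal !mulmxDl -!scalemxAl /f /y.
move: (c0 *m C) (c1 *m C) (c0 *m b) (c1 *m b) => X0 X1 b0 b1.
by apply/rowP => i; rewrite !mxE; ring.
Qed.

(** On a fixed K the dependency for small [t] keeps the signs of the limit at its nonzero entries,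
    so a positive one has a positive limit with possibly smaller support. K enters as [A], and [t]
    through its absolute value, so that [finite_radius] yields one radius for all K and both signs
    of [t]. *)
Lemma cells_specialize (A : {set 'I_n}) : exists2 eta, 0 < eta & forall x, 0 < x < eta ->
  forall t, `|t| = x -> sign_bounded k r (B t) -> forall g, (forall i : 'I_n, in_pairs r g i <-> i \in A) ->
  forall J1, cell_in r (B t) g J1 -> exists2 J0 : {set 'I_n}, J0 \subset J1 & cell_in r (B 0) g J0.
Proof.
have [[g1 [ag1 gA1]]|nA] := pselect (exists g1, admissible n r g1 /\ (forall i : 'I_n, in_pairs r g1 i <-> i \in A)); last first.
  by exists 1 => // x _ t _ _ g gA J1 [ag _ _ _]; case: nA; exists g.
have [a [aW a0 sa]] := dependency_exists g0 ag1.
have [nu snu nuW] := span_pairs g0 (- e) ag1.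
have /W0E[c0 Wc0] := aW.
have [y Hy] := perturbed_dependency Wc0 nuW.
set f := (c0 *m b) 0 0 in Hy.
have rad (i : 'I_n) : exists2 eta, 0 < eta & forall x, 0 < x < eta -> forall t, `|t| = x -> a 0 i != 0 ->
    0 < a 0 i * ((1 - t * y) * a 0 i + t * f * nu 0 i).
  have [ai|ai] := eqVneq (a 0 i) 0; first by exists 1.
  have [|eta e0 He] := @affine_ball R (a 0 i * a 0 i) (a 0 i * (f * nu 0 i) - y * a 0 i * a 0 i).
    by rewrite -expr2 exprn_even_gt0.
  exists eta => // x /andP[_ xe] t tx _; have := He t; rewrite tx => /(_ xe).
  by congr (_ < _); ring.
have [eta e0 He] := finite_radius rad; exists eta => // x xe t tx gt g gA J1 [ag J10 J1g [a1 a1W ha1]].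
have {}He i : a 0 i != 0 -> 0 < a 0 i * ((1 - t * y) * a 0 i + t * f * nu 0 i) by exact: (He x xe i t tx).
set at' := (1 - t * y) *: a + (t * f) *: nu in Hy.
have atE i : ((1 - t * y) *: a + (t * f) *: nu) 0 i = (1 - t * y) * a 0 i + t * f * nu 0 i by rewrite !mxE.
have sg1 (v : 'rV[R]_n) : supported (in_pairs r g1) v -> supported (in_pairs r g) v.
  by move=> sv i /sv /gA1 /gA.
have sat : supported (in_pairs r g) ((1 - t * y) *: a + (t * f) *: nu).
  move=> i; rewrite atE; have [->|ai] := eqVneq (a 0 i) 0; last by move=> _; apply: (sg1 _ sa).
  by rewrite mulr0 add0r mulf_eq0 negb_or => /andP[_]; apply: (sg1 _ snu).
have at0 : (1 - t * y) *: a + (t * f) *: nu != 0.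
  apply: contra a0 => /eqP E; apply/eqP/rowP => i; rewrite mxE; apply/eqP; apply: contraT => /He.
  by rewrite -atE E mxE mulr0 ltxx.
have sa1 : supported (in_pairs r g) a1.
  by move=> i ai; apply: J1g; apply: contraR ai => /(ha1 i).2->.
have [z Ez] := dependency_line gt ag (Hy t) a1W at0 sat sa1.
have z0 : z != 0.
  apply/eqP => E; have /set0Pn[i iJ] := J10; have := (ha1 i).1 iJ.
  by rewrite Ez E scale0r mxE ltxx.
pose J0 := [set i : 'I_n | a 0 i != 0].
have key i : i \in J0 -> 0 < z * a 0 i /\ i \in J1.
  rewrite inE => ai; have := He i ai; have E : a1 0 i = z * ((1 - t * y) * a 0 i + t * f * nu 0 i) by rewrite Ez mxE atE.
  have zn : ((1 - t * y) * a 0 i + t * f * nu 0 i) != 0 by apply/eqP => E0; have := He i ai; rewrite E0 mulr0 ltxx.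
  have iJ1 : i \in J1 by apply: contraT => /(ha1 i).2; rewrite E => /eqP; rewrite mulf_eq0 (negbTE z0) (negbTE zn).
  have := (ha1 i).1 iJ1; rewrite E; move: (_ + _) => w zw aw; split=> //.
  have w0 : w != 0 by apply/eqP => E0; rewrite E0 mulr0 ltxx in zw.
  have : 0 < (z * w) * (a 0 i * w) by rewrite mulr_gt0.
  rewrite (_ : _ * _ = z * a 0 i * (w ^+ 2)); last by ring.
  by rewrite pmulr_lgt0 // exprn_even_gt0.
exists J0; first by apply/fintype.subsetP => i /key[].
split=> //.
- apply/set0Pn; have [i ai] : exists i, a 0 i != 0; last by exists i; rewrite inE.
  by apply/rV0Pn.
- by move=> i; rewrite inE => /(sg1 _ sa).
- exists (z *: a); first exact: orthZ.
  move=> i; rewrite mxE; split; first by case/key.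
  by rewrite inE negbK => /eqP->; rewrite mulr0.
Qed.

(** On each K containing [J0] the deformed dependency is positive on [J0] and equals [t f nu] off
    [J0], where [t f nu - t f e] lies in W. It is nonnegative exactly when it solves the covering
    problem for [- t f e]: [cone_cover] provides such a K, and [cone_unique] shows that all of them
    give the same support. *)
Lemma cells_deform (J0 : {set 'I_n}) : exists2 eta, 0 < eta & forall x, 0 < x < eta ->
  forall t, `|t| = x -> sign_bounded k r (B t) -> cell_of r (B 0) J0 ->
  (exists g J1, [/\ cell_in r (B t) g J1 & cell_in r (B 0) g J0]) /\
  forall g g' J1 J1', cell_in r (B t) g J1 -> cell_in r (B t) g' J1' ->
    cell_in r (B 0) g J0 -> cell_in r (B 0) g' J0 -> J1 = J1'.
Proof.
have [[g1 [ag1 J00 J0g1 [a aW ha]]]|nc] := pselect (cell_of r (B 0) J0); last by exists 1.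
have aJ i : (a 0 i != 0) = (i \in J0).
  by have [h1 h2] := ha i; have [/h1 h3|/h2->] := boolP (i \in J0); rewrite ?eqxx // gt_eqF.
have a0 : a != 0 by apply/eqP => E; have /set0Pn[i] := J00; rewrite -aJ E mxE eqxx.
have sJ i : a 0 i != 0 -> i \in J0 by rewrite aJ.
have /W0E[c0 Wc0] := aW; pose f := (c0 *m b) 0 0.
pose data (A : {set 'I_n}) (nu : 'rV[R]_n) y := [/\ forall i, nu 0 i != 0 -> i \in A, orth (B 0) (nu - e) &
   forall t, orth (B t) ((1 - t * y) *: a + (t * f) *: nu)].
have rad (A : {set 'I_n}) : exists2 eta, 0 < eta & forall x, 0 < x < eta ->
   (exists g, admissible n r g /\ forall i : 'I_n, in_pairs r g i <-> i \in A) ->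
   exists nu y, data A nu y /\ forall t, `|t| = x -> forall i, i \in J0 -> 0 < (1 - t * y) * a 0 i + t * f * nu 0 i.
  have [[g [ag gA]]|nA] := pselect (exists g, admissible n r g /\ (forall i : 'I_n, in_pairs r g i <-> i \in A)); last by exists 1.
  have [nu snu nuW] := span_pairs g0 (- e) ag.
  have [y Hy] := perturbed_dependency Wc0 nuW.
  have rad (i : 'I_n) : exists2 eta, 0 < eta & forall x, 0 < x < eta -> forall t, `|t| = x -> i \in J0 ->
      0 < (1 - t * y) * a 0 i + t * f * nu 0 i.
    have [iJ|iJ] := boolP (i \in J0); last by exists 1.
    have [|eta e0 He] := @affine_ball R (a 0 i) (f * nu 0 i - y * a 0 i); first by case: (ha i) => /(_ iJ).
    exists eta => // x /andP[_ xe] t tx _; have := He t; rewrite tx => /(_ xe).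
    by congr (_ < _); ring.
  have [eta e0 He] := finite_radius rad; exists eta => // x xe _; exists nu, y; split.
    by split=> // i /snu /gA.
  by move=> t tx i; exact: (He x xe i t tx).
have [eta e0 He] := finite_radius rad; exists eta => // x xe t tx gt _.
have main g : admissible n r g -> (forall i : 'I_n, i \in J0 -> in_pairs r g i) -> exists nu : 'rV[R]_n, exists y, [/\ supported (in_pairs r g) nu,
    orth (B 0) ((t * f) *: nu + - ((t * f) *: e)), orth (B t) ((1 - t * y) *: a + (t * f) *: nu) &
    forall i, i \in J0 -> 0 < ((1 - t * y) *: a + (t * f) *: nu) 0 i].
  move=> ag J0g; have [|nu [y [[h1 h2 h3] h4]]] := He x xe [set i : 'I_n | `[< in_pairs r g i >]].
    by exists g; split=> // i; rewrite inE; split=> [?|/asboolP//]; exact/asboolP.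
  exists nu, y; split=> //.
  - by move=> i /h1; rewrite inE => /asboolP.
  - by rewrite -scalerBr; apply: orthZ.
  - by move=> i iJ; rewrite !mxE; apply: h4.
have offJ (nu : 'rV[R]_n) y i : i \notin J0 -> ((1 - t * y) *: a + (t * f) *: nu) 0 i = ((t * f) *: nu) 0 i.
  by move=> iJ; rewrite [LHS]mxE [X in X + _]mxE (ha i).2 // mulr0 add0r.
have supN (nu : 'rV[R]_n) g s : supported (in_pairs r g) nu -> supported (in_pairs r g) (s *: nu).
  by move=> sn i; rewrite mxE mulf_eq0 negb_or => /andP[_ /sn].
have supA (nu : 'rV[R]_n) g y : (forall i : 'I_n, i \in J0 -> in_pairs r g i) -> supported (in_pairs r g) nu ->
    supported (in_pairs r g) ((1 - t * y) *: a + (t * f) *: nu).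
  move=> J0g sn i; have [iJ _|iJ] := boolP (i \in J0); first exact: J0g.
  by rewrite offJ //; apply: supN.
have [i0 i0J] := set0Pn _ J00.
split.
  have [g [mu [ag J0g smu mu0 muW]]] := cone_cover g0 (- ((t * f) *: e)) aW a0 ag1 sJ J0g1.
  have [nu [y [snu nuW atW atp]]] := main g ag J0g.
  set v := (1 - t * y) *: a + (t * f) *: nu in atW atp.
  have eqm i : i \notin J0 -> ((t * f) *: nu) 0 i = mu 0 i.
    move=> iJ; have dW : orth (B 0) ((t * f) *: nu - mu).
      rewrite (_ : _ - _ = ((t * f) *: nu + - ((t * f) *: e)) + (-1) *: (mu + - ((t * f) *: e))).
        by apply: orthD => //; apply: orthZ.
      by apply/rowP => j; rewrite !mxE; ring.
    have sd : supported (in_pairs r g) ((t * f) *: nu - mu).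
      move=> j; rewrite [X in X != 0 -> _]mxE [X in _ + X]mxE.
      have [->|mj _] := eqVneq (mu 0 j) 0; last exact: smu.
      by rewrite subr0; apply: supN.
    have [z Ez] := dependency_line g0 ag aW dW a0 (fun j aj => J0g j (sJ j aj)) sd.
    have := congr1 (fun X : 'rV_n => X 0 i) Ez.
    rewrite [LHS]mxE [X in _ + X]mxE [RHS]mxE (ha i).2 // mulr0 => /eqP.
    by rewrite subr_eq0 => /eqP.
  have v0 i : 0 <= v 0 i.
    have [iJ|iJ] := boolP (i \in J0); first by apply: ltW; exact: atp.
    by rewrite /v offJ // eqm // mu0.
  exists g, [set i : 'I_n | v 0 i != 0]; split; last by split=> //; exists a.
  split=> //.
  - by apply/set0Pn; exists i0; rewrite inE gt_eqF // atp.
  - by move=> i; rewrite inE; apply: supA.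
  - exists v => // i; rewrite inE; split; last by rewrite negbK => /eqP.
    by move=> vi; rewrite lt_neqAle eq_sym vi v0.
have descr g J1 : cell_in r (B t) g J1 -> cell_in r (B 0) g J0 -> exists mu : 'rV[R]_n,
    [/\ supported (in_pairs r g) mu, forall i, i \notin J0 -> 0 <= mu 0 i, orth (B 0) (mu + - ((t * f) *: e)) &
      forall i, (i \in J1) = (i \in J0) || (mu 0 i != 0)].
  move=> [ag J10 J1g [a1 a1W ha1]] [_ _ J0g _].
  have [nu [y [snu nuW atW atp]]] := main g ag J0g.
  have vn0 : (1 - t * y) *: a + (t * f) *: nu != 0.
    by apply/eqP => E; have := atp i0 i0J; rewrite E mxE ltxx.
  have sa1 : supported (in_pairs r g) a1.
    by move=> i ai; apply: J1g; apply: contraR ai => /(ha1 i).2->.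
  have a1nn i : 0 <= a1 0 i by have [/(ha1 i).1/ltW|/(ha1 i).2->] := boolP (i \in J1).
  have [z Ez] := dependency_line gt ag atW a1W vn0 (supA _ _ _ J0g snu) sa1.
  have z0 : 0 < z.
    rewrite lt_neqAle eq_sym; apply/andP; split.
      apply/eqP => E; have /set0Pn[i iJ] := J10; have := (ha1 i).1 iJ.
      by rewrite Ez E scale0r mxE ltxx.
    by have := a1nn i0; rewrite Ez mxE pmulr_lge0 // atp.
  exists ((t * f) *: nu); split=> //; first exact: supN.
    by move=> i iJ; have := a1nn i; rewrite Ez mxE pmulr_rge0 // offJ.
  move=> i; have -> : (i \in J1) = (a1 0 i != 0).
    by have [/(ha1 i).1 h|/(ha1 i).2->] := boolP (i \in J1); rewrite ?eqxx // gt_eqF.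
  rewrite Ez mxE mulf_eq0 (gt_eqF z0) /=; have [iJ|iJ] := boolP (i \in J0); first by rewrite gt_eqF // atp.
  by rewrite offJ.
move=> g g' J1 J1' h1 h1' h0 h0'.
have [mu [smu mu0 muW E]] := descr g J1 h1 h0; have [mu' [smu' mu'0 mu'W E']] := descr g' J1' h1' h0'.
have [[ag _ J0g _] [ag' _ J0g' _]] := (h0, h0').
apply/setP => i; rewrite E E'; have [//|iJ /=] := boolP (i \in J0).
by rewrite (cone_unique g0 aW a0 sJ ag ag' J0g J0g' smu smu' mu0 mu'0 muW mu'W).
Qed.

Lemma ncells_locally_constant : exists2 eta, 0 < eta & forall t, `|t| < eta -> sign_bounded k r (B t) ->
  ncells r (B t) = ncells r (B 0).
Proof.
have [e1 e10 H1] := finite_radius cells_specialize.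
have [e2 e20 H2] := finite_radius cells_deform.
exists (Num.min e1 e2); first by rewrite lt_min e10.
move=> t; rewrite lt_min => /andP[t1 t2] gt.
have [->//|tn0] := eqVneq t 0.
have x0 : 0 < `|t| by rewrite normr_gt0.
have spec g J1 : cell_in r (B t) g J1 -> exists2 J0 : {set 'I_n}, J0 \subset J1 & cell_in r (B 0) g J0.
  have x1 : 0 < `|t| < e1 by rewrite x0.
  apply: (H1 _ x1 [set i : 'I_n | `[< in_pairs r g i >]] t erefl gt).
  by move=> i; rewrite inE; split=> [?|/asboolP//]; exact/asboolP.
have {}H2 J0 := H2 `|t| ltac:(by rewrite x0) J0 t erefl gt.
(* Cells for [t] and for 0 are matched when one K carries both. A cell may lie in several K, so a
   relation is used rather than a map. *)
pose S J1 J0 := exists g, cell_in r (B t) g J1 /\ cell_in r (B 0) g J0.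
apply/eqP; rewrite eqn_leq; apply/andP; split.
  apply: (@card_le_rel _ _ _ _ S) => [J1 /asboolP[g c1]|J1 J1' J0 _ _ [g [c1 c0]] [g' [c1' c0']]].
    by have [J0 _ c0] := spec g J1 c1; exists J0; [apply/asboolP; exists g|exists g].
  by have [_ H] := H2 J0 ltac:(by exists g); exact: (H g g').
apply: (@card_le_rel _ _ _ _ (fun J0 J1 => S J1 J0)) => [J0 /asboolP c0|J0 J0' J1 _ _ [g [c1 c0]] [g' [c1' c0']]].
  have [[g [J1 [c1 c0']]] _] := H2 J0 c0.
  by exists J1; [apply/asboolP; exists g|exists g].
(* [J1] contains a cell for 0, which is [J0] by uniqueness on [g]. Hence [J0] also lies in the
   system [g'], which carries only one cell. *)
have [J2 J21 c2] := spec g J1 c1; have E := cell_in_unique g0 c2 c0; subst J2.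
apply: (@cell_in_unique _ _ _ _ _ _ g0 g') c0'; case: c0 => ag h1 h2 h3.
have [ag' _ J1g' _] := c1'; split=> // i iJ; apply: J1g'; exact: (fintype.subsetP J21).
Qed.

End LocalConstancy.

(** * Removing the last point *)

Section Family.
Variable R : realType.

(** The columns of the cokernel span the x with [C Z x = 0], so the row space is U. *)
Definition ambient (k n p : nat) (C : 'M[R]_(k, n)) (Z : 'M[R]_(n, p)) : 'M[R]_(p, n) :=
  (cokermx (C *m Z))^T *m Z^T.

Lemma ambient_orthP (k n p : nat) (C : 'M[R]_(k, n)) (Z : 'M[R]_(n, p)) (a : 'rV[R]_n) :
  orth (ambient C Z) a <-> exists c, (a - c *m C) *m Z = 0.
Proof.
rewrite /orth /ambient trmx_mul !trmxK mulmxA.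
have -> : (a *m Z *m cokermx (C *m Z) = 0) <-> (a *m Z <= C *m Z)%MS.
  by rewrite submxE; split=> [->|/eqP].
split=> [/submxP[c E]|[c E]].
  by exists c; rewrite mulmxBl E mulmxA subrr.
apply/submxP; exists c; apply/eqP; rewrite -subr_eq0 mulmxA -mulmxBl E //.
Qed.

Lemma ambient_sub (k n p : nat) (C : 'M[R]_(k, n)) (Z : 'M[R]_(n, p)) (u : 'rV[R]_n) :
  (u <= ambient C Z)%MS -> u *m C^T = 0 /\ exists x, u = (Z *m x)^T.
Proof.
case/submxP => y ->; rewrite /ambient; split; last first.
  by exists (cokermx (C *m Z) *m y^T); rewrite !trmx_mul trmxK mulmxA.
by rewrite -!mulmxA -!trmx_mul mulmx_coker trmx0 mulmx0.
Qed.

(** The lower bound on the changes is a hypothesis because at the end of the path, where positivity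
    of the minors of [C] may be lost, it comes from the first n columns. *)
Lemma ambient_bounded (k n p r : nat) (C : 'M[R]_(k, n)) (Z : 'M[R]_(n, p)) :
  row_minors_pos Z -> (0 < r)%N -> p = (k + r.*2.-1)%N -> (p <= n)%N ->
  (forall u, (u <= ambient C Z)%MS -> u != 0 -> forall e, compat e (at_ u) -> (k <= changes n.-1 e)%N) ->
  sign_bounded k r (ambient C Z).
Proof.
move=> Zp r0 pE pn lo; split=> //; first by lia.
  have [A cA] : exists A : {set 'I_n}, #|A| = p.
    by exists [set t : 'I_n | (t < p)%N]; exact: card_ord_lt.
  have Zf : row_free Z^T.
    apply/inj_row_free => v vZ; apply/trmx_inj; rewrite trmx0.
    apply: (minors_full_rank Zp cA) => i _; rewrite -[Z]trmxK -trmx_mul vZ trmx0 mxE //.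
  rewrite /ambient mxrankMfree // mxrank_tr mxrank_coker.
  by have := rank_leq_row (C *m Z); lia.
move=> u uU u0 e ce; rewrite (lo u) //=; have [_ [x Ex]] := ambient_sub uU.
rewrite -pE; apply: (changes_image Zp (x := x)); rewrite -?Ex //; last by lia.
by apply: contra u0 => /eqP E; rewrite Ex E mulmx0 trmx0.
Qed.

Lemma ambient_bounded_pos (k n p r : nat) (C : 'M[R]_(k, n)) (Z : 'M[R]_(n, p)) :
  row_minors_pos Z -> (0 < r)%N -> p = (k + r.*2.-1)%N -> (p <= n)%N ->
  col_minors_pos C -> sign_bounded k r (ambient C Z).
Proof.
move=> Zp r0 pE pn Cp; apply: ambient_bounded => // u uU u0 e ce.
have [uC _] := ambient_sub uU; apply: (changes_kernel Cp _ uC) => //; lia.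
Qed.

Variables (k n p r : nat) (C : 'M[R]_(k, n.+1)) (Z : 'M[R]_(n.+1, p)).
Hypotheses (Cp : col_minors_pos C) (Zp : row_minors_pos Z).
Hypotheses (r0 : (0 < r)%N) (pE : p = (k + r.*2.-1)%N) (pn : (p <= n)%N).

Definition scale_last (t : R) : 'M[R]_(k, n.+1) :=
  C *m diag_mx (\row_j (if j == ord_max then t else 1)).

Lemma scale_lastE t i j : scale_last t i j = C i j * (if j == ord_max then t else 1).
Proof. by rewrite /scale_last mul_mx_diag !mxE. Qed.

Lemma scale_lastD t s : scale_last (t + s) = scale_last t + s *: (col ord_max C *m delta_mx 0 ord_max).
Proof.
have E (X Y : 'M[R]_(k, n.+1)) i j : (X + s *: Y) i j = X i j + s * Y i j by rewrite !mxE.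
apply/matrixP => i j; rewrite E !scale_lastE mxE big_ord1 !mxE eqxx /=.
by case: eqP => [->|_] /=; ring.
Qed.

Lemma scale_last_pos t : 0 < t -> col_minors_pos (scale_last t).
Proof.
move=> t0 f finc; pose w j := if f j == ord_max then t else 1.
have -> : colsub f (scale_last t) = colsub f C *m diag_mx (\row_j w j).
  by apply/matrixP => i j; rewrite [LHS]mxE scale_lastE mul_mx_diag !mxE.
rewrite det_mulmx det_diag mulr_gt0 ?Cp //; apply: prodr_gt0 => i _.
by rewrite mxE /w; case: ifP.
Qed.

Local Notation wd := (widen_ord (leqnSn n)).
Definition drop_col : 'M[R]_(k, n) := colsub wd C.
Definition drop_row : 'M[R]_(n, p) := rowsub wd Z.

Lemma drop_col_pos : col_minors_pos drop_col.
Proof.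
move=> f finc; rewrite /drop_col (_ : colsub f _ = colsub (wd \o f) C); last first.
  by apply/matrixP => i j; rewrite !mxE.
by apply: Cp => a b ab; apply: finc.
Qed.

Lemma drop_row_pos : row_minors_pos drop_row.
Proof.
move=> f finc; rewrite /drop_row (_ : rowsub f _ = rowsub (wd \o f) Z); last first.
  by apply/matrixP => i j; rewrite !mxE.
by apply: Zp => a b ab; apply: finc.
Qed.

Lemma at_colsub (u : 'rV[R]_n.+1) (j : nat) : (j < n)%N -> at_ (colsub wd u) j = at_ u j.
Proof.
move=> jn; rewrite -[j]/(nat_of_ord (Ordinal jn)) at_ord mxE.
by rewrite -[nat_of_ord _]/(nat_of_ord (wd (Ordinal jn))) at_ord.
Qed.

Lemma restricted_kernel (u : 'rV[R]_n.+1) :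
  (u <= ambient (scale_last 0) Z)%MS -> u != 0 ->
  colsub wd u *m drop_col^T = 0 /\ colsub wd u != 0.
Proof.
move=> uU u0; have [uC [x Ex]] := ambient_sub uU; split.
  apply/rowP => i; have E : \sum_j u 0 j * scale_last 0 i j = 0.
    have := congr1 (fun X : 'rV_k => X 0 i) uC; rewrite [LHS]mxE [RHS]mxE => E1; rewrite -[RHS]E1.
    by apply: eq_bigr => j _; rewrite [X in _ = _ * X]mxE.
  rewrite [LHS]mxE [RHS]mxE -[RHS]E big_ord_recr /= scale_lastE eqxx mulr0 mulr0 addr0.
  apply: eq_bigr => j _; rewrite scale_lastE !mxE (_ : wd j == ord_max = false) ?mulr1 //.
  by apply/negbTE; rewrite -val_eqE /=; have := ltn_ord j; lia.
apply/negP => /eqP E0.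
have z j : (j < n)%N -> at_ u j = 0 by move=> jn; rewrite -at_colsub // E0 /at_; case: insub => // ?; rewrite mxE.
(* A vector supported on the last position is compatible with alternating signs everywhere. These
   have n changes, and [changes_image] allows fewer than p. *)
pose e j := odd (n - j) (+) (at_ u n < 0).
have ce : compat e (at_ u).
  move=> j; case: (ltngtP j n) => h; first by rewrite z ?mulr0.
    by rewrite at_ge ?mulr0.
  rewrite h /e subnn /=; case: ltP => E; rewrite ?expr1 ?expr0 ?mulN1r ?mul1r ?oppr_ge0 //; exact: ltW.
have ch M : (M <= n)%N -> changes M e = M.
  elim: M => [|M IH] Mn; first by rewrite /changes big_ord0.
  rewrite changesS IH ?(ltnW Mn) // /e (_ : (n - M = (n - M.+1).+1)%N) /=; last by lia.
  by case: (odd _); case: (_ < _); rewrite /= addn1.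
have : (changes n.+1.-1 e < p)%N.
  apply: (changes_image Zp (x := x)); rewrite -?Ex //; last by lia.
  by apply: contra u0 => /eqP E; rewrite Ex E mulmx0 trmx0.
by rewrite /= ch //; lia.
Qed.

Lemma compat_colsub (u : 'rV[R]_n.+1) e : compat e (at_ u) -> compat e (at_ (colsub wd u)).
Proof.
move=> ce j; case: (ltnP j n) => jn; first by rewrite at_colsub.
by rewrite at_ge ?mulr0.
Qed.

Lemma scale_last_bounded t : 0 <= t -> sign_bounded k r (ambient (scale_last t) Z).
Proof.
rewrite le_eqVlt => /orP[/eqP<-|t0]; last first.
  by apply: ambient_bounded_pos => //; [lia|exact: scale_last_pos].
apply: ambient_bounded => //; first by lia.
move=> u uU u0 e ce; have [uC u'0] := restricted_kernel uU u0.
have := changes_kernel drop_col_pos _ uC u'0 (compat_colsub ce).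
have [n0|n0] := posnP n; first by lia.
have := changesS n.-1 e; rewrite prednK // => -> H; have := H ltac:(lia).
by case: (_ != _); lia.
Qed.

Lemma ncells_path : ncells r (ambient (scale_last 1) Z) = ncells r (ambient (scale_last 0) Z).
Proof.
(* N is kept opaque: [done] would otherwise try to compute it. *)
have [N NE] : exists N : R -> nat, forall t, N t = ncells r (ambient (scale_last t) Z).
  by exists (fun t => ncells r (ambient (scale_last t) Z)).
rewrite -!NE.
have loc t : 0 <= t -> exists2 eta, 0 < eta & forall s, `|s| < eta -> 0 <= t + s -> N (t + s) = N t.
  move=> t0; have [||eta eta0 H] := @ncells_locally_constant R n.+1 r k k p p (scale_last t) Z
    (col ord_max C) (delta_mx 0 ord_max) (fun s => ambient (scale_last (t + s)) Z).
  - by move=> s a; rewrite scale_lastD; exact: ambient_orthP.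
  - by rewrite addr0; exact: scale_last_bounded.
  move: H; cbv beta; rewrite addr0 => H; exists eta; first exact: eta0.
  by move=> s se ts; rewrite !NE; exact: H s se (scale_last_bounded ts).
apply: (@real_induction R (fun t => N t = N 0)); first exact: erefl.
- move=> t /andP[t0 t1] Et; have [eta eta0 H] := loc t t0.
  pose s := Num.min (eta / 2) (1 - t).
  have s0 : 0 < s by rewrite lt_min divr_gt0 // subr_gt0.
  have se : s < eta by rewrite gt_min; apply/orP; left; lra.
  have s1 : s <= 1 - t by rewrite ge_min lexx orbT.
  exists (t + s); first by apply/andP; split; lra.
  by rewrite H ?gtr0_norm // addr_ge0 // ltW.
- move=> t /andP[t0 t1] nE; have [eta eta0 H] := loc t (ltW t0).
  exists (Num.min eta t); first by rewrite lt_min eta0.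
  move=> x /andP[x0]; rewrite lt_min => /andP[x1 x2] E; apply: nE; rewrite -E.
  by rewrite H ?normrN ?gtr0_norm // subr_ge0 ltW.
Qed.

Lemma mul_drop q (v : 'M[R]_(q, n.+1)) : (forall i, v i ord_max = 0) ->
  v *m Z = colsub wd v *m drop_row.
Proof.
move=> v0; apply/matrixP => i j; rewrite !mxE big_ord_recr /= v0 mul0r addr0.
by apply: eq_bigr => s _; rewrite !mxE.
Qed.

Lemma orth_drop (a : 'rV[R]_n.+1) : a 0 ord_max = 0 ->
  orth (ambient (scale_last 0) Z) a <-> orth (ambient drop_col drop_row) (colsub wd a).
Proof.
move=> a0; have E (c : 'rV[R]_k) : (a - c *m scale_last 0) *m Z = (colsub wd a - c *m drop_col) *m drop_row.
  rewrite mul_drop; last first.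
    move=> i; rewrite ord1 !mxE a0 sub0r big1 ?oppr0 // => s _.
    by rewrite scale_lastE eqxx mulr0 mulr0.
  congr (_ *m _); apply/rowP => i; rewrite !mxE; congr (_ - _); apply: eq_bigr => s _.
  rewrite scale_lastE !mxE (_ : wd i == ord_max = false) ?mulr1 //.
  by apply/negbTE; rewrite -val_eqE /=; have := ltn_ord i; lia.
by split=> /ambient_orthP[c Ec]; apply/ambient_orthP; exists c; rewrite ?E // -E.
Qed.

(** Otherwise the last index closes the last pair. Take [u] vanishing on the other r - 1 pairs.
    Orthogonality to [a], positive at the last index and nonnegative before it, lets the last two
    entries of [u] receive opposite signs. This change, the 2(r - 1) gained at the pairs of zeros
    and the k forced by the truncated kernel add up to k + m, one too many. *)
Lemma last_notin_cell (J : {set 'I_n.+1}) :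
  cell_of r (ambient (scale_last 0) Z) J -> ord_max \notin J.
Proof.
move=> [g [[gg gn] J0 Jg [a aW ha]]]; apply/negP => mJ.
have gB := scale_last_bounded (lexx 0); have [_ _ _ sg] := gB.
have [s sr Es] := Jg _ mJ; have gsn := gn s sr; rewrite /= in Es.
have {}Es : (g s).+1 = n by case: Es; lia.
have sE : s = r.-1.
  case: (ltngtP s r.-1) => // h; last by lia.
  by have := gg s ltac:(lia); have := gn s.+1 ltac:(lia); lia.
have r1 : (r.-1 < r)%N by lia.
pose Q : {set 'I_r * bool} := [set c | c.1 != Ordinal r1].
have cQ : (#|Q| < r.*2.-1)%N.
  have : (#|~: Q| = 2)%N.
    have -> : ~: Q = [set (Ordinal r1, true); (Ordinal r1, false)].
      apply/setP => -[x y]; rewrite !inE negbK !xpair_eqE.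
      by case: eqP => //=; case: y.
    by rewrite cards2 xpair_eqE andbF.
  by have := cardsC Q; rewrite card_prod card_ord card_bool; lia.
have [u [uU u0 uz]] := solve_in_U gB (fun c => ev R n.+1 (pos g c)) cQ.
have {}uz t (b : bool) : (t < r.-1)%N -> at_ u (g t + b) = 0.
  move=> tr; have tr' : (t < r)%N by lia.
  by rewrite -dot_ev; apply: (uz (Ordinal tr', b)); rewrite inE -val_eqE /=; lia.
have uz0 t : (t < r.-1)%N -> at_ u (g t) = 0 by move=> /(uz t false); rewrite addn0.
have uz1 t : (t < r.-1)%N -> at_ u (g t).+1 = 0 by move=> /(uz t true); rewrite addn1.
have [uC u'0] := restricted_kernel uU u0; set u' := colsub wd u in uC u'0.
have n0 : (0 < n)%N by lia.
have nn : (n.-1 < n.+1)%N by lia.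
pose o1 := Ordinal nn.
have dot0 : a 0 o1 * u 0 o1 + a 0 ord_max * u 0 ord_max = 0.
  have := orth_dot aW uU; rewrite /dot (bigD1 ord_max) //= (bigD1 o1) /=; last first.
    by rewrite -val_eqE /=; lia.
  rewrite big1 ?addr0 ?[_ + a 0 o1 * _]addrC // => i /andP[i1 i2].
  have [iJ|iJ] := boolP (i \in J); last by rewrite (ha i).2 ?mul0r.
  have [t tr Et] := Jg _ iJ; rewrite -(at_ord u).
  have tr1 : (t < r.-1)%N.
    case: (ltngtP t r.-1) => // h; first by lia.
    by move: i1 i2; rewrite -!val_eqE /=; rewrite h -sE in Et; case: Et; lia.
  by case: Et => ->; [rewrite uz0|rewrite uz1]; rewrite ?mulr0.
have [i ui] : exists i, at_ u' i != 0.
  have [i ui] : exists i, u' 0 i != 0.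
    by apply/rV0Pn.
  by exists i; rewrite at_ord.
have ex : exists j, at_ u' j != 0 by exists i.
have bd j : at_ u' j != 0 -> (j <= n.-1)%N.
  by move=> uj; rewrite leqNgt; apply/negP => h; rewrite at_ge ?eqxx // in uj; lia.
case: (ex_maxnP ex bd) => a0 ua0 amax.
have [e [e' [ce ce' E]]] : exists e e', [/\ compat e (at_ u'), compat e' (at_ u') &
    changes n.-1 e = (changes n.-1 e' + r.-1.*2)%N].
  have gtn t : (t < r.-1)%N -> ((g t).+2 <= g r.-1)%N.
    by move=> tr; apply: (gapped_lt gg); rewrite tr.
  apply: (@gain R r.-1 n.-1 a0 g (at_ u') (at_ u')) => //.
  - exact: bd.
  - by move=> j aj; apply/eqP; apply: contraT => /amax; lia.
  - by move=> j uj; rewrite -expr2 exprn_even_gt0.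
  - by move=> t tr; apply: gg; lia.
  - by move=> t tr; have := gtn t tr; rewrite -sE; lia.
  move=> t tr; have := gtn t tr; rewrite -sE => h.
  have z1 : at_ u' (g t) = 0 by rewrite at_colsub ?uz0 //; lia.
  have z2 : at_ u' (g t).+1 = 0 by rewrite at_colsub ?uz1 //; lia.
  by split=> //; apply: flat_zero.
pose e2 j := if (j < n)%N then e j else ~~ e n.-1.
have ce2 : compat e2 (at_ u).
  move=> j; rewrite /e2; case: (ltnP j n) => jn; first by rewrite -at_colsub.
  have [jE|nj] := eqVneq j n; last by rewrite at_ge ?mulr0 //; lia.
  have -> : at_ u j = u 0 ord_max by rewrite jE -[n]/(nat_of_ord (ord_max : 'I_n.+1)) at_ord.
  have hc : 0 <= (-1) ^+ e n.-1 * u 0 o1 by rewrite -(at_ord u) -at_colsub //=; lia.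
  have am := (ha ord_max).1 mJ.
  have a1 : 0 <= a 0 o1 by have [/(ha o1).1/ltW|/(ha o1).2->] := boolP (o1 \in J).
  move: dot0 hc am a1; move: (a 0 o1) (u 0 o1) (a 0 ord_max) (u 0 ord_max) => x y z w d0 h z0 x0.
  rewrite -(pmulr_rge0 _ z0) (_ : z * _ = x * ((-1) ^+ e n.-1 * y)); first by rewrite mulr_ge0.
  have zw : z * w = - (x * y) by lra.
  by case: (e n.-1) => /=; rewrite ?expr1 ?expr0 ?mulN1r ?mul1r ?mulrN zw ?opprK.
have /andP[_ up] := sg u uU u0 e2 ce2.
have lo := changes_kernel drop_col_pos ltac:(lia) uC u'0 ce'.
have c1 : changes n e2 = (changes n.-1 e).+1.
  have e2n : e2 n = ~~ e n.-1 by rewrite /e2 ltnn.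
  have e2l j : (j < n)%N -> e2 j = e j by rewrite /e2 => ->.
  have chE : changes n.-1 e2 = changes n.-1 e.
    by apply: eq_bigr => j _; have := ltn_ord j => h; rewrite !e2l //; lia.
  have := changesS n.-1 e2; rewrite prednK // => ->.
  by rewrite e2n e2l ?prednK // chE; case: (e _); rewrite /= addn1.
by move: up; rewrite /= c1 E; lia.
Qed.

Lemma ncells_drop : ncells r (ambient (scale_last 0) Z) = ncells r (ambient drop_col drop_row).
Proof.
have gB := scale_last_bounded (lexx 0).
have winj : injective wd by move=> x y /(congr1 val) /= /val_inj.
have nmax (i : 'I_n) : wd i != ord_max by rewrite -val_eqE /=; have := ltn_ord i; lia.
have wsurj (i : 'I_n.+1) : i != ord_max -> exists j, i = wd j.
  move=> im; have lt : (i < n)%N by move: im; rewrite -val_eqE /=; have := ltn_ord i; lia.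
  by exists (Ordinal lt); apply/val_inj.
pose S (J : {set 'I_n.+1}) (J' : {set 'I_n}) := J = [set wd x | x in J'].
apply/eqP; rewrite eqn_leq; apply/andP; split.
  apply: (@card_le_rel _ _ _ _ S) => [J /asboolP cJ|J J' K _ _ -> -> //].
  have mJ := last_notin_cell cJ.
  have [g [ag J0 Jg [a aW ha]]] := cJ.
  have a0 : a != 0.
    by apply/eqP => E; have /set0Pn[i iJ] := J0; have := (ha i).1 iJ; rewrite E mxE ltxx.
  have sa i : a 0 i != 0 -> i \in J by move=> ai; apply: contraR ai => /(ha i).2->.
  (* A system whose right ends all lie in [J] avoids the last index, hence is admissible for n
     points. *)
  have [g' [[gg' gn'] Jg' hit]] := meets_all_pairs_left gB ag aW a0 sa Jg.
  pose J' := [set x : 'I_n | wd x \in J].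
  have JE : S J J'.
    apply/setP => i; apply/idP/imsetP => [iJ|[x]]; last by rewrite inE => xJ ->.
    have [|x Ex] := wsurj i; first by apply: contraNneq mJ => <-.
    by exists x => //; rewrite inE -Ex.
  exists J' => //; apply/asboolP; exists g'; split.
  - split=> // s sr; have [i iJ Ei] := hit s sr.
    have : i != ord_max by apply: contraNneq mJ => <-.
    by rewrite -Ei -val_eqE /=; have := ltn_ord i; lia.
  - by apply: contra J0 => /eqP E; rewrite JE E imset0.
  - by move=> i; rewrite inE => /Jg'.
  - exists (colsub wd a); first by apply/orth_drop => //; rewrite (ha _).2.
    by move=> i; rewrite inE mxE; exact: ha.
apply: (@card_le_rel _ _ _ _ (fun x y => S y x)) => [J' /asboolP[g [[gg gn] J0 Jg [a aW ha]]]|J J' K _ _ h1 h2]; last first.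
  by apply: (imset_inj winj); rewrite -[LHS]/([set wd x | x in J]) -h1 h2.
exists [set wd x | x in J'] => //; apply/asboolP; exists g.
pose a' : 'rV[R]_n.+1 := \row_j at_ a j.
have wa' i : a' 0 (wd i) = a 0 i by rewrite mxE /= at_ord.
have am : a' 0 ord_max = 0 by rewrite mxE /= at_ge.
split.
- by split=> // s /gn; lia.
- by have /set0Pn[i iJ] := J0; apply/set0Pn; exists (wd i); apply: imset_f.
- by move=> _ /imsetP[i iJ ->]; exact: Jg.
- exists a'; first by apply/orth_drop => //; rewrite (_ : colsub wd a' = a) //; apply/rowP => i; rewrite mxE wa'.
  move=> i; have [->|/wsurj[x ->]] := eqVneq i ord_max.
    split=> // /imsetP[x _ E]; by have := nmax x; rewrite -E eqxx.
  by rewrite wa' (mem_imset _ _ winj); exact: ha.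
Qed.

Lemma ncells_reduce : ncells r (ambient C Z) = ncells r (ambient drop_col drop_row).
Proof.
rewrite -ncells_drop -ncells_path; congr (ncells r (ambient _ Z)).
by apply/matrixP => i j; rewrite scale_lastE; case: eqP; rewrite mulr1.
Qed.

End Family.

(** * The case n = k + m *)

Section BaseCase.
Variables (R : realType) (n r : nat).

Definition pair_set (g : nat -> nat) : {set 'I_n} := [set i : 'I_n | `[< in_pairs r g i >]].

Lemma rank_pair_set (g : nat -> nat) (j : nat) : gapped r g -> (j <= n)%N ->
  rank_below (pair_set g) j = pair_count r g j.
Proof.
move=> gg; elim: j => [|j IH] jn.
  by rewrite /pair_count big1 //; apply: eq_card0 => i; rewrite !inE andbF.
rewrite pair_countS // -IH ?(ltnW jn) // /rank_below (cardsD1 (Ordinal jn)) !inE /= leqnn andbT addnC.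
congr (_ + _)%N; apply: eq_card => i; rewrite !inE -val_eqE /= ltnS.
by case: (ltngtP i j); rewrite ?andbF ?andbT.
Qed.

Lemma card_pair_set (g : nat -> nat) : admissible n r g -> #|pair_set g| = r.*2.
Proof.
move=> ag; rewrite -(pair_count_full ag) -rank_pair_set //; last by case: ag.
by apply: eq_card => i; rewrite [RHS]inE ltn_ord andbT.
Qed.

Lemma rank_compl (A : {set 'I_n}) (j : nat) : (j <= n)%N ->
  (rank_below (~: A) j + rank_below A j = j)%N.
Proof.
move=> jn; rewrite -[RHS](card_ord_lt jn) /rank_below -[in RHS](cardsID A) addnC.
by congr (_ + _)%N; apply: eq_card => i; rewrite !inE andbC.
Qed.

(** The pairs before [g s] occupy an even number of positions, so the gaps below it have the parity
    of [g s]; passing to the second element of the pair adds no gap. *)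
Lemma odd_rank_gaps (g : nat -> nat) (i : 'I_n) s : gapped r g -> (s < r)%N ->
  i = g s :> nat \/ i = (g s).+1 :> nat -> odd (rank_below (~: pair_set g) i) = odd (g s).
Proof.
move=> gg sr Ei; have := rank_compl (pair_set g) (ltnW (ltn_ord i)).
rewrite rank_pair_set // ?(ltnW (ltn_ord i)) // => /(congr1 odd); rewrite oddD => E.
case: Ei => Ei; rewrite Ei in E *.
  suff o : odd (pair_count r g (g s)) = false by rewrite o addbF in E.
  apply/negP => /(odd_pair_count _ gg)[t tr Et].
  have := @pos_inj r g (Ordinal sr, false) (Ordinal tr, true) gg.
  by rewrite /pos /= addn0 addn1 -Et => /(_ erefl).
have o : odd (pair_count r g (g s).+1) by apply/odd_pair_count => //; exists s.
by move: E; rewrite o /= addbT => /negb_inj.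
Qed.

Variables (k : nat) (C : 'M[R]_(k, n)) (Z : 'M[R]_(n, n)).
Hypotheses (Cp : col_minors_pos C) (Zp : row_minors_pos Z) (r0 : (0 < r)%N).
Hypothesis nE : n = (k + r.*2.-1)%N.

Lemma ambient_square_orthP (a : 'rV[R]_n) : orth (ambient C Z) a <-> exists c, a = c *m C.
Proof.
have Zu : Z \in unitmx.
  have <- : rowsub id Z = Z by apply/matrixP => i j; rewrite mxE.
  by rewrite unitmxE unitfE gt_eqF // Zp.
split=> [/ambient_orthP[c E]|[c ->]]; last by apply/ambient_orthP; exists c; rewrite subrr mul0mx.
by exists c; apply/eqP; rewrite -subr_eq0 -[_ - _](mulmxK Zu) E mul0mx.
Qed.

(** K has k - 1 gaps, so a nonzero vector of the row space of [C] vanishing on them changes sign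
    exactly there. It has one sign on K if and only if the numbers of gaps before the pairs all have
    the same parity. *)
Lemma cell_of_square (J : {set 'I_n}) : cell_of r (ambient C Z) J <->
  exists g, exists b : bool, [/\ admissible n r g, forall s, (s < r)%N -> odd (g s) = b & J = pair_set g].
Proof.
split=> [[g [ag J0 Jg [a /ambient_square_orthP[c Ec] ha]]]|[g [b [ag gb ->]]]].
  have [gg gn] := ag; pose H := ~: pair_set g.
  have cH : #|H|.+1 = k by have := cardsC (pair_set g); rewrite card_pair_set // card_ord -/H; have := gn 0%N r0; lia.
  have c0 : c != 0.
    by apply/eqP => E; have /set0Pn[i iJ] := J0; have := (ha i).1 iJ; rewrite Ec E mul0mx mxE ltxx.
  have z j : j \in H -> (c *m C) 0 j = 0.
    rewrite !inE -Ec => /asboolPn nj; apply: (ha j).2; apply/negP => /Jg //.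
  have JE : J = pair_set g.
    apply/setP => i; rewrite inE; apply/idP/asboolP => [/Jg//|ig].
    apply: contraT => /(ha i).2; rewrite Ec => E.
    have : i \notin H by rewrite !inE negbK; apply/asboolP.
    by move/(row_nonzero_off Cp c0 cH z); rewrite E eqxx.
  have [b sg] := row_sign_off Cp c0 cH z.
  exists g, b; split=> // s sr.
  have lt : (g s < n)%N by have := gn s sr; lia.
  have iP : in_pairs r g (Ordinal lt) by exists s => //; left.
  have iH : Ordinal lt \notin H by rewrite !inE negbK; apply/asboolP.
  have := sg _ iH; rewrite -Ec -signr_odd oddD oddb (odd_rank_gaps gg sr) /=; last by left.
  have : 0 < a 0 (Ordinal lt) by apply: (ha _).1; rewrite JE inE; apply/asboolP.
  by case: (b) (odd _) => [] [] //= a0; rewrite expr1 mulN1r oppr_gt0 => /(lt_trans a0); rewrite ltxx.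
have [gg gn] := ag; pose H := ~: pair_set g.
have cH : #|H|.+1 = k by have := cardsC (pair_set g); rewrite card_pair_set // card_ord -/H; have := gn 0%N r0; lia.
have [|c c0 cz] := @nonzero_solution R k _ H (fun i => col i C); first by lia.
have z j : j \in H -> (c *m C) 0 j = 0.
  by move=> /cz /matrixP/(_ 0 0); rewrite !mxE => E; rewrite -[RHS]E; apply: eq_bigr => s _; rewrite mxE.
have [b' sg] := row_sign_off Cp c0 cH z.
exists g; split=> //.
- apply/set0Pn; have lt : (g 0 < n)%N by have := gn 0%N r0; lia.
  by exists (Ordinal lt); rewrite inE; apply/asboolP; exists 0%N => //; left.
- by move=> i; rewrite inE => /asboolP.
exists ((-1) ^+ (b' (+) b) *: (c *m C)).
  by apply/ambient_square_orthP; exists ((-1) ^+ (b' (+) b) *: c); rewrite scalemxAl.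
move=> i; rewrite mxE; split; last by move=> iP; rewrite z ?mulr0 // inE iP.
move=> iP; have iH : i \notin H by rewrite inE iP.
have := sg i iH; move: iP; rewrite inE => /asboolP[s sr Ei].
by rewrite -signr_odd oddD oddb (odd_rank_gaps gg sr Ei) gb.
Qed.

(** When all starts have parity [b], the gap condition only says that the slots x are distinct, so
    the systems of pairs become the r-subsets of (n - b) / 2 slots. *)
Definition spread (N : nat) (b : bool) (X : {set 'I_N}) : {set 'I_n} :=
  [set i : 'I_n | [exists x in X, (i == (x.*2 + b)%N :> nat) || (i == (x.*2 + b).+1 :> nat)]].

Lemma spreadP (N : nat) (b : bool) (X : {set 'I_N}) (i : 'I_n) :
  reflect (exists2 x : 'I_N, x \in X & i = (x.*2 + b)%N :> nat \/ i = (x.*2 + b).+1 :> nat)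
    (i \in spread b X).
Proof.
rewrite inE; apply: (iffP existsP) => [[x /andP[xX h]]|[x xX h]]; exists x => //.
  by case/orP: h => /eqP; [left|right].
by rewrite xX; case: h => ->; rewrite eqxx ?orbT.
Qed.

Lemma spread_mem (N : nat) (b : bool) (X : {set 'I_N}) (x : 'I_N) (i : 'I_n) :
  i = (x.*2 + b)%N :> nat -> (i \in spread b X) = (x \in X).
Proof.
move=> Ei; apply/spreadP/idP => [[y yX h]|xX]; last by exists x => //; left.
suff -> : x = y by [].
by apply/val_inj => /=; case: h; rewrite Ei; case: (b); lia.
Qed.

Lemma spread_bound (b : bool) (x : nat) : (x < (n - b)./2)%N -> ((x.*2 + b).+1 < n)%N.
Proof. by case: b => /=; lia. Qed.

Lemma spread_inj (b : bool) : injective (@spread (n - b)./2 b).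
Proof.
move=> X Y E; apply/setP => x.
have lt : (x.*2 + b < n)%N by have := spread_bound (ltn_ord x); lia.
by rewrite -(@spread_mem _ b X x (Ordinal lt)) // E (@spread_mem _ b Y x).
Qed.

Lemma spread_cell (J : {set 'I_n}) (b : bool) :
  (exists g, [/\ admissible n r g, forall s, (s < r)%N -> odd (g s) = b & J = pair_set g]) <->
  J \in [set spread b X | X in [set X : {set 'I_((n - b)./2)} | #|X| == r]].
Proof.
split=> [[g [[gg gn] gb ->]]|/imsetP[X]].
  have gE s : (s < r)%N -> g s = ((g s)./2.*2 + b)%N.
    by move=> /gb <-; rewrite -[LHS]odd_double_half addnC.
  have lt (s : 'I_r) : ((g s)./2 < (n - b)./2)%N.
    by have := gE s (ltn_ord s); have := gn s (ltn_ord s); case: (b) => /=; lia.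
  pose h (s : 'I_r) : 'I_((n - b)./2) := Ordinal (lt s).
  have hinj : injective h.
    move=> s t /(congr1 val) /= E.
    have : pos g (s, false) = pos g (t, false) by rewrite /pos /= !addn0 [LHS](gE _ (ltn_ord s)) [RHS](gE _ (ltn_ord t)) E.
    by move/(pos_inj gg) => [].
  apply/imsetP; exists [set h s | s in [set: 'I_r]%SET].
    by rewrite inE card_imset // cardsT card_ord.
  apply/setP => i; rewrite inE; apply/asboolP/spreadP => [[s sr Ei]|[x /imsetP[s _ ->] Ei]].
    by exists (h (Ordinal sr)); [apply: imset_f; rewrite inE|rewrite /= -gE].
  by exists s => //; rewrite (gE s).
rewrite inE => /eqP cX ->; have [f [finc fX fsurj _]] := increasing_enum cX.
pose g s := if insub s is Some t then ((f t).*2 + b)%N else 0%N.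
have gE (s : 'I_r) : g s = ((f s).*2 + b)%N by rewrite /g valK.
exists g; split.
- split=> s sr.
    have sr' : (s < r)%N by lia.
    rewrite -[s]/(nat_of_ord (Ordinal sr')) -[s.+1]/(nat_of_ord (Ordinal sr)) !gE.
    by have := finc (Ordinal sr') (Ordinal sr) (leqnn _); lia.
  by rewrite -[s]/(nat_of_ord (Ordinal sr)) gE; exact: spread_bound.
- by move=> s sr; rewrite -[s]/(nat_of_ord (Ordinal sr)) gE oddD odd_double oddb.
apply/setP => i; rewrite [RHS]inE; apply/spreadP/asboolP => [[x /fsurj[s ->] Ei]|[s sr Ei]].
  by exists s; rewrite ?gE.
by exists (f (Ordinal sr)); rewrite ?fX // -gE.
Qed.

Lemma ncells_square : ncells r (ambient C Z) = ('C(n./2, r) + 'C(n.-1./2, r))%N.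
Proof.
pose S (b : bool) := [set spread b X | X in [set X : {set 'I_((n - b)./2)} | #|X| == r]].
have cS b : #|S b| = 'C((n - b)./2, r).
  by rewrite card_imset ?card_draws ?card_ord //; exact: spread_inj.
have -> : ncells r (ambient C Z) = #|S false :|: S true|.
  apply: eq_card => J; rewrite finset.in_setU; apply/asboolP/orP.
    move=> /cell_of_square[g [b [h1 h2 h3]]].
    have : J \in S b by apply/spread_cell; exists g.
    by case: (b); [right|left].
  by case=> /spread_cell[g [h1 h2 h3]]; apply/cell_of_square; [exists g, false|exists g, true].
rewrite cardsU (_ : S false :&: S true = finset.set0) ?cards0 ?subn0 ?cS /= ?subn0 ?subn1 //.
apply/eqP; rewrite -finset.subset0; apply/fintype.subsetP => J; rewrite finset.in_setI => /andP[/imsetP[X XX EX] /imsetP[Y YY EY]].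
exfalso; move: XX; rewrite inE => /eqP cX.
have [x0 x0X] : exists x, x \in X by apply/set0Pn; rewrite -card_gt0 cX.
have ex : exists j, [exists x in X, x == j :> nat] by exists x0; apply/existsP; exists x0; rewrite x0X eqxx.
(* For the least slot x of [X], the index 2x must be the second element of a pair starting at 2y +
   1, so y = x - 1. But then 2y + 1 requires the slot y in [X]. *)
case: (ex_minnP ex) => j /existsP[x /andP[xX /eqP xj]] jmin.
have lt : (x.*2 < n)%N by have := @spread_bound false x (ltn_ord x); rewrite /= addn0; lia.
have : Ordinal lt \in spread false X by rewrite (@spread_mem _ _ _ x) //= addn0.
rewrite -EX EY => /spreadP[y yY /= h].
have lt2 : (y.*2.+1 < n)%N by have := @spread_bound true y (ltn_ord y); rewrite /=; lia.
have : Ordinal lt2 \in spread true Y by rewrite (@spread_mem _ _ _ y) //= addn1.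
rewrite -EY EX => /spreadP[z zX /= h2].
have := jmin z; rewrite (_ : [exists x in X, _]); first by move=> /(_ isT); move: h h2; rewrite -xj /= ?addn0 ?addn1; move: (nat_of_ord x) (nat_of_ord y) (nat_of_ord z); clear; lia.
by apply/existsP; exists z; rewrite zX eqxx.
Qed.

End BaseCase.

Lemma ncells_ambient (R : realType) (e k n p r : nat) (C : 'M[R]_(k, n)) (Z : 'M[R]_(n, p)) :
  n = (e + p)%N -> (0 < r)%N -> p = (k + r.*2.-1)%N -> col_minors_pos C -> row_minors_pos Z ->
  ncells r (ambient C Z) = ('C(p./2, r) + 'C(p.-1./2, r))%N.
Proof.
elim: e n C Z => [|e IH] n C Z nE r0 pE Cp Zp.
  by rewrite add0n in nE; subst n; exact: ncells_square.
rewrite addSn in nE; subst n; rewrite (ncells_reduce Cp Zp r0 pE) ?leq_addl //.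
by apply: IH => //; [exact: drop_col_pos|exact: drop_row_pos].
Qed.

(** * Relative interiors of simplices *)

Section CellGeometry.
Variables (R : realType) (d : nat) (I : finType) (z : I -> 'rV[R]_d) (J : {set I}).

Lemma nbhs0_rowP (P : 'rV[R]_d -> Prop) :
  (\forall y \near (0 : 'rV[R]_d), P y) <->
  exists2 e, 0 < e & forall y : 'rV[R]_d, (forall i, `|y 0 i| < e) -> P y.
Proof.
split=> [/nbhs_ballP[e /= e0 H]|[e e0 H]].
  exists e => // y ye; apply: H; split=> // i j; rewrite -ball_normE /ball_ /= ord1 mxE sub0r normrN.
  exact: ye.
apply/nbhs_ballP; exists e => // y [_ ye]; apply: H => i.
by have := ye 0 i; rewrite -ball_normE /ball_ /= mxE sub0r normrN.
Qed.

Lemma hull_weights (p : nat) (a : 'I_p -> 'rV[R]_d) (l : 'I_p -> R) :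
  (forall i, (z @` [set` J])%classic (a i)) -> exists l' : I -> R,
  [/\ (forall i, 0 <= l i) -> forall j, 0 <= l' j, \sum_(j in J) l' j = \sum_i l i &
      \sum_(j in J) l' j *: z j = \sum_i l i *: a i].
Proof.
move=> Aa; have tot i : exists j, j \in J /\ z j = a i by have [j jJ E] := Aa i; exists j.
have [h hP] := choice tot.
exists (fun j => \sum_(i | h i == j) l i); split.
- by move=> l0 j; apply: sumr_ge0.
- by rewrite [RHS](partition_big h (mem J)) //= => i _; case: (hP i).
- rewrite [RHS](partition_big h (mem J)) /=; last by move=> i _; case: (hP i).
  apply: eq_bigr => j jJ; rewrite scaler_suml; apply: eq_bigr => i /eqP <-.
  by case: (hP i) => _ ->.
Qed.

Lemma weights_hull (l : I -> R) : exists (a : 'I_#|J| -> 'rV[R]_d) (l' : 'I_#|J| -> R),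
  [/\ forall i, (z @` [set` J])%classic (a i), (forall j, j \in J -> 0 <= l j) -> forall i, 0 <= l' i,
      \sum_i l' i = \sum_(j in J) l j & \sum_i l' i *: a i = \sum_(j in J) l j *: z j].
Proof.
exists (z \o enum_val), (l \o enum_val); split.
- by move=> i; exists (enum_val i) => //=; exact: enum_valP.
- by move=> l0 i; apply: l0; exact: enum_valP.
- by rewrite [RHS]big_enum_val.
- by rewrite [RHS]big_enum_val.
Qed.

Lemma affine_convex_weights (p : nat) (a : 'I_p -> 'rV[R]_d) (w : 'I_p -> R) :
  (forall i, convex_hull (z @` [set` J])%classic (a i)) -> exists l : I -> R,
  \sum_(j in J) l j = \sum_i w i /\ \sum_(j in J) l j *: z j = \sum_i w i *: a i.
Proof.
move=> ca; have tot i : exists h : I -> R, \sum_(j in J) h j = 1 /\ a i = \sum_(j in J) h j *: z j.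
  have [q [b [v [Ab _ v1 ->]]]] := ca i.
  by have [h [_ h1 h2]] := hull_weights v Ab; exists h; rewrite h1 h2.
have [h hP] := choice tot.
exists (fun j => \sum_i w i * h i j); split.
  rewrite exchange_big; apply: eq_bigr => i _.
  by rewrite -mulr_sumr (hP i).1 mulr1.
rewrite (eq_bigr (fun j => \sum_i w i *: (h i j *: z j))); last first.
  by move=> j _; rewrite scaler_suml; apply: eq_bigr => i _; rewrite scalerA.
rewrite exchange_big; apply: eq_bigr => i _.
by rewrite -scaler_sumr -(hP i).2.
Qed.

Hypothesis zI : affinely_independent z J.

Lemma affine_weights_unique (l l' : I -> R) :
  \sum_(j in J) l j = \sum_(j in J) l' j ->
  \sum_(j in J) l j *: z j = \sum_(j in J) l' j *: z j -> forall j, j \in J -> l j = l' j.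
Proof.
move=> E1 E2 j jJ; apply/eqP; rewrite -subr_eq0; apply/eqP.
apply: (zI (l := fun j => l j - l' j)) => //.
  by rewrite sumrB E1 subrr.
rewrite (eq_bigr (fun j => l j *: z j - l' j *: z j)); last by move=> i _; rewrite scalerBl.
by rewrite sumrB E2 subrr.
Qed.

(** By affine independence the matrix with rows [(z j, 1)] is row free; a right inverse [D] recovers
    the weights linearly from the point. *)
Lemma affine_weights_bound : exists2 K, 0 < K & forall (l : I -> R) (e : R), 0 < e ->
  \sum_(j in J) l j = 0 -> (forall i, `|(\sum_(j in J) l j *: z j) 0 i| < e) ->
  forall j, j \in J -> `|l j| <= K * e.
Proof.
pose M : 'M[R]_(#|J|, d + 1) := row_mx (\matrix_i z (enum_val i)) (const_mx 1).
pose lr (l : I -> R) : 'rV[R]_#|J| := \row_i l (enum_val i).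
have lM l : lr l *m M = row_mx (\sum_(j in J) l j *: z j) (const_mx (\sum_(j in J) l j)).
  rewrite mul_mx_row; congr row_mx; apply/rowP => i; rewrite !mxE.
    by rewrite [RHS]summxE [RHS]big_enum_val; apply: eq_bigr => j _; rewrite !mxE.
  by rewrite [RHS]big_enum_val; apply: eq_bigr => j _; rewrite !mxE mulr1.
have /row_freeP[D DE] : row_free M.
  apply/inj_row_free => v vM.
  have [j0|j0] := pickP (mem J); last first.
    by apply/rowP => i; have := j0 (enum_val i); rewrite /= enum_valP.
  move=> j0J; pose l j := v 0 (enum_rank_in j0J j).
  have vE : v = lr l by apply/rowP => i; rewrite mxE /l enum_valK_in.
  move: vM; rewrite vE lM -row_mx0 => /eq_row_mx[h1 h2].
  apply/rowP => i; rewrite !mxE; apply: (zI (l := l)) => //; last exact: enum_valP.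
  by have := congr1 (fun X : 'rV_1 => X 0 0) h2; rewrite !mxE.
pose S := \sum_i \sum_j `|D i j|.
exists (1 + S); first by rewrite ltr_pwDl // sumr_ge0 // => i _; exact: sumr_ge0.
move=> l e e0 l0 le j jJ.
have -> : l j = (lr l) 0 (enum_rank_in jJ j) by rewrite mxE enum_rankK_in.
have -> : lr l = row_mx (\sum_(j in J) l j *: z j) 0 *m D.
  by rewrite -[lr l]mulmx1 -DE mulmxA lM l0.
have le' i : `|(row_mx (\sum_(j in J) l j *: z j) (0 : 'rV[R]_1)) 0 i| <= e.
  by rewrite mxE; case: (fintype.split i) => i'; [exact: ltW|rewrite mxE normr0 ltW].
rewrite mxE (le_trans (ler_norm_sum _ _ _)) //.
apply: (@le_trans _ _ (\sum_i `|D i (enum_rank_in jJ j)| * e)).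
  by apply: ler_sum => i _; rewrite normrM mulrC ler_wpM2l.
rewrite -mulr_suml ler_wpM2r ?(ltW e0) // ler_wpDl //.
by apply: ler_sum => i _; rewrite (bigD1 (enum_rank_in jJ j)) //= lerDl sumr_ge0.
Qed.

(** If the origin had weight 0 at j, the points [- s z_j] with small s > 0 would be in the affine
    hull with weight [- s] at j, hence outside the convex hull. Conversely, positive weights stay
    positive nearby by [affine_weights_bound]. *)
Lemma cell0P : J != finset.set0 -> cell z J 0 <->
  exists l : I -> R, (forall j, j \in J -> 0 < l j) /\ \sum_(j in J) l j *: z j = 0.
Proof.
move=> /set0Pn[j1 j1J]; split=> [[[p [a [l [Aa l0 l1 E]]]]]|[l [lp lz]]].
  have [l' [h1 h2 h3]] := hull_weights l Aa.
  move=> /nbhs0_rowP[e e0 H]; exists l'; split; last by rewrite h3 -E.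
  move=> j jJ; rewrite lt_neqAle h1 // andbT eq_sym; apply/negP => /eqP lj.
  pose s := e / (2 * (1 + \sum_i `|z j 0 i|)).
  have S0 : 0 <= \sum_i `|z j 0 i| by exact: sumr_ge0.
  have s0 : 0 < s by rewrite divr_gt0 // mulr_gt0 // ltr_pwDl.
  (* These weights of [- s z_j] are those of the origin scaled by 1 + s and lowered by s at j, so
     that their sum is still 1. *)
  pose m i := (1 + s) * l' i - (if i == j then s else 0).
  have mE : \sum_(i in J) m i *: z i = - s *: z j.
    rewrite (eq_bigr (fun i => (1 + s) *: (l' i *: z i) - (if i == j then s *: z j else 0))); last first.
      by move=> i _; rewrite /m scalerBl scalerA; case: eqP => [->|_]; rewrite ?scale0r.
    rewrite sumrB -scaler_sumr h3 -E scaler0 sub0r (bigD1 j) //= eqxx big1 ?addr0 ?scaleNr //.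
    by move=> i /andP[_ /negbTE->].
  have m1 : \sum_(i in J) m i = 1.
    rewrite /m sumrB -mulr_sumr h2 l1 mulr1 (bigD1 j) //= eqxx big1 ?addr0 ?addrK //.
    by move=> i /andP[_ /negbTE->].
  have [a' [l2 [h1' _ h2' h3']]] := weights_hull m.
  have aff : affine_hull (convex_hull (z @` [set` J])%classic) (- s *: z j).
    exists #|J|, a', l2; split; [move=> i|by rewrite h2'|by rewrite h3'].
    exists 1%N, (fun=> a' i), (fun=> 1); split=> [_|_||].
    - exact: h1'.
    - exact: ler01.
    - by rewrite big_ord1.
    - by rewrite big_ord1 scale1r.
  have [|p2 [a2 [w [Aa2 w0 w1 E2]]]] := H (- s *: z j) _ aff.
    move=> i; rewrite mxE normrM normrN (gtr0_norm s0) /s mulrAC ltr_pdivrMr; last by rewrite mulr_gt0 // ltr_pwDl.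
    rewrite ltr_pM2l //; have : `|z j 0 i| <= \sum_i `|z j 0 i| by rewrite (bigD1 i) //= lerDl sumr_ge0.
    by move: S0; move: (\sum_i _) => S; lra.
  have [w' [k1 k2 k3]] := hull_weights w Aa2.
  have := k1 w0 j; rewrite -(@affine_weights_unique m w') ?k2 ?k3 ?m1 ?mE ?w1 //.
  by rewrite /m lj mulr0 sub0r eqxx oppr_ge0 leNgt s0.
pose T := \sum_(j in J) l j.
have T0 : 0 < T by rewrite /T (bigD1 j1) //= ltr_pwDl ?lp // sumr_ge0 // => i /andP[/lp/ltW].
pose m j := l j / T.
have mp j : j \in J -> 0 < m j by move=> jJ; rewrite divr_gt0 // lp.
have m1 : \sum_(j in J) m j = 1 by rewrite -mulr_suml divff // gt_eqF.
have mz : \sum_(j in J) m j *: z j = 0.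
  rewrite (eq_bigr (fun j => T^-1 *: (l j *: z j))); last by move=> j _; rewrite scalerA mulrC.
  by rewrite -scaler_sumr lz scaler0.
have conv (w : I -> R) y : (forall j, j \in J -> 0 <= w j) -> \sum_(j in J) w j = 1 ->
    \sum_(j in J) w j *: z j = y -> convex_hull (z @` [set` J])%classic y.
  move=> w0 w1 wz; have [a [l' [h1 h2 h3 h4]]] := weights_hull w.
  by exists #|J|, a, l'; split=> //; [exact: h2|rewrite h3|rewrite h4].
split; first by apply: (conv m) => // j /mp/ltW.
have [K K0 HK] := affine_weights_bound.
have rad j : exists2 e, 0 < e & forall x, 0 < x < e -> j \in J -> K * x <= m j.
  have [jJ|_] := boolP (j \in J); last by exists 1.
  exists (m j / K); first by rewrite divr_gt0 // mp.
  by move=> x /andP[_ xe] _; rewrite mulrC -ler_pdivlMr // ltW.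
have [e e0 He] := finite_radius rad.
have e2 : 0 < e / 2 < e by apply/andP; split; lra.
apply/nbhs0_rowP; exists (e / 2); first by case/andP: e2.
move=> y ye [p [a [w [Aa w1 E]]]].
have [w' [k2 k3]] := affine_convex_weights w Aa.
apply: (conv w'); [|by rewrite k2|by rewrite k3].
move=> j jJ.
have := HK (fun j => w' j - m j) (e / 2) (proj1 (andP e2)).
rewrite sumrB k2 w1 m1 subrr => /(_ erefl).
rewrite (eq_bigr (fun j => w' j *: z j - m j *: z j)); last by move=> i _; rewrite scalerBl.
rewrite sumrB k3 mz subr0 -E => /(_ ye j jJ).
have := He _ e2 j jJ; have := ler_norm (- (w' j - m j)); rewrite normrN.
move: `|_| => q; lra.
Qed.

End CellGeometry.

(** * The crossing number *)

Section Crossing.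
Variable R : realType.

Lemma rowspanP (k n : nat) (M : 'M[R]_(k, n)) (v : 'rV[R]_n) :
  v \in rowspan M <-> exists c, v = c *m M.
Proof.
split=> [|[c ->]]; last first.
  rewrite mulmx_sum_row /rowspan; apply: rpred_sum => i _; apply: rpredZ.
  by apply: memv_span; apply: map_f; rewrite mem_enum.
rewrite /rowspan; set X := [seq _ | _ : _] => vX; rewrite (@coord_span _ _ _ (in_tuple X) v vX).
elim/big_ind: _ => [|x y [c ->] [c' ->]|i _]; first by exists 0; rewrite mul0mx.
  by exists (c + c'); rewrite mulmxDl.
have : (in_tuple X)`_i \in X by rewrite mem_nth.
case/mapP => s _ ->; exists (coord (in_tuple X) i v *: delta_mx 0 s).
by rewrite -scalemxAl -rowE.
Qed.

Lemma linear_quot_sum (N : nat) (Y : {vspace 'rV[R]_N}) (I : finType) (P : pred I) (l : I -> R) (w : I -> 'rV[R]_N) :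
  \sum_(i | P i) l i *: quot_proj Y (w i) = quot_proj Y (\sum_(i | P i) l i *: w i).
Proof.
have [lin ker _ _] := quot_projP Y.
elim/big_rec2: _ => [|i y1 y2 _ ->]; last by rewrite lin.
by apply/esym/eqP; rewrite ker mem0v.
Qed.

Variables (k m n r : nat) (C : 'M[R]_(k, n)) (Z : 'M[R]_(n, k + m)) (Y : {vspace 'rV[R]_(k + m)}).
Hypotheses (Cp : col_minors_pos C) (Zp : row_minors_pos Z) (r0 : (0 < r)%N).
Hypotheses (mE : m = r.*2.-1) (hn : (k + m <= n)%N).
Hypothesis YE : forall v, v \in Y <-> exists c, v = c *m (C *m Z).

Local Notation z := (fun i : 'I_n => quot_proj Y (row i Z)).

Lemma quot_dependency (J : {set 'I_n}) (l : 'I_n -> R) (a : 'rV[R]_n) :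
  (forall i, a 0 i = if i \in J then l i else 0) ->
  \sum_(i in J) l i *: z i = 0 <-> orth (ambient C Z) a.
Proof.
move=> aE; rewrite linear_quot_sum.
have -> : \sum_(i in J) l i *: row i Z = a *m Z.
  rewrite mulmx_sum_row big_mkcond /=; apply: eq_bigr => i _; rewrite aE.
  by case: ifP => // _; rewrite scale0r.
have [_ ker _ _] := quot_projP Y.
have -> : quot_proj Y (a *m Z) = 0 <-> a *m Z \in Y by rewrite -ker; split=> [->|/eqP].
split=> [/YE[c E]|/ambient_orthP[c E]]; [apply/ambient_orthP|apply/YE]; exists c.
  by rewrite mulmxBl E mulmxA subrr.
by apply/eqP; rewrite -subr_eq0 mulmxA -mulmxBl E.
Qed.

Lemma cell_ofP (J : {set 'I_n}) :
  (cell_index r z J /\ cell z J 0) <-> cell_of r (ambient C Z) J.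
Proof.
have gB : sign_bounded k r (ambient C Z) by apply: ambient_bounded_pos => //; rewrite mE.
split=> [[[[K [i [ib ig iK]] JK] J0 zI] /(cell0P zI J0)[l [lp lz]]]|[g [ag J0 Jg [a aW ha]]]].
  pose g s := if insub s is Some t then i t else 0%N.
  have gE (s : 'I_r) : g s = i s by rewrite /g valK.
  exists g; split=> //.
  - split=> s sr.
      have sr' : (s < r)%N by lia.
      rewrite -[s]/(nat_of_ord (Ordinal sr')) -[s.+1]/(nat_of_ord (Ordinal sr)) !gE.
      exact: ig.
    by rewrite -[s]/(nat_of_ord (Ordinal sr)) gE.
  - move=> j jJ; have /iK[s Es] := fintype.subsetP JK j jJ.
    by exists s; rewrite ?gE.
  - exists (\row_j if j \in J then l j else 0).
      by apply/(quot_dependency (J := J) (l := l)) => // j; rewrite mxE.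
    by move=> j; rewrite mxE; split=> [jJ|/negbTE->//]; rewrite jJ lp.
have [gg gn] := ag.
have a0 : a != 0.
  by apply/eqP => E; have /set0Pn[i iJ] := J0; have := (ha i).1 iJ; rewrite E mxE ltxx.
have sag : supported (in_pairs r g) a.
  by move=> i ai; apply: Jg; apply: contraR ai => /(ha i).2->.
(* Every linear dependency on [J] is a multiple of [a], whose entries have a positive sum; sum 0
   forces the multiple to be zero. *)
have zI : affinely_independent z J.
  move=> l l0 lz; pose b : 'rV[R]_n := \row_j if j \in J then l j else 0.
  have bW : orth (ambient C Z) b.
    by apply/(quot_dependency (J := J) (l := l)) => // j; rewrite mxE.
  have sb : supported (in_pairs r g) b by move=> i; rewrite mxE; case: ifP => [/Jg//|]; rewrite eqxx.
  have [x Ex] := dependency_line gB ag aW bW a0 sag sb.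
  have lx j : j \in J -> l j = x * a 0 j.
    by move=> jJ; have := congr1 (fun X : 'rV_n => X 0 j) Ex; rewrite !mxE jJ.
  have S0 : 0 < \sum_(j in J) a 0 j.
    have /set0Pn[i iJ] := J0; rewrite (bigD1 i) //= ltr_pwDl ?(ha i).1 // sumr_ge0 // => j /andP[jJ _].
    by apply: ltW; exact: (ha j).1.
  move: l0; rewrite (eq_bigr _ lx) -mulr_sumr => /eqP; rewrite mulf_eq0 (gt_eqF S0) orbF => /eqP x0.
  by move=> j /lx ->; rewrite x0 mul0r.
split; first split=> //.
  exists (@pair_set n r g); last by apply/fintype.subsetP => i /Jg; rewrite inE => ?; apply/asboolP.
  exists (fun s : 'I_r => g s); split; first by move=> s; exact: gn.
    by move=> s t st; have := gapped_lt gg (s := s) (t := t); rewrite st ltn_ord => /(_ isT).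
  move=> j; rewrite inE; split=> [/asboolP[s sr Ej]|[s Ej]]; first by exists (Ordinal sr).
  by apply/asboolP; exists s.
apply/(cell0P zI J0); exists (fun j => a 0 j); split; first by move=> j; exact: (ha j).1.
apply/(quot_dependency (a := a)) => // i; case: ifP => // /negbT; exact: (ha i).2.
Qed.

Lemma crossing_number_ncells : m.+1./2 = r -> crossing_number Y Z = ncells r (ambient C Z).
Proof.
move=> rE; rewrite /crossing_number rE; apply: eq_card => J.
by apply: asbool_equiv_eq; exact: cell_ofP.
Qed.

End Crossing.

Lemma crossing_formula (k m r : nat) : (0 < r)%N -> m = r.*2.-1 ->
  ('C((k + m)./2, r) + 'C((k + m).-1./2, r))%:R =
    (if odd k then
       (2 * k + m - 1)%:R / (m + 1)%:R * 'C((k + m - 2)./2, (m - 1)./2)%:R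
     else 2 * 'C((k + m - 1)./2, (m + 1)./2)%:R) :> rat.
Proof.
case: r => // r _ ->.
have -> : (r.+1.*2.-1 + 1)./2 = r.+1 by lia.
have -> : (r.+1.*2.-1 - 1)./2 = r by lia.
case: ifP => ok; last first.
  have -> : (k + r.+1.*2.-1)./2 = (k + r.+1.*2.-1 - 1)./2 by lia.
  by rewrite subn1 natrD -mulr2n mulr_natl.
pose q := k./2; have kE : k = q.*2.+1 by rewrite /q; lia.
have -> : (k + r.+1.*2.-1)./2 = (q + r).+1 by lia.
have -> : (k + r.+1.*2.-1).-1./2 = (q + r)%N by lia.
have -> : (k + r.+1.*2.-1 - 2)./2 = (q + r)%N by lia.
have -> : (2 * k + r.+1.*2.-1 - 1 = 2 * (q.*2 + r.+1))%N by lia.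
have -> : (r.+1.*2.-1 + 1 = 2 * r.+1)%N by lia.
have d0 : (2 * r.+1)%:R != 0 :> rat by rewrite pnatr_eq0.
rewrite [RHS]mulrAC; apply: (canRL (mulfK d0)); rewrite -!natrM; congr (_%:R).
(* Multiplied by r + 1, the two binomials are q + r + 1 and q times ['C(q + r, r)], together 2q + r
   + 1 times it. *)
have e1 := mul_bin_diag (q + r).+1 r; have e2 := mul_bin_left (q + r) r.
by rewrite /= addnK in e1 e2; nia.
Qed.

Theorem theorem2 (R : realType) (k m n : nat) (hm1 : (1 <= m)%N) (hm : odd m)
  (hn : (k + m <= n)%N) (Z : 'M[R]_(n, k + m)) (hZ : row_minors_pos Z)
  (Y : {vspace 'rV[R]_(k + m)}) (hY : amplituhedron Z Y) :
  (crossing_number Y Z)%:R =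
    (if odd k then
       (2 * k + m - 1)%:R / (m + 1)%:R * 'C((k + m - 2)./2, (m - 1)./2)%:R
     else 2 * 'C((k + m - 1)./2, (m + 1)./2)%:R) :> rat.
Proof.
have [C0 [[_ [C [CE Cp]]] YE]] := hY.
pose r := m.+1./2; have r0 : (0 < r)%N by rewrite /r; lia.
have mE : m = r.*2.-1 by rewrite /r; lia.
(* The matrix [C0] that represents Y has the same row space as [C], whose minors are positive, so
   [C] represents Y as well. *)
have YP v : v \in Y <-> exists c, v = c *m (C *m Z).
  rewrite -YE; split=> [/rowspanP[c ->]|[c ->]].
    have : c *m C0 \in rowspan C0 by apply/rowspanP; exists c.
    by rewrite -CE => /rowspanP[c' E]; exists c'; rewrite !mulmxA E.
  have : c *m C \in rowspan C by apply/rowspanP; exists c.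
  by rewrite CE => /rowspanP[c' E]; apply/rowspanP; exists c'; rewrite !mulmxA E.
rewrite (crossing_number_ncells Cp hZ r0 mE hn YP erefl).
rewrite (@ncells_ambient R (n - (k + m)) k n (k + m) r C Z) //; [|lia|by rewrite {1}mE].
exact: crossing_formula.
Qed.
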